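(* Let $X$ be a random variable in $\mathbb{R}^d$ with $X\in B(0,R)$ almost surely (where $R>0$) and $\mathbb{E}[X]=0$. There exists $T_0$ depending only on $\mathcal{L}(X)$ such that the following holds for all $T\ge T_0$. Let $\epsilon>0$ and $N\ge 1$ be such that $T>\epsilon$ and $h=\frac{T-\epsilon}{N}$ satisfies $h\le \epsilon\le R^2$. Let $s_\theta$ satisfy Assumption 2 (stated in the context). Let $\hat X=\hat X_N$ be the output of the Euler–Maruyama sampler: $\hat X_0\sim\mathcal{N}(0,TI)$ and, for $n=1,\dots,N$, with $t_n=nh$, $$\hat X_n=\hat X_{n-1}+h\, s_\theta(T-t_{n-1},\hat X_{n-1})+Z_n,$$ where $Z_1,\dots,Z_N\sim\mathcal{N}(0,hI)$ are independent and independent of $\hat X_0$. Then $$W_2(\mathcal{L}(X),\mathcal{L}(\hat X))\le \sqrt{d\epsilon}+\frac{2\epsilon}{T^{3/2}}\exp\left(\frac{R^2}{\epsilon}\right)R^2+\sqrt{2d}\,\frac{R^2}{\epsilon}\exp\left(\frac{R^2}{\epsilon}\right)\sqrt h+2\epsilon\exp\left(\frac{R^2}{\epsilon}\right)h\sum_{k=1}^{N}\frac{\varepsilon_{\mathrm{score}}(\epsilon+hk)}{\epsilon+hk}.$$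
   Context: $B(0,R)$ is the closed Euclidean ball; $\mathcal{L}(Y)$ is the law of $Y$; $\|Y\|_{L_2}=(\mathbb{E}\|Y\|^2)^{1/2}$; $W_2$ is the Wasserstein-2 distance on $\mathbb{R}^d$ for the Euclidean norm. Forward process: $X_t=X+B_t$, with $B$ a standard Brownian motion in $\mathbb{R}^d$ independent of $X$ (so $B_t\sim\mathcal{N}(0,tI)$); $p_t$ is the density of $X_t$, $t>0$. $s_\theta:\mathbb{R}\times\mathbb{R}^d\to\mathbb{R}^d$ is a given function (an approximation of $(t,x)\mapsto\nabla\log p_t(x)$), with error $\varepsilon_{\mathrm{score}}(t)=\|\nabla\log p_t(X_t)-s_\theta(t,X_t)\|_{L_2}$. Assumption 2: for $t>0$, $x\mapsto s_\theta(t,x)$ is $C_t$-Lipschitz with $C_t=\max\left(\frac1t,\left|\frac{R^2}{t^2}-\frac1t\right|\right)$; and for all $0<h'\le\epsilon\le t$, the map $x\mapsto x+h's_\theta(t,x)$ is $L_{t,h'}$-Lipschitz with $L_{t,h'}=1+h'\left(\frac{R^2}{t^2}-\frac1t\right)$. *)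

(* Defs.v *)
From HB Require Import structures.
From mathcomp Require Import all_boot all_order all_algebra.
From mathcomp Require Import all_classical all_reals all_analysis.

Set Implicit Arguments.
Unset Strict Implicit.
Unset Printing Implicit Defensive.

Import Order.TTheory GRing.Theory Num.Theory.
Import numFieldNormedType.Exports.

Local Open Scope classical_set_scope.
Local Open Scope ring_scope.
Local Open Scope ereal_scope.

(* R^n is the type 'rV[R]_n of row vectors.  It carries the sigma-algebra
   generated by the coordinates, i.e. the Borel one.  The library norm `|v| on
   'rV[R]_n is the sup norm, hence the separate Euclidean norm enorm below. *)
Definition rowvec_display : measure_display.
Proof. exact: default_measure_display. Qed.

Section rowvec_measurable.
Context (R : realType) (n : nat).

Definition rowvec_coord (i : 'I_n) (v : 'rV[R]_n) : R := v ord0 i.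

Let rowvec_set0 : g_sigma_preimage rowvec_coord set0.
Proof. exact: sigma_algebra0. Qed.

Let rowvec_setC A : g_sigma_preimage rowvec_coord A ->
  g_sigma_preimage rowvec_coord (~` A).
Proof. exact: sigma_algebraC. Qed.

Let rowvec_bigcup (F : (set 'rV[R]_n)^nat) :
  (forall i, g_sigma_preimage rowvec_coord (F i)) ->
  g_sigma_preimage rowvec_coord (\bigcup_i (F i)).
Proof. exact: sigma_algebra_bigcup. Qed.

HB.instance Definition _ := Pointed.on 'rV[R]_n.
HB.instance Definition _ := @isMeasurable.Build rowvec_display 'rV[R]_n
  (g_sigma_preimage rowvec_coord) rowvec_set0 rowvec_setC rowvec_bigcup.

End rowvec_measurable.

Section rowvec_measurable_fun.
Context (R : realType) (n : nat).

Lemma measurable_rowvec_coord (i : 'I_n) :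
  measurable_fun [set: 'rV[R]_n] (fun v : 'rV[R]_n => v ord0 i).
Proof.
move=> _ Y mY; rewrite setTI; apply: sub_sigma_algebra => /=.
rewrite -bigcup_seq/=; exists i => /=; first by rewrite mem_index_enum.
by exists Y => //; rewrite setTI.
Qed.

Lemma measurable_fun_rowvec d (T : measurableType d) (f : T -> 'rV[R]_n) :
  (forall i, measurable_fun [set: T] (fun x => f x ord0 i)) ->
  measurable_fun [set: T] f.
Proof.
move=> mf.
have H : g_sigma_preimage (fun i => @rowvec_coord R n i \o f) `<=` measurable.
  apply: smallest_sub; first exact: sigma_algebra_measurable.
  rewrite -bigcup_seq/=; apply: bigcup_sub => i _ _ [B mB <-].
  exact: mf.
move=> _ A mA; apply: H; rewrite g_sigma_preimage_comp; by exists A.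
Qed.

End rowvec_measurable_fun.

Section power_measure.
Context (R : realType).

Definition rowvec_cons n (xv : measurableTypeR R * 'rV[R]_n) : 'rV[R]_n.+1 :=
  \row_i (if unlift ord0 i is Some j then xv.2 ord0 j else xv.1).

Definition rowvec_uncons n (v : 'rV[R]_n.+1) : measurableTypeR R * 'rV[R]_n :=
  (v ord0 ord0, \row_j v ord0 (lift ord0 j)).

Lemma rowvec_consK n : cancel (@rowvec_cons n) (@rowvec_uncons n).
Proof.
move=> [x v]; rewrite /rowvec_uncons /rowvec_cons mxE unlift_none; congr pair.
by apply/rowP => j; rewrite !mxE liftK.
Qed.

Lemma measurable_rowvec_cons n : measurable_fun setT (@rowvec_cons n).
Proof.
apply: measurable_fun_rowvec => i.
case: (unliftP ord0 i) => [j ->|->].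
- under eq_fun do rewrite mxE liftK.
  by apply: (measurableT_comp (@measurable_rowvec_coord R n j)).
- under eq_fun do rewrite mxE unlift_none.
  exact: measurable_fst.
Qed.

Lemma measurable_rowvec_uncons n : measurable_fun setT (@rowvec_uncons n).
Proof.
apply: measurable_fun_pair; first exact: measurable_rowvec_coord.
apply: measurable_fun_rowvec => i; under eq_fun do rewrite mxE.
exact: measurable_rowvec_coord.
Qed.

HB.instance Definition _ n := @isMeasurableFun.Build _ _ _ _ (@rowvec_cons n)
  (@measurable_rowvec_cons n).

Section step.
Context (m : {sigma_finite_measure set (measurableTypeR R) -> \bar R}) (n : nat).
Context (mn : {sigma_finite_measure set 'rV[R]_n -> \bar R}).

Definition power_step : set 'rV[R]_n.+1 -> \bar R :=
  pushforward (m \x mn) (@rowvec_cons n).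

Let power_step0 : power_step set0 = 0.
Proof. exact: measure0. Qed.

Let power_step_ge0 A : 0 <= power_step A.
Proof. exact: measure_ge0. Qed.

Let power_step_sigma_additive : semi_sigma_additive power_step.
Proof. exact: measure_semi_sigma_additive. Qed.

HB.instance Definition _ := isMeasure.Build _ _ _ power_step
  power_step0 power_step_ge0 power_step_sigma_additive.

Let power_step_sigma_finite : sigma_finite setT power_step.
Proof.
have /sigma_finiteP[F [TF ndF Foo]] := sigma_finiteT m.
have /sigma_finiteP[G [TG ndG Goo]] := sigma_finiteT mn.
exists (fun k => @rowvec_uncons n @^-1` (F k `*` G k)).
  rewrite -preimage_bigcup; apply/esym/seteqP; split=> // v _ /=.
  case: (rowvec_uncons v) => x w.
  have [i _ Fix] : (\bigcup_i F i) x by rewrite -TF.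
  have [j _ Gjw] : (\bigcup_i G i) w by rewrite -TG.
  exists (maxn i j) => //; split.
  - by move: x Fix; exact/subsetPset/ndF/leq_maxl.
  - by move: w Gjw; exact/subsetPset/ndG/leq_maxr.
move=> k; have [mF Fk] := Foo k; have [mG Gk] := Goo k; split.
  rewrite -[X in measurable X]setTI; apply: measurable_rowvec_uncons => //.
  exact: measurableX.
rewrite /power_step /pushforward -comp_preimage.
rewrite (_ : _ \o _ = id); last first.
  by apply/funext => x; rewrite /= rowvec_consK.
by rewrite preimage_id product_measure1E// lte_mul_pinfty// ge0_fin_numE.
Qed.

HB.instance Definition _ := Measure_isSigmaFinite.Build _ _ _ power_step
  power_step_sigma_finite.

End step.

(* n-fold product of m, characterized by power_measure_box below. *)
Fixpoint power_measure
    (m : {sigma_finite_measure set (measurableTypeR R) -> \bar R})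
    (n : nat) : {sigma_finite_measure set 'rV[R]_n -> \bar R} :=
  match n with
  | 0%N => \d_(0%R : 'rV[R]_0)
  | n'.+1 => power_step m (power_measure m n')
  end.

Lemma power_measure_box m n (A : 'I_n -> set (measurableTypeR R)) :
  (forall i, measurable (A i)) ->
  power_measure m n [set v : 'rV[R]_n | forall i, A i (v ord0 i)] =
  \prod_(i < n) m (A i).
Proof.
elim: n A => [|n IH] A mA.
  rewrite big_ord0 /= diracE mem_set//= => -[].
  by [].
rewrite big_ord_recl /= /power_step /pushforward.
rewrite -(IH (fun i => A (lift ord0 i)))//.
rewrite -product_measure1E//.
  congr (product_measure1 _ _ _); apply/seteqP; split => -[x v] /=.
    move=> H; split.
      by have := H ord0; rewrite mxE unlift_none.
    by move=> i; have := H (lift ord0 i); rewrite mxE liftK.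
  move=> [Hx Hv] i; rewrite mxE.
  by case: unliftP => [j ->|->] //; exact: Hv.
rewrite (_ : mkset _ = \bigcap_(i in [set: 'I_n])
    ((fun v : 'rV[R]_n => v ord0 i) @^-1` A (lift ord0 i))).
  apply: fin_bigcap_measurable => // i _.
  rewrite -[X in measurable X]setTI; apply: measurable_rowvec_coord => //.
  exact: mA.
by apply/seteqP; split => v /= H i => [_|]; exact: H.
Qed.

End power_measure.

Section euclidean_space.
Context (R : realType) (n : nat).
Local Open Scope ring_scope.

Definition enorm (v : 'rV[R]_n) : R := Num.sqrt (\sum_(i < n) v ord0 i ^+ 2).

Definition elipschitz (L : R) (f : 'rV[R]_n -> 'rV[R]_n) : Prop :=
  forall x y, enorm (f x - f y) <= L * enorm (x - y).

Definition gradient (f : 'rV[R]_n -> R) (x : 'rV[R]_n) : 'rV[R]_n :=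
  \row_i derive f x (delta_mx ord0 i).

Definition lebesgue_rowvec : {sigma_finite_measure set 'rV[R]_n -> \bar R} :=
  power_measure (@lebesgue_measure R) n.

(* N(0, t I), for t > 0; the last argument of normal_prob is the standard
   deviation. *)
Definition gaussian (t : R) : {sigma_finite_measure set 'rV[R]_n -> \bar R} :=
  power_measure (normal_prob 0 (Num.sqrt t)) n.

End euclidean_space.

Section probability_notions.
Context d (Omega : measurableType d) (R : realType) (P : probability Omega R).

Definition has_law d' (E : measurableType d') (Y : Omega -> E)
    (nu : set E -> \bar R) : Prop :=
  forall A, measurable A -> P (Y @^-1` A) = nu A.

Definition mutually_independent d' (E : measurableType d') (I : eqType)
    (D : set I) (Y : I -> Omega -> E) : Prop :=
  forall (s : seq I) (A : I -> set E), uniq s -> [set` s] `<=` D ->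
    (forall i, measurable (A i)) ->
    P (\bigcap_(i in [set` s]) (Y i @^-1` A i)) =
    \prod_(i <- s) P (Y i @^-1` A i).

(* Independence of Y from the sigma-algebra generated by the whole family
   (Z i)_(i in D), tested on the cylinders, a generating pi-system. *)
Definition independent_of_family d1 (E1 : measurableType d1)
    d2 (E2 : measurableType d2) (I : eqType) (D : set I)
    (Y : Omega -> E1) (Z : I -> Omega -> E2) : Prop :=
  forall (s : seq I) (A : set E1) (C : I -> set E2), uniq s ->
    [set` s] `<=` D -> measurable A -> (forall i, measurable (C i)) ->
    P (Y @^-1` A `&` \bigcap_(i in [set` s]) (Z i @^-1` C i)) =
    P (Y @^-1` A) * P (\bigcap_(i in [set` s]) (Z i @^-1` C i)).

(* Only the values B t for t >= 0 are relevant. *)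
Definition standard_brownian_motion n (B : R -> {RV P >-> 'rV[R]_n}) : Prop :=
  [/\ {ae P, forall w, B 0%R w = 0%R},
      forall s t : R, (0 <= s)%R -> (s < t)%R ->
        has_law (fun w => B t w - B s w)%R (gaussian n (t - s)%R),
      forall t : nat -> R, (0 <= t 0%N)%R -> nondecreasing_seq t ->
        mutually_independent [set: nat]
          (fun i w => B (t i.+1) w - B (t i) w)%R &
      {ae P, forall w, {within `[0%R, +oo[, continuous (fun t : R => B t w)}}].

(* p is the density of Y with respect to the Lebesgue measure.  Continuity
   selects the representative whose gradient is taken. *)
Definition continuous_density n (Y : Omega -> 'rV[R]_n)
    (p : 'rV[R]_n -> R) : Prop :=
  [/\ continuous p, forall x, (0 <= p x)%R &
      has_law Y (fun A => \int[lebesgue_rowvec R n]_(x in A) (p x)%:E)].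

Definition L2norm n (Y : Omega -> 'rV[R]_n) : \bar R :=
  'N[P]_2%:E [EFin \o @enorm R n \o Y].

Definition score_error n (Y : Omega -> 'rV[R]_n) (p : 'rV[R]_n -> R)
    (s : 'rV[R]_n -> 'rV[R]_n) : \bar R :=
  L2norm (fun w => gradient (fun x => ln (p x)) (Y w) - s (Y w))%R.

End probability_notions.

Section wasserstein.
Context (R : realType) (n : nat).

Definition coupling (mu nu : set 'rV[R]_n -> \bar R)
    (gamma : probability ('rV[R]_n * 'rV[R]_n)%type R) : Prop :=
  has_law gamma fst mu /\ has_law gamma snd nu.

Definition W2 (mu nu : set 'rV[R]_n -> \bar R) : \bar R :=
  ereal_inf [set L2norm gamma (fun z => (z.1 - z.2)%R) | gamma in coupling mu nu].

End wasserstein.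

Section sampler.
Context (R : realType) (n : nat).
Local Open Scope ring_scope.

(* The parameter r is the radius of the ball containing the support of X. *)
Definition score_lipschitz_assumption (r eps : R)
    (s : R -> 'rV[R]_n -> 'rV[R]_n) : Prop :=
  (forall t, 0 < t ->
     elipschitz (Num.max (1 / t) `|r ^+ 2 / t ^+ 2 - 1 / t|) (s t)) /\
  (forall h t, 0 < h -> h <= eps -> eps <= t ->
     elipschitz (1 + h * (r ^+ 2 / t ^+ 2 - 1 / t)) (fun x => x + h *: s t x)).

Definition euler_maruyama_sampler d (Omega : measurableType d)
    (Q : probability Omega R) (s : R -> 'rV[R]_n -> 'rV[R]_n) (T h : R)
    (N : nat) (Xh Z : nat -> {RV Q >-> 'rV[R]_n}) : Prop :=
  [/\ has_law Q (Xh 0%N) (gaussian n T),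
      forall k, (1 <= k <= N)%N -> has_law Q (Z k) (gaussian n h),
      mutually_independent Q [set k | (1 <= k <= N)%N] Z,
      independent_of_family Q [set k | (1 <= k <= N)%N] (Xh 0%N) Z &
      forall k, (1 <= k <= N)%N -> forall w,
        Xh k w = Xh k.-1 w + h *: s (T - k.-1%:R * h) (Xh k.-1 w) + Z k w].

End sampler.

(* Main.v *)
(* Write m_t(y) = E[X | X_t = y].  Then grad log p_t(y) = (m_t(y) - y) / t, since
   p_t is the N(0, tI) density times y |-> E exp((<y, X> - |X|^2 / 2) / t).  Given
   X_t = y, draw X from its posterior and G from N(0, I): the bridge
   y + (h/t)(X - y) + sqrt(h(t-h)/t) G has the law of X_(t-h), because X + B_t
   can be rewritten with two independent Gaussians.  Coupling this exact backward
   step with the Euler step through the same G, the L2 error obeys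
   e' <= sqrt((L_{t,h} e + h eps_score(t))^2 + v),  v <= 2 d R^2 (h/t)^2,
   where v gathers the fluctuation of X around m_t(y) and the mismatch of the two
   noise intensities.  Since 1 + a - b <= e^a / (1 + b), the product of the
   Lipschitz factors of the last j steps is at most
   exp(R^2/eps - R^2/t_j) (eps + h) / (t_j + h), with t_j = eps + h j, and the
   v's sum to a multiple of sum_j (h/t_j)^2 <= h/eps.

   The initial error W_2(law X_T, N(0, TI)) <= R^2 / sqrt T for centred X and
   T >= 8 R^2 is obtained with the same coupling, run with the exact Gaussian
   score: contracting times t -> c t by c < 1 close to 1 turns an error e into
   essentially c e + (1 - c) |m_t(X_t)|_2, and |m_t(X_t)|_2 <= (9/8) R^2 / sqrt t.
   The last posterior draw, from X_eps to X, costs sqrt(d eps).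

   T0 may depend on mu only while R may be any valid radius, so T0 is
   8 r^2 for one fixed admissible radius r of mu. *)
Require Import Defs.
From HB Require Import structures.
From mathcomp Require Import all_boot all_order all_algebra.
From mathcomp Require Import all_classical all_reals all_analysis.
From mathcomp Require Import measurable_realfun.
From mathcomp Require Import ring lra.


Set Implicit Arguments.
Unset Strict Implicit.
Unset Printing Implicit Defensive.

Import Order.TTheory GRing.Theory Num.Theory.
Import numFieldNormedType.Exports.

Local Open Scope classical_set_scope.
Local Open Scope ring_scope.

(** * Change of variables under a measure *)

(** Conditional laws are never formed: the posterior of [X] given [y] is the explicit density
    [cameron_martin t y z / mixture mu t y] with respect to [mu], and marginals are tracked as
    identities between integrals of nonnegative functions. The convolution of Gaussians is not
    computed but read off the increments of the given Brownian motion.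

    The obstacle is that the noise terms [v] must not add up like the score errors: a sum of the
    [sqrt v] would not vanish with [h]. The error is therefore carried as [A + sqrt V]. By
    [sqrt_chain_le], [A] evolves linearly and [V] quadratically, and only [V] receives the [v], so
    the noise costs the root of their sum, of order [sqrt h].

    For the initial error, a bound [beta r^2 / sqrt t] survives the passage from [t] to [c t], to
    first order in [1 - c], as soon as [3/2 beta >= 9/8]. This gives the stationary level [3/4]; the
    remaining quarter pays, half each, for forgetting the starting coupling and for the posterior
    noise. *)

Lemma measurable_fun_EFin d (T : measurableType d) (R : realType) (g : T -> R) :
  measurable_fun setT g -> measurable_fun setT (fun x => (g x)%:E).
Proof. by move=> mg; apply/measurable_EFinP. Qed.

Section weighted_image.
Local Open Scope ereal_scope.
Context d1 d2 (T1 : measurableType d1) (T2 : measurableType d2) (R : realType).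
Context (m1 : {measure set T1 -> \bar R}) (m2 : {measure set T2 -> \bar R}).
Context (phi : T1 -> T2) (g : T1 -> R).
Hypothesis mphi : measurable_fun setT phi.
Hypothesis mg : measurable_fun setT g.
Hypothesis g0 : forall x, (0 <= g x)%R.
Hypothesis m2E : forall A, measurable A ->
  m2 A = \int[m1]_(x in phi @^-1` A) (g x)%:E.

Import HBNNSimple.

(** The hypothesis on sets extends to simple functions by linearity and to [f] by monotone
    convergence. Pushforwards ([g = 1]), densities ([phi = id]) and affine substitutions (constant
    Jacobian [g]) are all instances. *)
Lemma ge0_integral_weighted_image (f : T2 -> \bar R) :
  measurable_fun setT f -> (forall x, 0 <= f x) ->
  \int[m2]_y f y = \int[m1]_x (f (phi x) * (g x)%:E).
Proof.
move=> mf f0; pose h := nnsfun_approx measurableT mf.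
have mhphi n : measurable_fun setT (h n \o phi) by exact: measurableT_comp.
have mhphiE n : measurable_fun setT (fun x => (h n (phi x))%:E).
  exact: (measurable_fun_EFin (mhphi n)).
have mgE : measurable_fun setT (fun x => (g x)%:E).
  exact: measurable_fun_EFin.
have mind n r : measurable_fun setT (\1_(h n @^-1` [set r]) \o phi : T1 -> R).
  exact: measurableT_comp.
have fE y : f y = limn (EFin \o h ^~ y).
  by apply/esym/cvg_lim => //; exact: cvg_nnsfun_approx.
have -> : \int[m2]_y f y = limn (fun n => \int[m2]_y (EFin \o h n) y).
  under eq_integral do rewrite fE.
  apply: monotone_convergence => //.
  - by move=> n; apply/measurable_EFinP.
  - by move=> n x _ /=; rewrite lee_fin.
  - by move=> x _ a b ab; rewrite lee_fin; exact/lefP/nd_nnsfun_approx.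
have -> : \int[m1]_x (f (phi x) * (g x)%:E) =
    limn (fun n => \int[m1]_x ((h n (phi x))%:E * (g x)%:E)).
  have fgE x : f (phi x) * (g x)%:E =
      limn (fun n => (h n (phi x))%:E * (g x)%:E).
    apply/esym/cvg_lim => //; apply: cvgeZr => //.
    exact: cvg_nnsfun_approx.
  under eq_integral do rewrite fgE.
  apply: monotone_convergence => //.
  - by move=> n; apply: emeasurable_funM.
  - by move=> n x _ /=; rewrite mule_ge0 ?lee_fin.
  - move=> x _ a b ab; rewrite lee_wpmul2r ?lee_fin//.
    exact/lefP/nd_nnsfun_approx.
congr (limn _); apply/funext => n.
transitivity (\sum_(r \in range (h n)) r%:E * m2 (h n @^-1` [set r])).
  transitivity (\int[m2]_y
      (\sum_(r \in range (h n)) (r * \1_(h n @^-1` [set r]) y)%:E)).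
    by apply: eq_integral => y _; rewrite /= fimfunE -fsumEFin.
  rewrite ge0_integral_fsum//.
  - apply: eq_fsbigr => r rhn; rewrite integralZl_indic_nnsfun//.
    by rewrite integral_indic// setIT.
  - by move=> r; apply/measurable_EFinP/measurable_funM.
  - by move=> r y _; exact: nnfun_muleindic_ge0.
transitivity (\int[m1]_x (\sum_(r \in range (h n))
    (r * \1_(h n @^-1` [set r]) (phi x))%:E * (g x)%:E)); last first.
  apply: eq_integral => x _.
  rewrite -ge0_mule_fsuml => [|y]; last exact: nnfun_muleindic_ge0.
  by rewrite fsumEFin // -(fimfunE _ (phi x)).
rewrite ge0_integral_fsum//; last 2 first.
  - move=> r; apply: emeasurable_funM => //; apply: measurable_fun_EFin.
    by apply: measurable_funM => //; exact: mind.
  - by move=> r x _; rewrite mule_ge0 ?lee_fin// -lee_fin nnfun_muleindic_ge0.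
apply: eq_fsbigr => r rhn.
(* Pulling the constant out requires [0 <= r]; a negative [r] has an empty level set, and both terms
   vanish. *)
have [r0|r0] := leP 0%R r; last first.
  rewrite (preimage_nnfun0 _ r0) measure0 mule0 integral0_eq// => x _.
  by rewrite indic0 mulr0 mul0e.
under eq_integral do rewrite EFinM -muleA.
rewrite ge0_integralZl//; last 2 first.
- by apply: emeasurable_funM => //; apply: measurable_fun_EFin; exact: mind.
- by move=> x _; rewrite mule_ge0// lee_fin.
congr (_ * _); rewrite m2E//.
under [RHS]eq_integral do rewrite muleC -EFinM.
by rewrite [in LHS]integral_mkcond/= restrict_EFin; apply: eq_integral => x _;
  rewrite patch_indic.
Qed.

End weighted_image.

Lemma ge0_integral_image d1 d2 (T1 : measurableType d1) (T2 : measurableType d2)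
    (R : realType) (m1 : {measure set T1 -> \bar R})
    (m2 : {measure set T2 -> \bar R}) (phi : T1 -> T2) (f : T2 -> \bar R) :
  measurable_fun setT phi ->
  (forall A, measurable A -> m2 A = m1 (phi @^-1` A)) ->
  measurable_fun setT f -> (forall x, 0 <= f x)%E ->
  (\int[m2]_y f y = \int[m1]_x f (phi x))%E.
Proof.
move=> mphi m2E mf f0.
rewrite (@ge0_integral_weighted_image _ _ _ _ R m1 m2 phi (fun=> 1))//.
  by apply: eq_integral => w _; rewrite mule1.
move=> A mA; rewrite m2E// (eq_integral (cst 1%E))//.
rewrite integral_cst ?mul1e//.
by rewrite -[X in measurable X]setTI; exact: mphi.
Qed.

(** * The Euclidean norm *)

Section euclidean_norm.
Context (R : realType) (d : nat).
Implicit Types (u v x y z : 'rV[R]_d) (a b : R).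

Definition dot u v : R := \sum_(i < d) u ord0 i * v ord0 i.

Lemma dotC u v : dot u v = dot v u.
Proof. by apply: eq_bigr => i _; rewrite mulrC. Qed.

Lemma dotDl u v x : dot (u + v) x = dot u x + dot v x.
Proof. by rewrite -big_split; apply: eq_bigr => i _; rewrite mxE mulrDl. Qed.

Lemma dotZl a u v : dot (a *: u) v = a * dot u v.
Proof. by rewrite mulr_sumr; apply: eq_bigr => i _; rewrite mxE mulrA. Qed.

Lemma dotDr u v x : dot x (u + v) = dot x u + dot x v.
Proof. by rewrite dotC dotDl !(dotC x). Qed.

Lemma dotZr a u v : dot u (a *: v) = a * dot u v.
Proof. by rewrite dotC dotZl dotC. Qed.

Lemma dotvv_ge0 u : 0 <= dot u u.
Proof. by apply: sumr_ge0 => i _; rewrite -expr2 sqr_ge0. Qed.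

Lemma enorm_sqr u : enorm u ^+ 2 = dot u u.
Proof.
rewrite sqr_sqrtr; first by apply: eq_bigr => i _; rewrite expr2.
by apply: sumr_ge0 => i _; rewrite sqr_ge0.
Qed.

Lemma enorm_sum u : enorm u ^+ 2 = \sum_(i < d) u ord0 i ^+ 2.
Proof. by rewrite enorm_sqr; apply: eq_bigr => i _; rewrite expr2. Qed.

Lemma enorm_ge0 u : 0 <= enorm u.
Proof. exact: sqrtr_ge0. Qed.

Lemma enormZ a u : enorm (a *: u) = `|a| * enorm u.
Proof.
rewrite /enorm -[`|a|]sqrtr_sqr -sqrtrM ?sqr_ge0// mulr_sumr.
by congr Num.sqrt; apply: eq_bigr => i _; rewrite mxE exprMn.
Qed.

Lemma enormN u : enorm (- u) = enorm u.
Proof. by rewrite -scaleN1r enormZ normrN1 mul1r. Qed.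

Lemma enormB u v : enorm (u - v) = enorm (v - u).
Proof. by rewrite -enormN opprB. Qed.

Lemma coord_le_enorm u (i : 'I_d) : `|u ord0 i| <= enorm u.
Proof.
rewrite -[`|_|]sqrtr_sqr ler_sqrt; last first.
  by apply: sumr_ge0 => j _; rewrite sqr_ge0.
by rewrite (bigD1 i)//= lerDl; apply: sumr_ge0 => j _; rewrite sqr_ge0.
Qed.

Lemma dot_le u v : dot u v <= (dot u u + dot v v) / 2.
Proof.
rewrite ler_pdivlMr// mulr_suml -big_split/=; apply: ler_sum => i _.
by have := sqr_ge0 (u ord0 i - v ord0 i); nra.
Qed.

(** [dot_le] applied to the two normalised vectors; a vector of norm zero has zero coordinates and
    is set apart. *)
Lemma cauchy_schwarz u v : dot u v <= enorm u * enorm v.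
Proof.
have [u0|u0] := eqVneq (enorm u) 0; last have [v0|v0] := eqVneq (enorm v) 0.
- rewrite u0 mul0r /dot big1// => i _; have := coord_le_enorm u i.
  by rewrite u0 normr_le0 => /eqP ->; rewrite mul0r.
- rewrite v0 mulr0 /dot big1// => i _; have := coord_le_enorm v i.
  by rewrite v0 normr_le0 => /eqP ->; rewrite mulr0.
have {}u0 : 0 < enorm u by rewrite lt_neqAle eq_sym u0 enorm_ge0.
have {}v0 : 0 < enorm v by rewrite lt_neqAle eq_sym v0 enorm_ge0.
have := dot_le ((enorm u)^-1 *: u) ((enorm v)^-1 *: v).
rewrite !dotZl !dotZr -!enorm_sqr expr2 mulKf ?gt_eqF// mulVf ?gt_eqF//.
rewrite expr2 mulKf ?gt_eqF// mulVf ?gt_eqF//.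
rewrite (_ : (1 + 1) / 2 = 1 :> R); last by field.
by rewrite mulrA -invfM mulrC ler_pdivrMr ?mul1r ?mulr_gt0// mulrC [X in _ <= X]mulrC.
Qed.

Lemma dot_delta u (i : 'I_d) : dot u (delta_mx ord0 i) = u ord0 i.
Proof.
rewrite /dot (bigD1 i)//= mxE !eqxx mulr1 big1 ?addr0// => j ji.
by rewrite mxE (negbTE ji) andbF mulr0.
Qed.

Lemma enorm_le_l1 u : enorm u <= \sum_(i < d) `|u ord0 i|.
Proof.
rewrite -(@ler_pXn2r _ 2)// ?nnegrE ?enorm_ge0// ?sumr_ge0//.
rewrite enorm_sum expr2 mulr_suml; apply: ler_sum => i _.
rewrite -real_normK ?num_real// expr2 ler_wpM2l//.
by rewrite (bigD1 i)//= lerDl sumr_ge0.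
Qed.

End euclidean_norm.

Section rowvec_measurability.
Context (R : realType) (d : nat) (dT : measure_display) (T : measurableType dT).
Implicit Types (f g : T -> 'rV[R]_d).

Lemma measurable_fun_coord f i :
  measurable_fun setT f -> measurable_fun setT (fun x => f x ord0 i).
Proof.
by move=> mf; apply: (measurableT_comp (@measurable_rowvec_coord R d i) mf).
Qed.

Lemma measurable_fun_rowvecD f g : measurable_fun setT f ->
  measurable_fun setT g -> measurable_fun setT (fun x => f x + g x).
Proof.
move=> mf mg; apply: measurable_fun_rowvec => i.
under eq_fun do rewrite mxE.
by apply: measurable_funD; apply: measurable_fun_coord.
Qed.

Lemma measurable_fun_rowvecZ (c : T -> R) f : measurable_fun setT c ->
  measurable_fun setT f -> measurable_fun setT (fun x => c x *: f x).
Proof.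
move=> mc mf; apply: measurable_fun_rowvec => i.
under eq_fun do rewrite mxE.
by apply: measurable_funM => //; apply: measurable_fun_coord.
Qed.

Lemma measurable_fun_rowvecB f g : measurable_fun setT f ->
  measurable_fun setT g -> measurable_fun setT (fun x => f x - g x).
Proof.
move=> mf mg; apply: measurable_fun_rowvecD => //.
under eq_fun do rewrite -scaleN1r.
exact: measurable_fun_rowvecZ.
Qed.

Lemma measurable_fun_dot f g : measurable_fun setT f ->
  measurable_fun setT g -> measurable_fun setT (fun x => dot (f x) (g x)).
Proof.
move=> mf mg; apply: measurable_sum => i.
by apply: measurable_funM; apply: measurable_fun_coord.
Qed.

Lemma measurable_fun_enorm f : measurable_fun setT f ->
  measurable_fun setT (fun x => enorm (f x)).
Proof.
move=> mf; have ms : measurable_fun setT (@Num.sqrt R).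
  exact: (@continuous_measurable_fun R _ (@sqrt_continuous R)).
apply: (measurableT_comp ms).
by apply: measurable_sum => i; apply: measurable_funX; apply: measurable_fun_coord.
Qed.

End rowvec_measurability.

(** * Measurability of Lipschitz maps *)

Section lipschitz_measurable.
Context (R : realType) (d : nat).

(** The sigma-algebra is generated by the coordinates, so the argument avoids open sets: [c < g] is
    the countable union, over rational points [q], of the sets where the Lipschitz minorant
    [g q - L' * enorm (x - q)] exceeds [c], and these are measurable because [enorm] is. *)
Lemma ler_lipschitz_measurable (L : R) (g : 'rV[R]_d -> R) :
  (forall x y, `|g x - g y| <= L * enorm (x - y)) -> measurable_fun setT g.
Proof.
move=> gL; pose L' := `|L| + 1.
have L'0 : 0 < L' by rewrite ltr_wpDl.
have gL' x y : `|g x - g y| <= L' * enorm (x - y).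
  apply: (le_trans (gL x y)); rewrite ler_wpM2r ?enorm_ge0//.
  by rewrite (le_trans (ler_norm _))// lerDl.
apply: (measurability (@RGenOInfty.G R)); first exact: RGenOInfty.measurableE.
move=> _ [_ [c ->] <-]; rewrite setTI.
pose qv (q : 'rV[rat]_d) : 'rV[R]_d := map_mx (@ratr R) q.
rewrite (_ : _ @^-1` _ =
    \bigcup_(q in [set: 'rV[rat]_d]) [set x | c < g (qv q) - L' * enorm (x - qv q)]).
  apply: countable_bigcupT_measurable => // q.
  rewrite (_ : mkset _ =
    (fun x => g (qv q) - L' * enorm (x - qv q)) @^-1` `]c, +oo[%classic); last first.
    by apply/seteqP; split=> x /=; rewrite in_itv/= andbT.
  rewrite -[X in measurable X]setTI.
  suff mq : measurable_fun [set: 'rV[R]_d]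
      (fun x : 'rV[R]_d => g (qv q) - L' * enorm (x - qv q)) by exact: mq.
  apply: measurable_funB => //; apply: measurable_funM => //.
  by apply: measurable_fun_enorm; exact: measurable_fun_rowvecB.
apply/seteqP; split => x /=; rewrite in_itv/= andbT.
  (* Rational coordinates within [e] of those of [x] change [g], and cost the cone, at most a
     quarter of the gap [g x - c] each; [d.+1] keeps the denominator nonzero for [d = 0]. *)
  move=> cx; pose e := (g x - c) / (4 * L' * d.+1%:R).
  have e0 : 0 < e by rewrite divr_gt0 ?subr_gt0// !mulr_gt0.
  have /boolp.choice[q xq] : forall i, exists q, `|x ord0 i - ratr q| < e.
    move=> i; have [q] : exists q, ratr q \in `]x ord0 i - e, x ord0 i + e[.
      by apply: rat_in_itvoo; rewrite ltrBlDr -addrA ltrDl addr_gt0.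
    rewrite in_itv/= => /andP[q1 q2]; exists q.
    by rewrite ltr_distlC q1 q2.
  exists (\row_i q i) => //=.
  set y := qv _.
  have xy : L' * enorm (x - y) <= (g x - c) / 4.
    rewrite -ler_pdivlMl//; apply: le_trans (enorm_le_l1 _) _.
    apply: (@le_trans _ _ (\sum_(i < d) e)).
      by apply: ler_sum => i _; rewrite /y /qv !mxE ltW.
    rewrite sumr_const card_ord.
    have -> : L'^-1 * ((g x - c) / 4) = e *+ d.+1.
      rewrite -[RHS]mulr_natl /e; field.
      by rewrite !gt_eqF.
    by rewrite ler_wpMn2l// ltW.
  have := gL' x y; rewrite ler_norml => /andP[_].
  lra.
move=> [q _ /=] /lt_le_trans; apply.
rewrite lerBlDr -lerBlDl; apply: le_trans (gL' x (qv q)).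
by rewrite -normrN opprB ler_norm.
Qed.

(** Lipschitz continuity in space is the regularity assumed of the approximate score; this is how it
    becomes measurable, as the integrals along the sampler require. *)
Lemma elipschitz_measurable (L : R) (F : 'rV[R]_d -> 'rV[R]_d) :
  elipschitz L F -> measurable_fun setT F.
Proof.
move=> FL; apply: measurable_fun_rowvec => i.
apply: (@ler_lipschitz_measurable L) => x y.
apply: le_trans (FL x y); have := coord_le_enorm (F x - F y) i.
by rewrite !mxE.
Qed.

End lipschitz_measurable.

(** * Laws and product measures *)

Section law.
Local Open Scope ereal_scope.
Context d (Omega : measurableType d) (R : realType) (P : probability Omega R).
Context d1 (E1 : measurableType d1).

Lemma ge0_integral_has_law (Y : Omega -> E1) (nu : {measure set E1 -> \bar R}) f :
  measurable_fun setT Y -> has_law P Y nu ->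
  measurable_fun setT f -> (forall x, 0 <= f x) ->
  \int[nu]_x f x = \int[P]_w f (Y w).
Proof.
by move=> mY YE; apply: ge0_integral_image => // A /YE.
Qed.

Lemma has_law_pair d2 (E2 : measurableType d2) (Y1 : Omega -> E1)
    (Y2 : Omega -> E2) (nu1 : {sigma_finite_measure set E1 -> \bar R})
    (nu2 : {sigma_finite_measure set E2 -> \bar R}) :
  measurable_fun setT Y1 -> measurable_fun setT Y2 ->
  (forall A B, measurable A -> measurable B ->
    P (Y1 @^-1` A `&` Y2 @^-1` B) = nu1 A * nu2 B) ->
  has_law P (fun w => (Y1 w, Y2 w)) (nu1 \x nu2).
Proof.
move=> mY1 mY2 ind A mA.
pose Yf : {mfun Omega >-> (E1 * E2)%type} := mfun_Sub (mem_set (measurable_fun_pair mY1 mY2)).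
by rewrite (@product_measure_unique _ _ _ _ _ nu1 nu2 (pushforward P Yf)).
Qed.

End law.

Section power_measure_integral.
Local Open Scope ereal_scope.
Context (R : realType).
Implicit Type m : {sigma_finite_measure set (measurableTypeR R) -> \bar R}.

Lemma ge0_integral_power_measureS m n (F : 'rV[R]_n.+1 -> \bar R) :
  measurable_fun setT F -> (forall v, 0 <= F v) ->
  \int[power_measure m n.+1]_v F v =
  \int[m]_x \int[power_measure m n]_v F (rowvec_cons (x, v)).
Proof.
move=> mF F0.
rewrite (@ge0_integral_image _ _ _ _ R (m \x power_measure m n)
  (power_measure m n.+1) (@rowvec_cons R n))//.
rewrite fubini_tonelli1//.
exact: measurableT_comp mF (@measurable_rowvec_cons R n).
Qed.

(** Tensorisation: a change of variables valid in each coordinate, with density [l i], passes to the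
    product with the product density, by Tonelli and induction on [n]. Scaling, reflection,
    translation and Lebesgue density of Gaussian measures are its four uses. *)
Lemma ge0_integral_power_measure_transport n m1 m2 (T l : 'I_n -> R -> R)
    (F : 'rV[R]_n -> \bar R) :
  (forall i, measurable_fun setT (T i)) ->
  (forall i, measurable_fun setT (l i)) -> (forall i x, (0 <= l i x)%R) ->
  (forall i (G : measurableTypeR R -> \bar R),
    measurable_fun setT G -> (forall x, 0 <= G x) ->
    \int[m1]_x G (T i x) = \int[m2]_x (G x * (l i x)%:E)) ->
  measurable_fun setT F -> (forall v, 0 <= F v) ->
  \int[power_measure m1 n]_v F (\row_i T i (v ord0 i)) =
  \int[power_measure m2 n]_v (F v * (\prod_i l i (v ord0 i))%:E).
Proof.
move=> mT ml l0 TE.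
have mrow k (U : 'I_k -> R -> R) : (forall i, measurable_fun setT (U i)) ->
    measurable_fun setT (fun v : 'rV[R]_k => \row_i U i (v ord0 i) : 'rV[R]_k).
  move=> mU; apply: measurable_fun_rowvec => i; under eq_fun do rewrite mxE.
  by apply: measurableT_comp => //; exact: measurable_rowvec_coord.
have mprod k (U : 'I_k -> R -> R) : (forall i, measurable_fun setT (U i)) ->
    measurable_fun setT (fun v : 'rV[R]_k => (\prod_i U i (v ord0 i))%:E).
  move=> mU; apply: measurable_fun_EFin; apply: measurable_prod => i _.
  by apply: measurableT_comp => //; exact: measurable_rowvec_coord.
elim: n T l F mT ml l0 TE => [|n IH] T l F mT ml l0 TE mF F0.
  apply: eq_integral => v _; rewrite big_ord0 mule1; congr F.
  by apply/rowP => -[].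
have l'0 k (U : 'I_k -> R -> R) (v : 'rV[R]_k) : (forall i x, (0 <= U i x)%R) ->
    0 <= (\prod_i U i (v ord0 i))%:E.
  by move=> U0; rewrite lee_fin; apply: prodr_ge0.
rewrite ge0_integral_power_measureS//; last first.
  exact: measurableT_comp mF (mrow _ _ mT).
rewrite [RHS]ge0_integral_power_measureS//; first last.
- by move=> v; rewrite mule_ge0// l'0.
- by apply: emeasurable_funM => //; exact: mprod.
pose G x := \int[power_measure m2 n]_v (F (rowvec_cons (x, v)) *
   (\prod_i l (lift ord0 i) (v ord0 i))%:E).
have mH : measurable_fun setT (fun xv : measurableTypeR R * 'rV[R]_n =>
    F (rowvec_cons xv) * (\prod_i l (lift ord0 i) (xv.2 ord0 i))%:E).
  apply: emeasurable_funM.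
    exact: measurableT_comp mF (@measurable_rowvec_cons R n).
  exact: (measurableT_comp (mprod _ (fun i => l (lift ord0 i)) (fun i => ml _))
    measurable_snd).
have H0 xv : 0 <= F (rowvec_cons xv) *
    (\prod_i l (lift ord0 i) (xv.2 ord0 i))%:E.
  by rewrite mule_ge0// (l'0 _ (fun i => l (lift ord0 i))).
have mG : measurable_fun setT G.
  exact: (measurable_fun_fubini_tonelli_F _ mH).
have G0 x : 0 <= G x by apply: integral_ge0 => v _; exact: (H0 (x, v)).
transitivity (\int[m1]_x G (T ord0 x)).
  apply: eq_integral => x _; rewrite /G.
  rewrite -(IH (fun i => T (lift ord0 i)) (fun i => l (lift ord0 i)))//.
  - apply: eq_integral => v _; congr F; apply/rowP => i; rewrite !mxE.
    by case: unliftP => [j ->|->]; rewrite ?mxE.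
  - move=> i; exact: TE.
  - exact: (measurableT_comp (measurableT_comp mF (@measurable_rowvec_cons R n))
      (pair1_measurable _)).
rewrite TE//; apply: eq_integral => x _; rewrite -ge0_integralZr//.
- apply: eq_integral => v _; rewrite -muleA -EFinM; congr (_ * _%:E).
  rewrite big_ord_recl mulrC mxE unlift_none; congr (_ * _)%R.
  by apply: eq_bigr => i _; rewrite mxE liftK.
- exact: (measurableT_comp mH (pair1_measurable x)).
- exact: l0.
Qed.

End power_measure_integral.

(** * Gaussian measures *)

Section lebesgue_affine.
Local Open Scope ereal_scope.
Context (R : realType).
Notation leb := (@lebesgue_measure R).

Lemma ge0_integral_lebesgue_affine (c z : R) (G : measurableTypeR R -> \bar R) :
  (0 < c)%R -> measurable_fun setT G -> (forall x, 0 <= G x) ->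
  \int[leb]_x G x = \int[leb]_x (G (c * x + z)%R * c%:E).
Proof.
move=> c0 mG G0.
have mphi : @measurable_fun _ _ (measurableTypeR R) (measurableTypeR R) setT
    (fun x => c * x + z)%R.
  by apply: measurable_funD => //; exact: measurable_funM.
pose phi : {mfun measurableTypeR R >-> measurableTypeR R} :=
  @mfun_Sub _ _ (measurableTypeR R) (measurableTypeR R) _ (mem_set mphi).
apply: (@ge0_integral_weighted_image _ _ _ _ R leb leb phi (fun=> c)) => //.
  by move=> x; exact: ltW.
move=> A mA.
rewrite (eq_integral (cst c%:E))// integral_cst; last first.
  by rewrite -[X in measurable X]setTI; apply: (measurable_funPT phi).
(* Lebesgue measure is determined by half-open intervals, where [c] times the length of the preimage
   is the length of the interval. *)
apply: (@lebesgue_measure_unique R (mscale (NngNum (ltW c0)) (pushforward leb phi)))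
  => // _ [[a b]] _ <-.
have phiE : pushforward leb phi `]a, b]%classic =
    leb `]((a - z) / c)%R, ((b - z) / c)%R]%classic.
  congr (leb _); apply/seteqP; split => x /=; rewrite !in_itv/=;
    by rewrite ltr_pdivrMr// ler_pdivlMr// ltrBlDr lerBrDr mulrC.
transitivity (c%:E * leb `]((a - z) / c)%R, ((b - z) / c)%R]%classic); last first.
  by rewrite -phiE.
rewrite !lebesgue_measure_itv/= !lte_fin ltr_pM2r ?invr_gt0// ltrD2r.
case: ifP => _; last by rewrite mule0.
by rewrite -!EFinD -EFinM; congr (_%:E); field; rewrite gt_eqF.
Qed.

Lemma ge0_integral_lebesgueN (G : measurableTypeR R -> \bar R) :
  measurable_fun setT G -> (forall x, 0 <= G x) ->
  \int[leb]_x G x = \int[leb]_x G (- x)%R.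
Proof.
move=> mG G0; apply: (@ge0_integral_image _ _ _ _ R leb leb
  (-%R : measurableTypeR R -> measurableTypeR R)) => //.
by move=> A mA; rewrite -[LHS]lebesgue_measureN.
Qed.

End lebesgue_affine.

Section normal_integral.
Local Open Scope ereal_scope.
Context (R : realType).
Notation leb := (@lebesgue_measure R).
Implicit Types (s z : R) (G : measurableTypeR R -> \bar R).

Lemma ge0_integral_normal_prob s G :
  measurable_fun setT G -> (forall x, 0 <= G x) ->
  \int[normal_prob 0 s]_x G x = \int[leb]_x (G x * (normal_pdf 0 s x)%:E).
Proof.
move=> mG G0; apply: (@ge0_integral_weighted_image _ _ _ _ R leb
  (normal_prob 0 s) id (normal_pdf 0 s)) => //.
- exact: measurable_normal_pdf.
- by move=> x; exact: normal_pdf_ge0.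
Qed.

Let measurable_mule_normal_pdf s G : measurable_fun setT G ->
  measurable_fun setT (fun x => G x * (normal_pdf 0 s x)%:E).
Proof.
move=> mG; apply: emeasurable_funM => //; apply: measurable_fun_EFin.
exact: measurable_normal_pdf.
Qed.

Let mule_normal_pdf_ge0 s G : (forall x, 0 <= G x) ->
  forall x, 0 <= G x * (normal_pdf 0 s x)%:E.
Proof. by move=> G0 x; rewrite mule_ge0// lee_fin normal_pdf_ge0. Qed.

Lemma ge0_integral_normal_scale s G : (0 < s)%R ->
  measurable_fun setT G -> (forall x, 0 <= G x) ->
  \int[normal_prob 0 1]_x G (s * x)%R = \int[normal_prob 0 s]_x G x.
Proof.
move=> s0 mG G0.
have mGs : measurable_fun [set: measurableTypeR R]
    (fun x : measurableTypeR R => G (s * x)%R).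
  by apply: measurableT_comp => //; exact: measurable_funM.
rewrite (ge0_integral_normal_prob 1 mGs (fun=> G0 _)).
rewrite [RHS](ge0_integral_normal_prob s mG G0).
rewrite [RHS](ge0_integral_lebesgue_affine 0 s0
  (measurable_mule_normal_pdf s mG) (mule_normal_pdf_ge0 s G0)).
apply: eq_integral => x _; rewrite addr0 -muleA -EFinM; congr (_ * _%:E).
rewrite !normal_pdfE ?gt_eqF//.
have peakE : normal_peak 1 = (normal_peak s * s)%R.
  rewrite /normal_peak expr1n mul1r -mulrnAr sqrtrM ?sqr_ge0// sqrtr_sqr.
  by rewrite gtr0_norm// invfM mulrAC mulVf ?gt_eqF// mul1r.
rewrite peakE [RHS]mulrAC; congr (_ * _)%R.
rewrite /normal_fun !subr0; congr expR.
by field; rewrite gt_eqF.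
Qed.

Lemma ge0_integral_normalN s G : (0 < s)%R ->
  measurable_fun setT G -> (forall x, 0 <= G x) ->
  \int[normal_prob 0 s]_x G (- x)%R = \int[normal_prob 0 s]_x G x.
Proof.
move=> s0 mG G0.
have mGN : measurable_fun [set: measurableTypeR R]
    (fun x : measurableTypeR R => G (- x)%R).
  exact: measurableT_comp.
rewrite (ge0_integral_normal_prob s mGN (fun=> G0 _)).
rewrite [RHS](ge0_integral_normal_prob s mG G0).
rewrite [RHS](ge0_integral_lebesgueN
  (measurable_mule_normal_pdf s mG) (mule_normal_pdf_ge0 s G0)).
apply: eq_integral => x _; congr (_ * _%:E).
by rewrite !normal_pdfE ?gt_eqF// /normal_fun !subr0 sqrrN.
Qed.

(** Cameron-Martin in one dimension: the quotient of the normal densities at [x - z] and at [x] is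
    the exponential of [(x z - z^2/2) / s^2]. *)
Lemma ge0_integral_normal_shift s z G : (0 < s)%R ->
  measurable_fun setT G -> (forall x, 0 <= G x) ->
  \int[normal_prob 0 s]_x G (x + z)%R =
  \int[normal_prob 0 s]_x
    (G x * (expR ((x * z - z * z / 2) / s ^+ 2))%:E).
Proof.
move=> s0 mG G0.
have mk : measurable_fun setT
    (fun x : R => expR ((x * z - z * z / 2) / s ^+ 2)).
  apply: measurableT_comp => //; apply: measurable_funM => //.
  by apply: measurable_funB => //; exact: measurable_funM.
have mGz : measurable_fun [set: measurableTypeR R]
    (fun x : measurableTypeR R => G (x + z)%R).
  by apply: measurableT_comp => //; exact: measurable_funD.
have mGk : measurable_fun [set: measurableTypeR R] (fun x : measurableTypeR R =>
    G x * (expR ((x * z - z * z / 2) / s ^+ 2))%:E).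
  by apply: emeasurable_funM => //; exact: measurable_fun_EFin.
have Gk0 x : 0 <= G x * (expR ((x * z - z * z / 2) / s ^+ 2))%:E.
  by rewrite mule_ge0// lee_fin expR_ge0.
rewrite (ge0_integral_normal_prob s mGz (fun=> G0 _)).
rewrite [RHS](ge0_integral_normal_prob s mGk Gk0).
rewrite [RHS](ge0_integral_lebesgue_affine z ltr01
  (measurable_mule_normal_pdf s mGk) (mule_normal_pdf_ge0 s Gk0)).
apply: eq_integral => x _; rewrite mul1r mule1 -muleA -EFinM; congr (_ * _%:E).
rewrite !normal_pdfE ?gt_eqF// mulrCA; congr (_ * _)%R.
rewrite /normal_fun -expRD; congr expR.
by field; rewrite gt_eqF.
Qed.

End normal_integral.

(* The density of N(z, tI) with respect to N(0, tI). *)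
Definition cameron_martin (R : realType) (d : nat) (t : R) (y z : 'rV[R]_d) : R :=
  expR ((dot y z - dot z z / 2) / t).

(* A sealed copy: unification would otherwise unfold the product measures. *)
HB.lock Definition gauss (R : realType) (d : nat) (t : R) :
  {sigma_finite_measure set 'rV[R]_d -> \bar R} := gaussian d t.

Lemma gaussE (R : realType) (d : nat) (t : R) : gauss d t = gaussian d t.
Proof. by rewrite unlock. Qed.

Section gaussian.
Context (R : realType) (d : nat).
Implicit Types (F : 'rV[R]_d -> \bar R) (t b : R).
Notation gauss := (@gauss R d).
Notation gaussU := (@gaussian R d).

Lemma measurable_cameron_martin dT (T : measurableType dT) t
    (f g : T -> 'rV[R]_d) : measurable_fun setT f -> measurable_fun setT g ->
  measurable_fun setT (fun x => cameron_martin t (f x) (g x)).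
Proof.
move=> mf mg; apply: measurableT_comp => //; apply: measurable_funM => //.
apply: measurable_funB; first exact: measurable_fun_dot.
by apply: measurable_funM => //; exact: measurable_fun_dot.
Qed.

Lemma cameron_martin_gt0 t (y z : 'rV[R]_d) : 0 < cameron_martin t y z.
Proof. exact: expR_gt0. Qed.

Lemma cameron_martin_prod t (y z : 'rV[R]_d) : 0 <= t ->
  cameron_martin t y z = \prod_i
    expR ((y ord0 i * z ord0 i - z ord0 i * z ord0 i / 2) / Num.sqrt t ^+ 2).
Proof.
move=> t0; rewrite -expR_sum; congr expR; rewrite sqr_sqrtr//.
by rewrite -mulr_suml; congr (_ / _); rewrite sumrB mulr_suml.
Qed.

Lemma ge0_integral_gaussian_scale t F : 0 < t ->
  measurable_fun setT F -> (forall v, 0 <= F v)%E ->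
  (\int[gauss 1]_v F (Num.sqrt t *: v)%R = \int[gauss t]_v F v)%E.
Proof.
move=> t0 mF F0; rewrite !gaussE; have st0 : 0 < Num.sqrt t by rewrite sqrtr_gt0.
transitivity (\int[gaussU 1]_v F (\row_i (Num.sqrt t * v ord0 i)%R))%E.
  apply: eq_integral => v _; congr F; apply/rowP => i; by rewrite !mxE.
transitivity (\int[gaussU t]_v (F v * (\prod_(i < d) 1)%:E))%E; last first.
  by apply: eq_integral => v _; rewrite big1// mule1.
apply: (@ge0_integral_power_measure_transport R d
    (normal_prob 0 (Num.sqrt 1)) (normal_prob 0 (Num.sqrt t))
    (fun _ x => Num.sqrt t * x) (fun _ _ => 1) F _ _ _ _ mF F0).
- by move=> _; exact: measurable_funM.
- by move=> _; exact: measurable_cst.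
- by move=> _ _; exact: ler01.
- move=> _ G mG G0; rewrite sqrtr1 (ge0_integral_normal_scale st0 mG G0).
  by apply: eq_integral => x _; rewrite mule1.
Qed.

Lemma ge0_integral_gaussianN t F : 0 < t ->
  measurable_fun setT F -> (forall v, 0 <= F v)%E ->
  (\int[gauss t]_v F (- v)%R = \int[gauss t]_v F v)%E.
Proof.
move=> t0 mF F0; rewrite !gaussE; have st0 : 0 < Num.sqrt t by rewrite sqrtr_gt0.
transitivity (\int[gaussU t]_v F (\row_i (- v ord0 i)%R))%E.
  apply: eq_integral => v _; congr F; apply/rowP => i; by rewrite !mxE.
transitivity (\int[gaussU t]_v (F v * (\prod_(i < d) 1)%:E))%E; last first.
  by apply: eq_integral => v _; rewrite big1// mule1.
apply: (@ge0_integral_power_measure_transport R d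
    (normal_prob 0 (Num.sqrt t)) (normal_prob 0 (Num.sqrt t))
    (fun _ x => - x) (fun _ _ => 1) F _ _ _ _ mF F0).
- by move=> _; exact: oppr_measurable.
- by move=> _; exact: measurable_cst.
- by move=> _ _; exact: ler01.
move=> _ G mG G0; rewrite (ge0_integral_normalN st0 mG G0).
by apply: eq_integral => x _; rewrite mule1.
Qed.

Lemma ge0_integral_gaussian_shift t z F : 0 < t ->
  measurable_fun setT F -> (forall v, 0 <= F v)%E ->
  (\int[gauss t]_v F (v + z)%R =
   \int[gauss t]_v (F v * (cameron_martin t v z)%:E))%E.
Proof.
move=> t0 mF F0; rewrite !gaussE; have st0 : 0 < Num.sqrt t by rewrite sqrtr_gt0.
transitivity (\int[gaussU t]_v F (\row_i (v ord0 i + z ord0 i)%R))%E.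
  apply: eq_integral => v _; congr F; apply/rowP => i; by rewrite !mxE.
under [RHS]eq_integral do rewrite cameron_martin_prod ?(ltW t0)//.
apply: (@ge0_integral_power_measure_transport R d
    (normal_prob 0 (Num.sqrt t)) (normal_prob 0 (Num.sqrt t))
    (fun i x => x + z ord0 i) (fun i x =>
    expR ((x * z ord0 i - z ord0 i * z ord0 i / 2) / Num.sqrt t ^+ 2))
    F _ _ _ _ mF F0).
- by move=> i; exact: measurable_funD.
- move=> i; apply: measurableT_comp => //; apply: measurable_funM => //.
  by apply: measurable_funB => //; exact: measurable_funM.
- by move=> i x; exact: expR_ge0.
- move=> i G mG G0; exact: (ge0_integral_normal_shift _ st0 mG G0).
Qed.

Lemma ge0_integral_gaussian_density t F : 0 < t ->
  measurable_fun setT F -> (forall v, 0 <= F v)%E ->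
  (\int[gauss t]_v F v = \int[lebesgue_rowvec R d]_v
    (F v * (\prod_i normal_pdf 0 (Num.sqrt t) (v ord0 i))%:E))%E.
Proof.
move=> t0 mF F0; rewrite !gaussE.
transitivity (\int[gaussU t]_v F (\row_i v ord0 i))%E.
  by apply: eq_integral => v _; congr F; apply/rowP => i; rewrite !mxE.
apply: (@ge0_integral_power_measure_transport R d
    (normal_prob 0 (Num.sqrt t)) (@lebesgue_measure R)
    (fun i x => x) (fun i x => normal_pdf 0 (Num.sqrt t) x) F _ _ _ _ mF F0).
- by move=> i; exact: measurable_id.
- by move=> i; exact: measurable_normal_pdf.
- by move=> i x; exact: normal_pdf_ge0.
- by move=> i G mG G0; exact: (ge0_integral_normal_prob _ mG G0).
Qed.

Lemma gaussianT t : gauss t setT = 1%E.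
Proof.
rewrite gaussE; have := @power_measure_box R (normal_prob 0 (Num.sqrt t)) d (fun=> setT)
  (fun=> measurableT).
rewrite big1; last by move=> i _; exact: probability_setT.
by rewrite (_ : mkset _ = setT)//; apply/seteqP; split.
Qed.

Lemma integral_gaussian_cst t (c : \bar R) : (\int[gauss t]_v c = c)%E.
Proof.
rewrite (@integral_cst _ _ _ (gauss t) setT measurableT).
transitivity (c * gauss t setT)%E; first by [].
by rewrite gaussianT mule1.
Qed.

Lemma expectation_cameron_martin t z : 0 < t ->
  (\int[gauss t]_v (cameron_martin t v z)%:E = 1)%E.
Proof.
move=> t0; have := @ge0_integral_gaussian_shift t z (cst 1%E) t0.
move=> /(_ (measurable_cst _) (fun=> lee01)).
rewrite integral_gaussian_cst => ->.
by apply: eq_integral => v _; rewrite mul1e.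
Qed.

Lemma expR_le_inv1B (u : R) : u < 1 -> expR u <= (1 - u)^-1.
Proof.
move=> u1; rewrite -[expR u]invrK lef_pV2 ?posrE ?invr_gt0 ?expR_gt0 ?subr_gt0//.
by rewrite -expRN expR_ge1Dx.
Qed.

(** The right side is [(2 sinh (x/2))^2], and [sinh v >= v] for [v >= 0] by the mean value theorem.
    The inequality trades a second moment for exponential moments. *)
Lemma sqr_le_expRDexpRN (x : R) : x ^+ 2 <= expR x + expR (- x) - 2.
Proof.
wlog x0 : x / 0 <= x => [H|].
  have [|x0] := leP 0 x; first exact: H.
  by have := H (- x); rewrite opprK sqrrN oppr_ge0 (ltW x0) => /(_ isT); lra.
have sinh_ge (v : R) : 0 <= v -> 2 * v <= expR v - expR (- v).
  rewrite le_eqVlt => /predU1P[<-|v0]; first by rewrite oppr0 mulr0 subrr.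
  pose g (y : R) : R := expR y - expR (- y).
  have dg (y : R) : is_derive y 1 g (expR y + expR (- y)).
    rewrite /g; apply: is_derive_eq.
    by rewrite /GRing.scale/=; ring.
  have [|c _] := @MVT _ g (fun y => expR y + expR (- y)) 0 v v0 (fun y _ => dg y).
    by apply: derivable_within_continuous => y _; apply: (@ex_derive _ _ _ _ _ _ _ (dg y)).
  rewrite /g oppr0 subrr !subr0 addr0 => ->; rewrite ler_wpM2r ?(ltW v0)//.
  have := expR_ge1Dx c; have := expR_ge1Dx (- c); lra.
have -> : expR x + expR (- x) - 2 = (expR (x / 2) - expR (- (x / 2))) ^+ 2.
  have E (y : R) : expR y = expR (y / 2) ^+ 2.
    by rewrite -expRM_natl; congr expR; field.
  rewrite (E x) (E (- x)) mulNr sqrrB -expRD subrr expR0; ring.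
rewrite ler_sqr ?nnegrE//.
- by have := sinh_ge (x / 2); rewrite divr_ge0// => /(_ isT); lra.
- by have := sinh_ge (x / 2); rewrite divr_ge0// => /(_ isT); lra.
Qed.

(** The second moment [I] comes from the Laplace transform, which the Cameron-Martin density with
    [z = a e_i] already provides: [a^2 I + 2 <= 2 exp (a^2/2)] gives [I <= 1 / (1 - a^2/2)], and [a]
    may be small. *)
Lemma gaussian1_coord_sqr i :
  (\int[gauss 1]_v (v ord0 i ^+ 2)%:E <= 1)%E.
Proof.
have mi : measurable_fun setT (fun v : 'rV[R]_d => v ord0 i).
  exact: measurable_rowvec_coord.
have expE (a : R) :
    (\int[gauss 1]_v (expR (a * v ord0 i))%:E = (expR (a ^+ 2 / 2))%:E)%E.
  have := @expectation_cameron_martin 1 (a *: delta_mx ord0 i) ltr01.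
  rewrite (eq_integral (fun v : 'rV[R]_d =>
      ((expR (- (a ^+ 2 / 2)))%:E * (expR (a * v ord0 i))%:E)%E)); last first.
    move=> v _; rewrite -EFinM -expRD /cameron_martin divr1; congr (expR _)%:E.
    rewrite !dotZr dotZl.
    by rewrite !dot_delta mxE !eqxx /=; field.
  rewrite ge0_integralZl//; last first.
  - by apply: measurable_fun_EFin; apply: measurableT_comp => //; exact: measurable_funM.
  move=> H; rewrite -[LHS]mul1e -[X in (X%:E * _)%E](_ : expR (a ^+ 2 / 2) * expR (- (a ^+ 2 / 2)) = 1).
    by rewrite EFinM -muleA H mule1.
  by rewrite -expRD subrr expR0.
have mexp (a : R) : measurable_fun setT (fun v : 'rV[R]_d => expR (a * v ord0 i)).
  by apply: measurableT_comp => //; exact: measurable_funM.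
have m2 : measurable_fun setT (fun v : 'rV[R]_d => (v ord0 i ^+ 2)%:E).
  by apply: measurable_fun_EFin; exact: measurable_funX.
set I := (\int[_]_v _)%E.
have I0 : (0 <= I)%E by apply: integral_ge0 => v _; rewrite lee_fin sqr_ge0.
have H (a : R) : 0 < a < 1 -> (I <= (1 - a ^+ 2 / 2)^-1%:E)%E.
  move=> /andP[a0 a1].
  have q0 : 0 < 1 - a ^+ 2 / 2 by nra.
  have : ((a ^+ 2)%:E * I + 2%:E <= (2 * expR (a ^+ 2 / 2))%:E)%E.
    rewrite -ge0_integralZl//; last 2 first.
    - by move=> v _; rewrite lee_fin sqr_ge0.
    - by rewrite lee_fin sqr_ge0.
    have -> : 2%:E = (\int[gauss 1]_v (cst 2%:E v))%E.
      by rewrite integral_gaussian_cst.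
    rewrite -ge0_integralD//; last 3 first.
    - by move=> v _; rewrite -EFinM lee_fin mulr_ge0 ?sqr_ge0.
    - exact: emeasurable_funM.
    - by move=> v _; rewrite lee_fin.
    have -> : ((2 * expR (a ^+ 2 / 2))%:E = \int[gauss 1]_v
        ((expR (a * v ord0 i))%:E + (expR (- a * v ord0 i))%:E))%E.
      rewrite ge0_integralD//.
      - by rewrite !expE sqrrN -EFinD; congr (_%:E); ring.
      - exact: measurable_fun_EFin.
      - exact: measurable_fun_EFin.
    apply: ge0_le_integral => //.
    - by move=> v _; rewrite adde_ge0 ?mule_ge0 ?lee_fin ?sqr_ge0.
    - by apply: emeasurable_funD => //; exact: emeasurable_funM.
    - by apply: emeasurable_funD; exact: measurable_fun_EFin.
    - move=> v _; rewrite -EFinM -!EFinD lee_fin mulNr.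
      by have := sqr_le_expRDexpRN (a * v ord0 i); rewrite exprMn; lra.
  have : ((2 * expR (a ^+ 2 / 2))%:E <= (2 + a ^+ 2 * (1 - a ^+ 2 / 2)^-1)%:E)%E.
    rewrite lee_fin (_ : 2 + _ = 2 * (1 - a ^+ 2 / 2)^-1).
      by rewrite ler_pM2l// expR_le_inv1B//; lra.
    by field; rewrite gt_eqF//; lra.
  move=> /[swap] /le_trans /[apply].
  case: I I0 => [r _|_|//]; last by rewrite gt0_muley ?lte_fin ?exprn_gt0.
  rewrite -EFinM -EFinD !lee_fin addrC lerD2l ler_pM2l//.
  by rewrite exprn_gt0.
case: I I0 H => [r _ H|_ /(_ 2^-1)|//]; last first.
  by rewrite invr_gt0 invf_lt1// ltr0n ltr1n => /(_ isT).
rewrite lee_fin leNgt; apply/negP => r1.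
have r0 : 0 < r by rewrite (lt_trans _ r1).
have r1' : r^-1 < 1 by rewrite invf_lt1.
have rV0 : 0 < r^-1 by rewrite invr_gt0.
(* Here [r] is the supposed value, above 1, of the integral. With [a^2 = 1 - 1/r] the bound is
   [2 r / (r + 1)], which is below [r]. *)
have := H (Num.sqrt (1 - r^-1)).
have sq1 : Num.sqrt (1 - r^-1) < 1 by rewrite -[ltRHS]sqrtr1 ltr_sqrt// gtrBl.
rewrite sqrtr_gt0 subr_gt0 r1' sq1 => /(_ isT).
rewrite sqr_sqrtr ?subr_ge0 ?(ltW r1')// lee_fin leNgt => /negP; apply.
rewrite invf_plt ?posrE//; lra.
Qed.

(** Both sides are doubled so that the integrand can be averaged over [v] and [- v]: the cross term
    then cancels pointwise and no signed integral occurs. *)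
Lemma gaussian1_shift_sqr (c : 'rV[R]_d) (b : R) :
  (\int[gauss 1]_v (enorm (c + b *: v) ^+ 2)%:E <=
   (enorm c ^+ 2 + b ^+ 2 * d%:R)%:E)%E.
Proof.
have m1 (u : R) : measurable_fun setT
    (fun v : 'rV[R]_d => (enorm (c + u *: v) ^+ 2)%:E).
  apply: measurable_fun_EFin; apply: measurable_funX.
  apply: measurable_fun_enorm; apply: measurable_fun_rowvecD => //.
  exact: measurable_fun_rowvecZ.
have m2 : measurable_fun setT (fun v : 'rV[R]_d => (enorm v ^+ 2)%:E).
  by apply: measurable_fun_EFin; apply: measurable_funX; exact: measurable_fun_enorm.
have sq0 (x : R) : (0 <= (x ^+ 2)%:E)%E by rewrite lee_fin sqr_ge0.
rewrite -(@lee_pmul2l _ 2%:E)//.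
rewrite -[X in (X%:E * _)%E](_ : 1 + 1 = 2 :> R)// EFinD ge0_muleDl// mul1e.
rewrite -[X in (_ + X)%E](ge0_integral_gaussianN ltr01 (m1 b) (fun=> sq0 _)).
rewrite -ge0_integralD//; last first.
  by have := m1 (- b); under eq_fun do rewrite scaleNr -scalerN.
rewrite (eq_integral (fun v : 'rV[R]_d => (2 * enorm c ^+ 2)%:E +
    (2 * b ^+ 2)%:E * (enorm v ^+ 2)%:E)%E); last first.
  move=> v _; rewrite -EFinM -!EFinD; congr (_%:E).
  rewrite scalerN -scaleNr !enorm_sqr !(dotDl, dotDr, dotZl, dotZr) (dotC v c).
  ring.
have b20 : (0 <= (2 * b ^+ 2)%:E)%E by rewrite lee_fin mulr_ge0 ?sqr_ge0.
rewrite ge0_integralD//; last 3 first.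
- by move=> v _; rewrite lee_fin mulr_ge0 ?sqr_ge0.
- by move=> v _; exact: mule_ge0.
- exact: emeasurable_funM.
rewrite integral_gaussian_cst ge0_integralZl//.
rewrite -EFinM [X in (_ <= X%:E)%E](_ : _ = 2 * enorm c ^+ 2 + 2 * b ^+ 2 * d%:R); last by ring.
rewrite EFinD leeD2l// (EFinM (2 * b ^+ 2) d%:R) lee_pmul//; first exact: integral_ge0.
rewrite (eq_integral (fun v : 'rV[R]_d => \sum_(i < d) (v ord0 i ^+ 2)%:E)%E); last first.
  by move=> v _; rewrite enorm_sum -sumEFin.
rewrite ge0_integral_sum//; last first.
  move=> i; apply: measurable_fun_EFin; apply: measurable_funX.
  exact: measurable_rowvec_coord.
apply: (@le_trans _ _ (\sum_(i < d) 1)%E).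
  by apply: lee_sum => i _; exact: gaussian1_coord_sqr.
by rewrite sumEFin sumr_const card_ord.
Qed.

End gaussian.

(** * Posterior mean *)

Section ae_bounded_integral.
Context d (T : measurableType d) (R : realType) (mu : probability T R).
Implicit Types (g : T -> R).

Lemma integral_prob_cst (c : \bar R) : (\int[mu]_z c = c)%E.
Proof.
rewrite (@integral_cst _ _ _ mu setT measurableT).
transitivity (c * mu setT)%E; first by [].
by rewrite probability_setT mule1.
Qed.

Lemma ae_bounded_integrable g (M : R) : measurable_fun setT g ->
  {ae mu, forall z, `|g z| <= M} -> mu.-integrable setT (EFin \o g).
Proof.
move=> mg gM; apply/integrableP; split; first exact/measurable_EFinP.
apply: (@le_lt_trans _ _ (\int[mu]_z (cst `|M|%:E z))%E).
  apply: ae_ge0_le_integral => //.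
  - by apply: measurableT_comp => //; exact/measurable_EFinP.
  - by move=> z _; rewrite lee_fin.
  - apply: filterS gM => z gM _ /=; rewrite lee_fin.
    exact: le_trans gM (ler_norm _).
by rewrite integral_prob_cst ltry.
Qed.

Lemma EFin_Rintegral g : mu.-integrable setT (EFin \o g) ->
  ((\int[mu]_z g z)%R%:E = \int[mu]_z (g z)%:E)%E.
Proof. by move=> ig; rewrite /Rintegral fineK//; exact: integrable_fin_num. Qed.

Lemma ae_le_Rintegral g1 g2 :
  mu.-integrable setT (EFin \o g1) -> mu.-integrable setT (EFin \o g2) ->
  {ae mu, forall z, g1 z <= g2 z} -> \int[mu]_z g1 z <= \int[mu]_z g2 z.
Proof.
move=> i1 i2 g12; rewrite -subr_ge0 -RintegralB//.
have m1 : measurable_fun setT g1 by have /integrableP[/measurable_EFinP] := i1.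
have m2 : measurable_fun setT g2 by have /integrableP[/measurable_EFinP] := i2.
(* The difference is nonnegative only almost everywhere; its positive part is so everywhere and has
   the same integral. *)
rewrite /Rintegral (@ae_eq_integral _ _ _ mu setT
  (fun z => (Num.max (g2 z - g1 z) 0)%:E))//.
- by apply: fine_ge0; apply: integral_ge0 => z _; rewrite lee_fin le_max lexx orbT.
- by apply: measurable_fun_EFin; exact: measurable_funB.
- apply: measurable_fun_EFin; apply: measurable_maxr => //.
  exact: measurable_funB.
- by apply: filterS g12 => z g12 _; rewrite max_l// subr_ge0.
Qed.

(** Jensen by the tangent line: [g^2 >= 2 c g - c^2], and the integral of the right side is [c^2].
    An infinite integral of [g^2] leaves nothing to prove. *)
Lemma sqr_Rintegral_le g : mu.-integrable setT (EFin \o g) ->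
  (((\int[mu]_z g z)%R ^+ 2)%:E <= \int[mu]_z (g z ^+ 2)%:E)%E.
Proof.
move=> ig; have mg : measurable_fun setT g.
  by have /integrableP[/measurable_EFinP] := ig.
set c := (\int[mu]_z g z)%R.
have i2 : mu.-integrable setT (EFin \o (fun z => (2 * c) * g z - c ^+ 2)).
  rewrite (_ : _ \o _ = (fun z => (2 * c)%:E * (EFin \o g) z) \- cst (c ^+ 2)%:E)%E//.
  apply: integrableB => //; first exact: integrableZl.
  exact: finite_measure_integrable_cst.
have -> : ((c ^+ 2)%:E = \int[mu]_z ((2 * c) * g z - c ^+ 2)%:E)%E.
  rewrite -EFin_Rintegral// RintegralB//; last 2 first.
  - exact: (integrableZl measurableT (2 * c) ig).
  - exact: finite_measure_integrable_cst.
  rewrite RintegralZl// -/c Rintegral_cst// [X in fine X]probability_setT/=.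
  by congr (_%:E); ring.
have [i3|] := boolP (\int[mu]_z (g z ^+ 2)%:E < +oo)%E; last first.
  by rewrite -leNgt leye_eq => /eqP ->; rewrite leey.
apply: le_integral => //.
- apply/integrableP; split.
    by apply: measurable_fun_EFin; exact: measurable_funX.
  under eq_integral do rewrite abse_EFin ger0_norm ?sqr_ge0//.
  exact: i3.
- by move=> z _; rewrite lee_fin; have := sqr_ge0 (g z - c); nra.
Qed.

End ae_bounded_integral.

Lemma measurable_fun_integral_snd d1 d2 (T1 : measurableType d1)
    (T2 : measurableType d2) (R : realType)
    (mu : {sigma_finite_measure set T2 -> \bar R}) (g : T1 * T2 -> R) :
  measurable_fun setT g ->
  measurable_fun setT (fun y => \int[mu]_z (g (y, z))%:E)%E.
Proof.
move=> mg; have mG := measurable_fun_EFin mg.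
under eq_fun do rewrite integralE.
apply: emeasurable_funB.
- have H := @measurable_fun_fubini_tonelli_F _ _ _ _ _ mu _
    (measurable_funepos mG) (funepos_ge0 _).
  rewrite (_ : (fun _ => _) = fubini_F mu ((fun x => (g x)%:E)^\+)%E)//.
  by apply/funext => y; apply: eq_integral => z _; rewrite !funeposE.
- have H := @measurable_fun_fubini_tonelli_F _ _ _ _ _ mu _
    (measurable_funeneg mG) (funeneg_ge0 _).
  rewrite (_ : (fun _ => _) = fubini_F mu ((fun x => (g x)%:E)^\-)%E)//.
  by apply/funext => y; apply: eq_integral => z _; rewrite !funenegE.
Qed.

Section posterior.
Context (R : realType) (d : nat) (mu : probability 'rV[R]_d R) (r : R).
Hypothesis mur : {ae mu, forall z, enorm z <= r}.
Implicit Types (t : R) (y z : 'rV[R]_d).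

(* mixture t is the density of X + B_t with respect to N(0, tI), and
   post_mean t y is E[X | X + B_t = y]. *)
Definition mixture t y : R := \int[mu]_z cameron_martin t y z.

Definition post_mean t y : 'rV[R]_d :=
  \row_i ((\int[mu]_z (z ord0 i * cameron_martin t y z)) / mixture t y).

(** The square is completed in [z]: [<y,z> - |z|^2/2 <= |y|^2/2]. The bound is uniform in [z], which
    serves integrability and, later, domination of the derivative. *)
Lemma cameron_martin_le t y z : 0 < t ->
  cameron_martin t y z <= expR (dot y y / (2 * t)).
Proof.
move=> t0; rewrite ler_expR invfM mulrA ler_wpM2r ?invr_ge0 ?(ltW t0)//.
by have := dot_le y z; lra.
Qed.

Lemma measurable_cameron_martinr t y :
  measurable_fun setT (fun z : 'rV[R]_d => cameron_martin t y z).
Proof. exact: measurable_cameron_martin. Qed.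

Lemma integrable_cameron_martin t y : 0 < t ->
  mu.-integrable setT (fun z => (cameron_martin t y z)%:E).
Proof.
move=> t0; apply: (@ae_bounded_integrable _ _ _ mu _ (expR (dot y y / (2 * t)))).
  exact: measurable_cameron_martinr.
by apply: aeW => z; rewrite gtr0_norm ?cameron_martin_gt0// cameron_martin_le.
Qed.

Lemma integrable_coord_cameron_martin t y i : 0 < t ->
  mu.-integrable setT (fun z => (z ord0 i * cameron_martin t y z)%:E).
Proof.
move=> t0; apply: (@ae_bounded_integrable _ _ _ mu _
    (r * expR (dot y y / (2 * t)))).
  apply: measurable_funM; first exact: measurable_rowvec_coord.
  exact: measurable_cameron_martinr.
apply: filterS mur => z zr; rewrite normrM ler_pM//.
  exact: le_trans (coord_le_enorm z i) zr.
by rewrite gtr0_norm ?cameron_martin_gt0// cameron_martin_le.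
Qed.

Lemma mixtureE t y : 0 < t ->
  ((mixture t y)%:E = \int[mu]_z (cameron_martin t y z)%:E)%E.
Proof. by move=> t0; exact: EFin_Rintegral (integrable_cameron_martin y t0). Qed.

(** The integrand is at least an explicit positive constant as long as [z] stays in the ball of
    radius [r]. *)
Lemma mixture_gt0 t y : 0 < t -> 0 < mixture t y.
Proof.
move=> t0; pose c := expR (- (enorm y * r + r ^+ 2 / 2) / t).
apply: (@lt_le_trans _ _ c); first exact: expR_gt0.
have -> : c = \int[mu]_z cst c z.
  by rewrite Rintegral_cst// [X in fine X]probability_setT mulr1.
apply: ae_le_Rintegral; first exact: finite_measure_integrable_cst.
  exact: integrable_cameron_martin.
apply: filterS mur => z zr; rewrite ler_expR ler_wpM2r ?invr_ge0 ?(ltW t0)//.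
have := cauchy_schwarz y (- z).
rewrite enormN -scaleN1r dotZr -enorm_sqr => H.
have : enorm z ^+ 2 <= r ^+ 2 by rewrite ler_sqr// nnegrE ?(le_trans _ zr) ?enorm_ge0.
have : enorm y * enorm z <= enorm y * r by rewrite ler_wpM2l ?enorm_ge0.
lra.
Qed.

Lemma measurable_mixture t : 0 < t -> measurable_fun setT (mixture t).
Proof.
move=> t0; apply: (measurableT_comp (f := fine)) => //.
apply: (@measurable_fun_integral_snd _ _ _ _ _ mu
  (fun x => cameron_martin t x.1 x.2)).
exact: measurable_cameron_martin.
Qed.

Lemma measurable_post_mean t : 0 < t -> measurable_fun setT (post_mean t).
Proof.
move=> t0; apply: measurable_fun_rowvec => i.
under eq_fun do rewrite mxE.
apply: measurable_funM; last first.
  (* By positivity the inverse is [exp (- ln _)], a composition of measurable maps. *)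
  under eq_fun do rewrite -(lnK (mixture_gt0 _ t0)) -expRN.
  apply: measurableT_comp => //; apply: measurableT_comp => //.
  by apply: measurableT_comp; [exact: measurable_ln|exact: measurable_mixture].
apply: (measurableT_comp (f := fine)) => //.
apply: (@measurable_fun_integral_snd _ _ _ _ _ mu
  (fun x => x.2 ord0 i * cameron_martin t x.1 x.2)).
apply: measurable_funM; last exact: measurable_cameron_martin.
exact: (measurableT_comp (@measurable_rowvec_coord R d i)).
Qed.

Lemma post_mean_mixture t y i : 0 < t -> post_mean t y ord0 i * mixture t y =
  \int[mu]_z (z ord0 i * cameron_martin t y z).
Proof. by move=> t0; rewrite mxE divfK// gt_eqF// mixture_gt0. Qed.

(* Bias-variance: the posterior is centered at its mean, so the cross term
   vanishes. *)
Lemma posterior_sqr_le t y (u : 'rV[R]_d) (a : R) : 0 < t ->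
  (\int[mu]_z (enorm (u + a *: (z - post_mean t y)) ^+ 2 * cameron_martin t y z)%:E
   <= ((enorm u ^+ 2 + a ^+ 2 * (d%:R * r ^+ 2)) * mixture t y)%:E)%E.
Proof.
move=> t0; have [m mE] : exists m, m = post_mean t y by exists (post_mean t y).
rewrite -mE.
pose h i (z : 'rV[R]_d) := (u ord0 i + a * (z ord0 i - m ord0 i)) ^+ 2 * cameron_martin t y z.
have mh i : measurable_fun setT (h i).
  apply: measurable_funM; last exact: measurable_cameron_martinr.
  apply: measurable_funX; apply: measurable_funD => //.
  apply: measurable_funM => //; apply: measurable_funB => //.
  exact: measurable_rowvec_coord.
have h0 i z : 0 <= h i z by rewrite mulr_ge0 ?sqr_ge0// ltW// cameron_martin_gt0.
rewrite (eq_integral (fun z => \sum_(i < d) (h i z)%:E)%E); last first.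
  move=> z _; rewrite sumEFin; congr (_%:E); rewrite enorm_sum mulr_suml.
  by apply: eq_bigr => i _; rewrite !mxE.
rewrite ge0_integral_sum//; last 2 first.
- by move=> i; exact: measurable_fun_EFin.
- by move=> i z _; rewrite lee_fin.
have -> : (enorm u ^+ 2 + a ^+ 2 * (d%:R * r ^+ 2)) * mixture t y =
    \sum_(i < d) (u ord0 i ^+ 2 + a ^+ 2 * r ^+ 2) * mixture t y.
  rewrite -mulr_suml; congr (_ * _); rewrite big_split/= enorm_sum; congr (_ + _).
  by rewrite sumr_const card_ord -mulr_natl; ring.
rewrite -sumEFin; apply: lee_sum => i _.
(* In each coordinate [(u + a (z - m))^2 = (u - a m)^2 + a^2 z^2 + b z], and [A] absorbs
   [z^2 <= r^2]. Bounding every coordinate by [r] is what produces the factor [d]. *)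
pose b := 2 * a * (u ord0 i - a * m ord0 i).
pose A := (u ord0 i - a * m ord0 i) ^+ 2 + a ^+ 2 * r ^+ 2.
have i1 := integrable_cameron_martin y t0.
have i2 := integrable_coord_cameron_martin y i t0.
have i3 : mu.-integrable setT (EFin \o (fun z => A * cameron_martin t y z)).
  exact: (integrableZl measurableT A i1).
have i4 : mu.-integrable setT (EFin \o (fun z => b * (z ord0 i * cameron_martin t y z))).
  exact: (integrableZl measurableT b i2).
apply: (@le_trans _ _ (\int[mu]_z (A * cameron_martin t y z +
    b * (z ord0 i * cameron_martin t y z))%:E)%E).
  have mn (g : 'rV[R]_d -> R) : measurable_fun setT g ->
    measurable_fun setT (fun z => (`|g z|)%:E).
    by move=> mg; apply: measurable_fun_EFin; exact: measurableT_comp.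
  have mab : measurable_fun setT (fun z : 'rV[R]_d => A * cameron_martin t y z +
    b * (z ord0 i * cameron_martin t y z)).
    apply: measurable_funD; apply: measurable_funM => //.
      exact: measurable_cameron_martinr.
    apply: measurable_funM; first exact: measurable_rowvec_coord.
    exact: measurable_cameron_martinr.
  have hle z : enorm z <= r -> h i z <= A * cameron_martin t y z +
    b * (z ord0 i * cameron_martin t y z).
    move=> zr; rewrite [b * _]mulrA -mulrDl.
    rewrite ler_wpM2r ?(ltW (cameron_martin_gt0 _ _ _))//.
    have : z ord0 i ^+ 2 <= r ^+ 2.
      rewrite -real_normK ?num_real// ler_sqr ?nnegrE//.
        exact: le_trans (coord_le_enorm z i) zr.
      exact: le_trans (enorm_ge0 z) zr.
    move=> /(ler_wpM2l (sqr_ge0 a)); rewrite /A /b; lra.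
  (* The majorant is nonnegative only where [enorm z <= r]; absolute values make it so everywhere
     without changing its integral. *)
  rewrite [leRHS](_ : _ = \int[mu]_z `|A * cameron_martin t y z +
    b * (z ord0 i * cameron_martin t y z)|%:E)%E; last first.
    apply: ae_eq_integral => //; first exact: measurable_fun_EFin.
      exact: mn.
    apply: filterS mur => z /hle hz _; rewrite ger0_norm//.
    exact: le_trans (h0 i z) hz.
  apply: ae_ge0_le_integral => //.
  - by move=> z _; rewrite lee_fin.
  - exact: measurable_fun_EFin.
  - exact: mn.
  - apply: filterS mur => z /hle hz _; rewrite lee_fin.
    exact: le_trans hz (ler_norm _).
rewrite -EFin_Rintegral; last first.
  exact: (integrableD measurableT i3 i4).
rewrite RintegralD// !RintegralZl// -post_mean_mixture// lee_fin -mE.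
rewrite -/(mixture t y).
rewrite [b * _]mulrA -mulrDl ler_wpM2r ?(ltW (mixture_gt0 _ _))//.
(* [z] has posterior mean [m], and [A + b m = u^2 + a^2 r^2 - a^2 m^2]. *)
by rewrite /A /b; have := sqr_ge0 (a * m ord0 i); nra.
Qed.

End posterior.

(** * One backward step *)

Section weighted_image_probability.
Local Open Scope ereal_scope.
Context d1 d2 (T1 : measurableType d1) (T2 : measurableType d2) (R : realType).
Context (m1 : {measure set T1 -> \bar R}) (phi : T1 -> T2) (g : T1 -> R).
Hypothesis mphi : measurable_fun setT phi.
Hypothesis mg : measurable_fun setT g.
Hypothesis g0 : forall x, (0 <= g x)%R.

Definition weighted_image (A : set T2) : \bar R :=
  \int[m1]_(x in phi @^-1` A) (g x)%:E.

Let weighted_image0 : weighted_image set0 = 0.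
Proof. by rewrite /weighted_image preimage_set0 integral_set0. Qed.

Let weighted_image_ge0 A : 0 <= weighted_image A.
Proof. by apply: integral_ge0 => x _; rewrite lee_fin. Qed.

Let weighted_image_sigma_additive : semi_sigma_additive weighted_image.
Proof.
move=> F mF tF mUF; rewrite /weighted_image preimage_bigcup.
have mpF n : measurable (phi @^-1` F n).
  by rewrite -[X in measurable X]setTI; exact: mphi.
rewrite ge0_integral_bigcup//.
- apply: is_cvg_ereal_nneg_natsum_cond => n _ _.
  by apply: integral_ge0 => x _; rewrite lee_fin.
- by apply: measurable_funTS; exact: measurable_fun_EFin.
- by move=> x _; rewrite lee_fin.
- apply/trivIsetP => i j _ _ ij; rewrite -preimage_setI.
  by move/trivIsetP : tF => /(_ _ _ _ _ ij) ->//; rewrite preimage_set0.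
Qed.

HB.instance Definition _ := isMeasure.Build _ _ _ weighted_image
  weighted_image0 weighted_image_ge0 weighted_image_sigma_additive.

Hypothesis g1 : \int[m1]_x (g x)%:E = 1.

Let weighted_imageT : weighted_image setT = 1.
Proof. by rewrite /weighted_image preimage_setT. Qed.

HB.instance Definition _ :=
  @Measure_isProbability.Build _ _ R weighted_image weighted_imageT.

(** Every coupling below is obtained here, as an image measure with an explicit density, and is then
    known only through its integrals of nonnegative functions. *)
Lemma weighted_image_probability : exists gamma : probability T2 R,
  forall f, measurable_fun setT f -> (forall x, 0 <= f x) ->
    \int[gamma]_y f y = \int[m1]_x (f (phi x) * (g x)%:E).
Proof.
exists weighted_image => f mf f0.
exact: (@ge0_integral_weighted_image _ _ _ _ R m1 weighted_image phi g).
Qed.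

End weighted_image_probability.

Section tonelli.
Local Open Scope ereal_scope.
Context d1 d2 (T1 : measurableType d1) (T2 : measurableType d2) (R : realType).
Context (m1 : {sigma_finite_measure set T1 -> \bar R}).
Context (m2 : {sigma_finite_measure set T2 -> \bar R}).
Variable f : T1 * T2 -> \bar R.
Hypothesis mf : measurable_fun setT f.
Hypothesis f0 : forall x, 0 <= f x.

Lemma measurable_ge0_integral_snd :
  measurable_fun setT (fun x => \int[m2]_y f (x, y)).
Proof. exact: (measurable_fun_fubini_tonelli_F _ mf). Qed.

Lemma ge0_integral_prod : \int[m1 \x m2]_z f z = \int[m1]_x \int[m2]_y f (x, y).
Proof. by rewrite (fubini_tonelli1 f mf f0). Qed.

Lemma ge0_integral_swap :
  \int[m1]_x \int[m2]_y f (x, y) = \int[m2]_y \int[m1]_x f (x, y).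
Proof. exact: fubini_tonelli. Qed.

End tonelli.

Section one_step.
Context (R : realType) (d : nat) (mu : probability 'rV[R]_d R) (r : R).
Hypothesis mur : {ae mu, forall z, enorm z <= r}.
Notation E := 'rV[R]_d.
Notation gauss := (@gauss R d).
Implicit Types (t : R) (y z : E).

(* The law of X + B_t, as a functional. *)
Definition smoothed_law t (G : E -> \bar R) : \bar R :=
  (\int[gauss t]_y (G y * (mixture mu t y)%:E))%E.

Lemma measurable_mixtureV t : 0 < t ->
  measurable_fun setT (fun y => (mixture mu t y)^-1).
Proof.
move=> t0; under eq_fun do rewrite -(lnK (mixture_gt0 mur _ t0)) -expRN.
apply: measurableT_comp => //; apply: measurableT_comp => //.
by apply: measurableT_comp; [exact: measurable_ln|exact: measurable_mixture].
Qed.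

Lemma measurable_cameron_martin_pair t :
  measurable_fun setT (fun x : E * E => cameron_martin t x.1 x.2).
Proof. exact: measurable_cameron_martin. Qed.

(** Bayes' formula for the pair [(X + B_t, X)]: on the left [y] comes first and [z] follows the
    unnormalised posterior, on the right [z] comes first and noise is added. Tonelli and the
    translation by [z] connect them. *)
Lemma smoothed_law_kernel t (G : E * E -> \bar R) : 0 < t ->
  measurable_fun setT G -> (forall x, 0 <= G x)%E ->
  (\int[gauss t]_y \int[mu]_z (G (y, z) * (cameron_martin t y z)%:E) =
   \int[mu]_z \int[gauss t]_v G ((v + z)%R, z))%E.
Proof.
move=> t0 mG G0; pose f (x : E * E) := (G x * (cameron_martin t x.1 x.2)%:E)%E.
have mf : measurable_fun setT f.
  apply: emeasurable_funM => //; apply: measurable_fun_EFin.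
  exact: measurable_cameron_martin_pair.
have f0 x : (0 <= f x)%E by rewrite mule_ge0// lee_fin ltW// cameron_martin_gt0.
rewrite (ge0_integral_swap (gauss t) mu mf f0); apply: eq_integral => z _.
rewrite (@ge0_integral_gaussian_shift R d t z (fun y => G (y, z)) t0)//.
exact: (measurableT_comp mG (pair2_measurable z)).
Qed.

Lemma smoothed_lawE t (G : E -> \bar R) : 0 < t ->
  measurable_fun setT G -> (forall x, 0 <= G x)%E ->
  (smoothed_law t G = \int[mu]_z \int[gauss t]_v G (v + z)%R)%E.
Proof.
move=> t0 mG G0.
have mG1 : measurable_fun setT (G \o fst : E * E -> \bar R).
  exact: (measurableT_comp mG).
rewrite -(smoothed_law_kernel t0 mG1 (fun=> G0 _)).
apply: eq_integral => y _; rewrite (mixtureE _ _ t0) /= ge0_integralZl//.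
- by apply: measurable_fun_EFin; exact: measurable_cameron_martinr.
- by move=> z _; rewrite lee_fin ltW// cameron_martin_gt0.
Qed.

(** Adds a third variable that depends on [p] through [p.1] only. Its law has an explicit density
    with respect to [gamma \x mu], of mass 1 by the definition of [mixture]. *)
Lemma posterior_coupling t (gamma : probability (E * E)%type R) : 0 < t ->
  exists Gamma : probability (E * E * E)%type R,
    forall G, measurable_fun setT G -> (forall x, 0 <= G x)%E ->
    (\int[Gamma]_x G x = \int[gamma]_p ((mixture mu t p.1)^-1%:E *
      \int[mu]_z (G (p, z) * (cameron_martin t p.1 z)%:E)))%E.
Proof.
move=> t0.
have mk : measurable_fun setT
    (fun x : E * E * E => cameron_martin t x.1.1 x.2).
  apply: measurable_cameron_martin => //.
  exact: (measurableT_comp measurable_fst measurable_fst).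
have mw := measurable_mixtureV t0.
have mw1 : measurable_fun setT
    (fun x : E * E * E => (mixture mu t x.1.1)^-1).
  apply: (measurableT_comp mw).
  exact: (measurableT_comp measurable_fst measurable_fst).
have k0 y z : 0 <= cameron_martin t y z by exact: ltW (cameron_martin_gt0 _ _ _).
have w0 y : 0 <= (mixture mu t y)^-1 by rewrite invr_ge0 ltW// (mixture_gt0 mur).
pose W (x : E * E * E) := (mixture mu t x.1.1)^-1 * cameron_martin t x.1.1 x.2.
have mW : measurable_fun setT W by exact: measurable_funM.
have W0 x : 0 <= W x by rewrite mulr_ge0.
have int_prod G : measurable_fun setT G -> (forall x, 0 <= G x)%E ->
    (\int[gamma \x mu]_x (G x * (W x)%:E) = \int[gamma]_p ((mixture mu t p.1)^-1%:E *
      \int[mu]_z (G (p, z) * (cameron_martin t p.1 z)%:E)))%E.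
  move=> mG G0; rewrite ge0_integral_prod//; last 2 first.
  - by apply: emeasurable_funM => //; exact: measurable_fun_EFin.
  - by move=> x; rewrite mule_ge0// lee_fin.
  apply: eq_integral => p _; rewrite -ge0_integralZl//.
  - by apply: eq_integral => z _; rewrite muleCA -EFinM.
  - apply: emeasurable_funM; first exact: (measurableT_comp mG (pair1_measurable p)).
    by apply: measurable_fun_EFin; exact: measurable_cameron_martinr.
  - by move=> z _; rewrite mule_ge0// lee_fin.
  - exact: w0.
have [|Gamma GammaE] := @weighted_image_probability _ _ _ _ R (gamma \x mu)%E id W
    (@measurable_id _ _ _) mW W0.
  have := int_prod (cst 1%E) (measurable_cst _) (fun=> lee01).
  rewrite (eq_integral (fun x => (W x)%:E)); last by move=> x _; rewrite mul1e.
  move=> ->.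
  rewrite -[RHS](@integral_prob_cst _ _ R gamma 1%E).
  apply: eq_integral => p _; under eq_integral do rewrite mul1e.
  by rewrite -mixtureE// -EFinM mulVf// gt_eqF// (mixture_gt0 mur).
exists Gamma => G mG G0; rewrite -int_prod//; exact: GammaE.
Qed.

Lemma gaussian_scale2 (c t : R) (G : E -> \bar R) : 0 < c -> 0 < t ->
  measurable_fun setT G -> (forall x, 0 <= G x)%E ->
  (\int[gauss t]_v G (c *: v)%R = \int[gauss (c ^+ 2 * t)]_v G v)%E.
Proof.
move=> c0 t0 mG G0.
have mGc : measurable_fun setT (fun v : E => G (c *: v)).
  by apply: (measurableT_comp mG); exact: measurable_fun_rowvecZ.
rewrite -(ge0_integral_gaussian_scale t0 mGc (fun=> G0 _)).
have ct0 : 0 < c ^+ 2 * t by rewrite mulr_gt0 ?exprn_gt0.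
rewrite -(ge0_integral_gaussian_scale ct0 mG G0).
apply: eq_integral => v _; rewrite scalerA sqrtrM ?sqr_ge0// sqrtr_sqr gtr0_norm//.
Qed.

Hypothesis gauss_conv : forall (s t : R) (G : E -> \bar R), 0 < s -> 0 < t ->
  measurable_fun setT G -> (forall x, 0 <= G x)%E ->
  (\int[gauss s]_v \int[gauss t]_w G (v + w)%R = \int[gauss (s + t)]_v G v)%E.

(** The variances add up: [(1 - h/t)^2 t + h (t - h) / t = t - h]. *)
Lemma gaussian_bridge (t h : R) (G : E -> \bar R) : 0 < h -> h < t ->
  measurable_fun setT G -> (forall x, 0 <= G x)%E ->
  (\int[gauss t]_v \int[gauss 1]_g
     G ((1 - h / t) *: v + Num.sqrt (h * (t - h) / t) *: g)%R =
   \int[gauss (t - h)]_v G v)%E.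
Proof.
move=> h0 ht mG G0; have t0 : 0 < t by exact: lt_trans ht.
have th0 : 0 < t - h by rewrite subr_gt0.
have c0 : 0 < 1 - h / t by rewrite subr_gt0 ltr_pdivrMr// mul1r.
have s0 : 0 < h * (t - h) / t by rewrite divr_gt0// mulr_gt0.
have mGD v : measurable_fun setT (fun w : E => G (v + w)).
  by apply: (measurableT_comp mG); exact: measurable_fun_rowvecD.
have E1 v : (\int[gauss 1]_g G (v + Num.sqrt (h * (t - h) / t) *: g)%R =
    \int[gauss (h * (t - h) / t)]_g G (v + g)%R)%E.
  exact: (ge0_integral_gaussian_scale s0 (mGD v) (fun=> G0 _)).
under eq_integral do rewrite E1.
have mH : measurable_fun setT
    (fun v : E => \int[gauss (h * (t - h) / t)]_g G (v + g)%R)%E.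
  apply: (@measurable_ge0_integral_snd _ _ _ _ _ _ (fun x : E * E => G (x.1 + x.2)%R)) => //.
  by apply: (measurableT_comp mG); exact: measurable_fun_rowvecD.
rewrite (gaussian_scale2 c0 t0 mH); last by move=> v; exact: integral_ge0.
rewrite gauss_conv//; last by rewrite mulr_gt0// exprn_gt0.
by congr (integral (gauss _) _ _); field; rewrite gt_eqF.
Qed.

(** [F] and [b] are left free because the step is used twice: with the Euler map and [b = sqrt h]
    for the sampler, and with a dilation and the intensity of the bridge itself for the initial
    error, where the last term vanishes. *)
Lemma one_step (gamma : probability (E * E)%type R) (t h b : R) (F : E -> E) :
  0 < h -> h < t -> measurable_fun setT F ->
  (forall G, measurable_fun setT G -> (forall x, 0 <= G x)%E ->
    \int[gamma]_p G p.1 = smoothed_law t G)%E ->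
  exists gamma' : probability (E * E)%type R,
  [/\ forall G, measurable_fun setT G -> (forall x, 0 <= G x)%E ->
        (\int[gamma']_p G p.1 = smoothed_law (t - h) G)%E,
      forall G, measurable_fun setT G -> (forall x, 0 <= G x)%E ->
        (\int[gamma']_p G p.2 =
         \int[gamma]_p \int[gauss 1]_g G (F p.2 + b *: g)%R)%E &
      (\int[gamma']_p (enorm (p.1 - p.2) ^+ 2)%:E <=
       \int[gamma]_p
         (enorm (p.1 + (h / t) *: (post_mean mu t p.1 - p.1) - F p.2) ^+ 2)%:E +
       ((h / t) ^+ 2 * (d%:R * r ^+ 2) +
        (Num.sqrt (h * (t - h) / t) - b) ^+ 2 * d%:R)%:E)%E].
Proof.
move=> h0 ht mF gamma1; have t0 : 0 < t by exact: lt_trans ht.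
set a := Num.sqrt (h * (t - h) / t).
have [Gamma GammaE] := posterior_coupling gamma t0.
(* [x] stands for [(((y, xhat), z), g)]: the current pair, the posterior draw and the shared
   Gaussian. *)
pose phi (x : E * E * E * E) : E * E :=
  (x.1.1.1 + (h / t) *: (x.1.2 - x.1.1.1) + a *: x.2, F x.1.1.2 + b *: x.2).
have mf1 : measurable_fun setT (fun x : E * E * E * E => x.1.1).
  exact: (measurableT_comp measurable_fst measurable_fst).
have m1 : measurable_fun setT (fun x : E * E * E * E => x.1.1.1).
  exact: (measurableT_comp measurable_fst mf1).
have m2 : measurable_fun setT (fun x : E * E * E * E => x.1.1.2).
  exact: (measurableT_comp measurable_snd mf1).
have m3 : measurable_fun setT (fun x : E * E * E * E => x.1.2).
  exact: (measurableT_comp measurable_snd measurable_fst).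
have mphi : measurable_fun setT phi.
  apply: measurable_fun_pair.
    apply: measurable_fun_rowvecD; last exact: measurable_fun_rowvecZ.
    apply: measurable_fun_rowvecD => //; apply: measurable_fun_rowvecZ => //.
    exact: measurable_fun_rowvecB.
  apply: measurable_fun_rowvecD; last exact: measurable_fun_rowvecZ.
  exact: (measurableT_comp mF).
have int_phi G : measurable_fun setT G -> (forall x, 0 <= G x)%E ->
    (\int[Gamma \x gauss 1]_x (G (phi x) * 1%:E) =
     \int[gamma]_p ((mixture mu t p.1)^-1%:E *
      \int[mu]_z ((\int[gauss 1]_g G (phi (p, z, g)))
                   * (cameron_martin t p.1 z)%:E)))%E.
  move=> mG G0; under eq_integral do rewrite mule1.
  have mGphi : measurable_fun setT (G \o phi) by exact: measurableT_comp.
  rewrite (ge0_integral_prod _ _ mGphi (fun=> G0 _)) GammaE//.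
  - exact: (measurable_ge0_integral_snd _ mGphi (fun=> G0 _)).
  - by move=> x; apply: integral_ge0 => g _; exact: G0.
have [|gamma' gamma'E] := @weighted_image_probability _ _ _ _ R
    (Gamma \x gauss 1)%E phi (fun=> 1) mphi (measurable_cst _) (fun=> ler01).
  have mc1 : measurable_fun [set: E * E * E * E] (fun=> 1%E : \bar R).
    exact: measurable_cst.
  rewrite (ge0_integral_prod Gamma (gauss 1) mc1 (fun=> lee01)).
  under eq_integral do rewrite integral_gaussian_cst.
  exact: integral_prob_cst.
have w0 y : (0 <= (mixture mu t y)^-1%:E)%E.
  by rewrite lee_fin invr_ge0 ltW// (mixture_gt0 mur).
(* What does not depend on [z] is unchanged by the posterior average; this settles the second
   marginal. *)
have wE (c : \bar R) y : (0 <= c)%E -> ((mixture mu t y)^-1%:E *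
      \int[mu]_z (c * (cameron_martin t y z)%:E) = c)%E.
  move=> c0; rewrite ge0_integralZl//; last 2 first.
  - by apply: measurable_fun_EFin; exact: measurable_cameron_martinr.
  - by move=> z _; rewrite lee_fin ltW// cameron_martin_gt0.
  rewrite -mixtureE// muleCA -EFinM mulVf ?mule1// gt_eqF//.
  exact: (mixture_gt0 mur).
exists gamma'; split.
- move=> G mG G0; have mG1 := measurableT_comp mG (@measurable_fst _ _ E E).
  rewrite (gamma'E _ mG1 (fun=> G0 _)) (int_phi _ mG1 (fun=> G0 _)).
  pose H (x : E * E) :=
    (\int[gauss 1]_g G (x.1 + (h / t) *: (x.2 - x.1) + a *: g)%R)%E.
  have mH : measurable_fun setT H.
    apply: (@measurable_ge0_integral_snd _ _ _ _ _ _ (fun x : E * E * E =>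
       G (x.1.1 + (h / t) *: (x.1.2 - x.1.1) + a *: x.2)%R)) => //.
    have n1 : measurable_fun setT (fun x : E * E * E => x.1.1).
      exact: (measurableT_comp measurable_fst measurable_fst).
    have n2 : measurable_fun setT (fun x : E * E * E => x.1.2).
      exact: (measurableT_comp measurable_snd measurable_fst).
    apply: (measurableT_comp mG).
    apply: measurable_fun_rowvecD; last exact: measurable_fun_rowvecZ.
    apply: measurable_fun_rowvecD => //; apply: measurable_fun_rowvecZ => //.
    exact: measurable_fun_rowvecB.
  have H0 x : (0 <= H x)%E by exact: integral_ge0.
  have mHk : measurable_fun setT
      (fun x : E * E => (H x * (cameron_martin t x.1 x.2)%:E)%E).
    apply: emeasurable_funM => //; apply: measurable_fun_EFin.
    exact: measurable_cameron_martin_pair.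
  have Hk0 x : (0 <= H x * (cameron_martin t x.1 x.2)%:E)%E.
    by rewrite mule_ge0// lee_fin ltW// cameron_martin_gt0.
  have mw := measurable_mixtureV t0.
  transitivity (smoothed_law t (fun y => (mixture mu t y)^-1%:E *
      \int[mu]_z (H (y, z) * (cameron_martin t y z)%:E))%E).
    rewrite -gamma1//.
    - apply: emeasurable_funM; first exact: measurable_fun_EFin.
      exact: (measurable_ge0_integral_snd _ mHk Hk0).
    - move=> y; rewrite mule_ge0//; apply: integral_ge0 => z _.
      exact: (Hk0 (y, z)).
  (* The normalisation cancels against the density of [y], which leaves the unnormalised posterior
     of Bayes' formula. *)
  transitivity (\int[gauss t]_y \int[mu]_z (H (y, z) * (cameron_martin t y z)%:E))%E.
    apply: eq_integral => y _; rewrite muleAC -EFinM mulVf ?mul1e//.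
    by rewrite gt_eqF// (mixture_gt0 mur).
  rewrite (smoothed_law_kernel t0 mH H0) smoothed_lawE ?subr_gt0//.
  apply: eq_integral => z _.
  have mGz : measurable_fun setT (fun v : E => G (v + z)).
    by apply: (measurableT_comp mG); exact: measurable_fun_rowvecD.
  (* With [y = v + z], [y + (h/t) (z - y) = z + (1 - h/t) v]: the Gaussian bridge, translated by
     [z]. *)
  rewrite -(gaussian_bridge h0 ht mGz (fun=> G0 _)).
  apply: eq_integral => v _; apply: eq_integral => g _; congr G.
  by apply/rowP => i; rewrite !mxE /a; ring.
- move=> G mG G0; have mG2 := measurableT_comp mG (@measurable_snd _ _ E E).
  rewrite (gamma'E _ mG2 (fun=> G0 _)) (int_phi _ mG2 (fun=> G0 _)).
  apply: eq_integral => p _.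
  by apply: (wE (\int[gauss 1]_g G (F p.2 + b *: g)%R)%E); exact: integral_ge0.
- have mD : measurable_fun setT (fun p : E * E => (enorm (p.1 - p.2) ^+ 2)%:E).
    apply: measurable_fun_EFin; apply: measurable_funX.
    by apply: measurable_fun_enorm; exact: measurable_fun_rowvecB.
  have D0 (p : E * E) : (0 <= (enorm (p.1 - p.2) ^+ 2)%:E)%E.
    by rewrite lee_fin sqr_ge0.
  rewrite (gamma'E _ mD D0) (int_phi _ mD D0).
  pose u (p : E * E) := p.1 + (h / t) *: (post_mean mu t p.1 - p.1) - F p.2.
  pose c2 := (h / t) ^+ 2 * (d%:R * r ^+ 2).
  pose c3 := (a - b) ^+ 2 * d%:R.
  have mu2 : measurable_fun setT (fun p => (enorm (u p) ^+ 2)%:E).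
    have n1 : measurable_fun setT (fun p : E * E => post_mean mu t p.1).
      exact: (measurableT_comp (measurable_post_mean mur t0)).
    apply: measurable_fun_EFin; apply: measurable_funX.
    apply: measurable_fun_enorm; apply: measurable_fun_rowvecB.
      apply: measurable_fun_rowvecD => //; apply: measurable_fun_rowvecZ => //.
      exact: measurable_fun_rowvecB.
    exact: (measurableT_comp mF).
  have c230 : 0 <= c2 + c3.
    by rewrite addr_ge0// mulr_ge0 ?sqr_ge0// mulr_ge0 ?sqr_ge0.
  rewrite -[X in (_ + X)%E](@integral_prob_cst _ _ R gamma (c2 + c3)%:E).
  have u20 p : (0 <= (enorm (u p) ^+ 2)%:E)%E by rewrite lee_fin sqr_ge0.
  have c230' : (0 <= (c2 + c3)%:E)%E by rewrite lee_fin.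
  rewrite -(ge0_integralD gamma measurableT (fun p _ => u20 p) mu2 (fun _ _ => c230')
    (measurable_cst _)).
  have mDphi : measurable_fun setT (fun x => (enorm ((phi x).1 - (phi x).2) ^+ 2)%:E).
    exact: (measurableT_comp mD mphi).
  have D0' x : (0 <= (enorm ((phi x).1 - (phi x).2) ^+ 2)%:E)%E by exact: D0.
  have mI := measurable_ge0_integral_snd (gauss 1) mDphi D0'.
  have I0 x : (0 <= \int[gauss 1]_g
      (enorm ((phi (x, g)).1 - (phi (x, g)).2) ^+ 2)%:E)%E.
    exact: integral_ge0.
  have k0 y z : (0 <= (cameron_martin t y z)%:E)%E.
    by rewrite lee_fin ltW// cameron_martin_gt0.
  have mk y : measurable_fun setT (fun z : E => (cameron_martin t y z)%:E).
    by apply: measurable_fun_EFin; exact: measurable_cameron_martinr.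
  have mIk : measurable_fun setT (fun x : E * E * E => (\int[gauss 1]_g
      (enorm ((phi (x, g)).1 - (phi (x, g)).2) ^+ 2)%:E *
      (cameron_martin t x.1.1 x.2)%:E)%E).
    apply: emeasurable_funM => //; apply: measurable_fun_EFin.
    apply: measurable_cameron_martin => //.
    exact: (measurableT_comp measurable_fst measurable_fst).
  have Ik0 x : (0 <= \int[gauss 1]_g
      (enorm ((phi (x, g)).1 - (phi (x, g)).2) ^+ 2)%:E *
      (cameron_martin t x.1.1 x.2)%:E)%E by rewrite mule_ge0.
  apply: ge0_le_integral => //.
  - move=> p _; rewrite mule_ge0//; apply: integral_ge0 => z _.
    exact: (Ik0 (p, z)).
  - apply: emeasurable_funM.
      exact: (measurable_fun_EFin (measurableT_comp (measurable_mixtureV t0)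
        measurable_fst)).
    exact: (measurable_ge0_integral_snd _ mIk Ik0).
  - by apply: emeasurable_funD => //; exact: measurable_cst.
  move=> p _; set y := p.1.
  (* The two components differ by [c z + (a - b) g]. Integrating out [g] leaves the mismatch of
     intensities, then integrating out [z] leaves the posterior fluctuation. *)
  pose c (z : E) := u p + (h / t) *: (z - post_mean mu t y).
  have mc : measurable_fun setT c.
    apply: measurable_fun_rowvecD => //; apply: measurable_fun_rowvecZ => //.
    exact: measurable_fun_rowvecB.
  have mc2 : measurable_fun setT (fun z => (enorm (c z) ^+ 2)%:E).
    apply: measurable_fun_EFin; apply: measurable_funX.
    exact: measurable_fun_enorm.
  have c20 z : (0 <= (enorm (c z) ^+ 2)%:E)%E by rewrite lee_fin sqr_ge0.
  have c30 : (0 <= c3%:E)%E by rewrite lee_fin mulr_ge0 ?sqr_ge0.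
  have f0 : 0 < mixture mu t y by exact: (mixture_gt0 mur).
  rewrite lee_pdivrMl// [(_ + (c2 + c3)%:E)%E]addeC -!EFinD -EFinM.
  apply: (@le_trans _ _ (\int[mu]_z
      ((enorm (c z) ^+ 2)%:E * (cameron_martin t y z)%:E +
       c3%:E * (cameron_martin t y z)%:E))%E).
    apply: ge0_le_integral => //.
    - exact: (measurableT_comp mIk (pair1_measurable p)).
    - by apply: emeasurable_funD; exact: emeasurable_funM.
    - move=> z _; rewrite -ge0_muleDl//; apply: lee_wpmul2r => //.
      rewrite -EFinD; apply: le_trans (gaussian1_shift_sqr (c z) (a - b)).
      apply: ge0_le_integral => //.
      + exact: (measurableT_comp mDphi (pair1_measurable (p, z))).
      + apply: measurable_fun_EFin; apply: measurable_funX.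
        apply: measurable_fun_enorm; apply: measurable_fun_rowvecD => //.
        exact: measurable_fun_rowvecZ.
      + move=> g _; rewrite lee_fin le_eqVlt; apply/orP; left; apply/eqP.
        congr (enorm _ ^+ 2); rewrite /phi /c /u /y.
        move: (post_mean _ _ _) => m.
        by apply/rowP => i; rewrite !mxE; ring.
  rewrite ge0_integralD//; last 4 first.
  - by move=> z _; rewrite mule_ge0.
  - exact: emeasurable_funM.
  - by move=> z _; rewrite mule_ge0.
  - exact: emeasurable_funM.
  rewrite ge0_integralZl// -mixtureE//.
  have := posterior_sqr_le mur y (u p) (h / t) t0.
  under eq_integral do rewrite EFinM.
  move=> H; apply: (le_trans (leeD2r _ H)).
  by rewrite -EFinM -EFinD lee_fin -/c2 -/y; nra.
Qed.

End one_step.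

(** * The initial error *)

Section post_mean_norm.
Context (R : realType) (d : nat) (mu : probability 'rV[R]_d R) (r : R).
Hypothesis mur : {ae mu, forall z, enorm z <= r}.
Hypothesis mu0 : forall i, \int[mu]_z (z ord0 i) = 0.
Notation E := 'rV[R]_d.
Notation gauss := (@gauss R d).
Implicit Types (t : R) (y z : E).

(** A negative radius would make the almost sure bound false everywhere, against the total mass
    1. *)
Lemma ae_radius_ge0 : 0 <= r.
Proof.
have [//|r0] := leP 0 r; exfalso.
have : {ae mu, forall z, False}.
  apply: filterS mur => z zr; have := le_trans (enorm_ge0 z) zr.
  by rewrite leNgt r0.
move=> [N [mN muN NT]].
have : mu setT = 0%E.
  apply/eqP; rewrite eq_le measure_ge0 andbT -muN.
  by apply: le_measure; rewrite ?inE//; apply: subset_trans NT => x _ /=.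
by rewrite probability_setT => /eqP; rewrite onee_eq0.
Qed.

Lemma cameron_martin_mul t y z z' : 0 < t ->
  cameron_martin t (y + z) z' = expR (dot z z' / t) * cameron_martin t y z'.
Proof.
by move=> t0; rewrite /cameron_martin -expRD dotDl; congr expR; field; rewrite gt_eqF.
Qed.

(** This is the chi-square divergence of [N(z, tI)] from [N(0, tI)]. Translation by [z] gives
    [E k^2 = exp (|z|^2 / t)], and [E k = 1]. *)
Lemma gaussian_cameron_martin_sqrB1 t z : 0 < t ->
  (\int[gauss t]_y ((cameron_martin t y z - 1) ^+ 2)%:E =
   (expR (dot z z / t) - 1)%:E)%E.
Proof.
move=> t0; set k := fun y => cameron_martin t y z.
have mk : measurable_fun setT k by exact: measurable_cameron_martin.
have k0 y : 0 <= k y by exact: ltW (cameron_martin_gt0 _ _ _).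
have mkE := measurable_fun_EFin mk.
have k0E y : (0 <= (k y)%:E)%E by rewrite lee_fin.
have k2 : (\int[gauss t]_y ((k y)%:E * (k y)%:E) = (expR (dot z z / t))%:E)%E.
  rewrite -(ge0_integral_gaussian_shift z t0 mkE k0E).
  under eq_integral do rewrite /k cameron_martin_mul// EFinM.
  have e0 : (0 <= (expR (dot z z / t))%:E)%E by rewrite lee_fin expR_ge0.
  rewrite (ge0_integralZl _ measurableT mkE (fun y _ => k0E y) e0).
  by rewrite expectation_cameron_martin// mule1.
have mkB : measurable_fun setT (fun y => ((k y - 1) ^+ 2)%:E).
  apply: measurable_fun_EFin; apply: measurable_funX.
  exact: measurable_funB.
have kB0 y : (0 <= ((k y - 1) ^+ 2)%:E)%E by rewrite lee_fin sqr_ge0.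
have c20 : (0 <= 2%:E :> \bar R)%E by rewrite lee_fin.
have m2k : measurable_fun setT (fun y => 2%:E * (k y)%:E)%E by exact: emeasurable_funM.
have k20 y : (0 <= 2%:E * (k y)%:E)%E by rewrite mule_ge0.
have mkk : measurable_fun setT (fun y => (k y)%:E * (k y)%:E)%E by exact: emeasurable_funM.
have kk0 y : (0 <= (k y)%:E * (k y)%:E)%E by rewrite mule_ge0.
(* The term [- 2 k] of the square is moved to the other side, so that all integrands stay
   nonnegative. *)
have H : (\int[gauss t]_y ((k y - 1) ^+ 2)%:E + 2%:E =
    (expR (dot z z / t))%:E + 1%:E)%E.
  transitivity (\int[gauss t]_y (((k y - 1) ^+ 2)%:E + 2%:E * (k y)%:E))%E.
    rewrite (ge0_integralD (gauss t) measurableT (fun y _ => kB0 y) mkB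
      (fun y _ => k20 y) m2k).
    rewrite (ge0_integralZl _ measurableT mkE (fun y _ => k0E y) c20).
    by rewrite expectation_cameron_martin// mule1.
  transitivity (\int[gauss t]_y ((k y)%:E * (k y)%:E + 1%:E))%E.
    apply: eq_integral => y _; rewrite -!EFinM -!EFinD; congr (_%:E); ring.
  rewrite (ge0_integralD (gauss t) measurableT (fun y _ => kk0 y) mkk
      (fun y _ => lee01) (measurable_cst _)).
  by rewrite k2 integral_gaussian_cst.
have : (\int[gauss t]_y ((k y - 1) ^+ 2)%:E = (expR (dot z z / t))%:E + 1%:E - 2%:E)%E.
  by rewrite -H addeK.
by move=> ->; rewrite -!EFinD; congr (_%:E); ring.
Qed.

(** The exponential lies above [1 + (<y,z> - |z|^2/2) / t], whose linear term integrates to 0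
    because [mu] is centred. *)
Lemma mixture_ge t y : 0 < t -> 1 - r ^+ 2 / (2 * t) <= mixture mu t y.
Proof.
move=> t0.
have i_coord i : mu.-integrable setT (fun z : E => (z ord0 i)%:E).
  apply: (@ae_bounded_integrable _ _ _ mu _ r); first exact: measurable_rowvec_coord.
  by apply: filterS mur => z; exact: le_trans (coord_le_enorm z i).
have i_dot : mu.-integrable setT (EFin \o dot y).
  apply: (@ae_bounded_integrable _ _ _ mu _ (enorm y * r)).
    exact: measurable_fun_dot.
  apply: filterS mur => z zr; rewrite ler_norml.
  have yz : enorm y * enorm z <= enorm y * r by rewrite ler_wpM2l ?enorm_ge0.
  rewrite (le_trans (cauchy_schwarz _ _) yz) andbT.
  have := cauchy_schwarz y (- z); rewrite enormN -scaleN1r dotZr; lra.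
have dot0 : \int[mu]_z dot y z = 0.
  rewrite /Rintegral (eq_integral (fun z : E => \sum_(i < d) ((y ord0 i)%:E * (z ord0 i)%:E))%E); last first.
    by move=> z _; rewrite -sumEFin; apply: eq_bigr => i _; rewrite EFinM.
  rewrite integral_sum//; last by move=> i; exact: (integrableZl measurableT _ (i_coord i)).
  rewrite big1// => i _; rewrite integralZl//.
  by rewrite -(EFin_Rintegral (i_coord i)) mu0 mule0.
have ic (c : R) : mu.-integrable setT (EFin \o (fun _ : E => c)).
  exact: finite_measure_integrable_cst.
have iZ := integrableZl measurableT t^-1 i_dot.
have -> : 1 - r ^+ 2 / (2 * t) = \int[mu]_z ((1 - r ^+ 2 / (2 * t)) + t^-1 * dot y z).
  rewrite RintegralD// RintegralZl// dot0 mulr0 addr0 Rintegral_cst//.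
  by rewrite [X in fine X]probability_setT mulr1.
apply: ae_le_Rintegral.
- exact: (integrableD measurableT (ic _) iZ).
- exact: integrable_cameron_martin.
apply: filterS mur => z zr; apply: le_trans (expR_ge1Dx _).
have : dot z z <= r ^+ 2.
  by rewrite -enorm_sqr ler_sqr// ?nnegrE ?enorm_ge0 ?ae_radius_ge0.
move=> H; rewrite -addrA lerD2l mulrBl (mulrC _ (dot y z)) addrC lerD2l.
rewrite lerN2 invfM mulrA ler_wpM2r ?invr_ge0 ?(ltW t0)//; lra.
Qed.

(** Centring allows the density [k] to be replaced by [k - 1] in the numerator of the posterior
    mean, whose square is then governed by [r^2] times the chi-square divergence, itself of order
    [r^2 / t]. Of the two factors [1 / mixture], the weight of [smoothed_law] absorbs one and
    [mixture_ge] bounds the other. *)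
Lemma smoothed_post_mean_le t : r ^+ 2 < 2 * t ->
  (smoothed_law mu t (fun y => (enorm (post_mean mu t y) ^+ 2)%:E) <=
   (r ^+ 2 * (expR (r ^+ 2 / t) - 1) / (1 - r ^+ 2 / (2 * t)))%:E)%E.
Proof.
move=> rt; have t0 : 0 < t by have := sqr_ge0 r; lra.
have q0 : 0 < 1 - r ^+ 2 / (2 * t).
  by rewrite subr_gt0 ltr_pdivrMr ?mul1r// mulr_gt0.
have r0 := ae_radius_ge0.
set q := 1 - _ in q0 *.
pose N i y := \int[mu]_z (z ord0 i * cameron_martin t y z).
have i_coord i : mu.-integrable setT (fun z : E => (z ord0 i)%:E).
  apply: (@ae_bounded_integrable _ _ _ mu _ r); first exact: measurable_rowvec_coord.
  by apply: filterS mur => z; exact: le_trans (coord_le_enorm z i).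
pose K (x : E * E) := (cameron_martin t x.1 x.2 - 1) ^+ 2.
have mK : measurable_fun setT (fun x => (K x)%:E).
  apply: measurable_fun_EFin; apply: measurable_funX; apply: measurable_funB => //.
  exact: measurable_cameron_martin_pair.
have K0 x : (0 <= (K x)%:E)%E by rewrite lee_fin sqr_ge0.
have N2 y : ((\sum_i N i y ^+ 2)%:E <= (r ^+ 2)%:E * \int[mu]_z (K (y, z))%:E)%E.
  have mKy : measurable_fun setT (fun z => (K (y, z))%:E).
    exact: (measurableT_comp mK (pair1_measurable y)).
  have mB : measurable_fun setT (fun z : E => cameron_martin t y z - 1).
    by apply: measurable_funB => //; exact: measurable_cameron_martinr.
  apply: (@le_trans _ _ (\sum_(i < d) \int[mu]_z ((z ord0 i * (cameron_martin t y z - 1)) ^+ 2)%:E)%E).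
    rewrite -sumEFin; apply: lee_sum => i _.
    have iB : mu.-integrable setT (EFin \o (fun z : E => z ord0 i * (cameron_martin t y z - 1))).
      have -> : EFin \o (fun z : E => z ord0 i * (cameron_martin t y z - 1)) =
          ((fun z : E => (z ord0 i * cameron_martin t y z)%:E) \- (fun z => (z ord0 i)%:E))%E.
        by apply/funext => z /=; rewrite mulrBr mulr1 EFinB.
      exact: (integrableB measurableT (integrable_coord_cameron_martin mur y i t0) (i_coord i)).
    have -> : N i y = \int[mu]_z (z ord0 i * (cameron_martin t y z - 1)).
      rewrite -[LHS]subr0 -(mu0 i) -(RintegralB measurableT
        (integrable_coord_cameron_martin mur y i t0) (i_coord i)).
      by apply: eq_Rintegral => z _; rewrite mulrBr mulr1.
    exact: sqr_Rintegral_le.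
  rewrite -ge0_integral_sum//; last 2 first.
  - move=> i; apply: measurable_fun_EFin; apply: measurable_funX.
    by apply: measurable_funM => //; exact: measurable_rowvec_coord.
  - by move=> i z _; rewrite lee_fin sqr_ge0.
  rewrite -ge0_integralZl//; last by rewrite lee_fin sqr_ge0.
  apply: ae_ge0_le_integral => //.
  - by move=> z _; apply: sume_ge0 => i _; rewrite lee_fin sqr_ge0.
  - apply: emeasurable_sum => i; apply: measurable_fun_EFin; apply: measurable_funX.
    by apply: measurable_funM => //; exact: measurable_rowvec_coord.
  - by move=> z _; rewrite mule_ge0// lee_fin sqr_ge0.
  - exact: emeasurable_funM.
  apply: filterS mur => z zr _; rewrite sumEFin -EFinM lee_fin.
  under eq_bigr do rewrite exprMn.
  rewrite -mulr_suml -enorm_sum ler_wpM2r ?sqr_ge0//.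
  by rewrite ler_sqr ?nnegrE ?enorm_ge0.
have mI := measurable_ge0_integral_snd mu mK K0.
have I0 y : (0 <= \int[mu]_z (K (y, z))%:E)%E by exact: integral_ge0.
have mpm := measurable_post_mean mur t0.
have mmix := measurable_mixture mu t0.
apply: (@le_trans _ _ (\int[gauss t]_y ((r ^+ 2 / q)%:E * \int[mu]_z (K (y, z))%:E))%E).
  apply: ge0_le_integral => //.
  - move=> y _; rewrite mule_ge0 ?lee_fin ?sqr_ge0//.
    exact: ltW (mixture_gt0 mur y t0).
  - apply: emeasurable_funM; apply: measurable_fun_EFin => //.
    by apply: measurable_funX; exact: measurable_fun_enorm.
  - exact: emeasurable_funM.
  move=> y _; have f0 := mixture_gt0 mur y t0.
  have -> : (enorm (post_mean mu t y) ^+ 2)%:E =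
      ((mixture mu t y)^-1 ^+ 2 * \sum_i N i y ^+ 2)%:E.
    congr (_%:E); rewrite enorm_sum mulr_sumr; apply: eq_bigr => i _.
    by rewrite mxE exprMn mulrC.
  rewrite -EFinM [X in (X%:E <= _)%E](_ : _ =
    (mixture mu t y)^-1 * \sum_i N i y ^+ 2); last by field; rewrite gt_eqF.
  rewrite EFinM; apply: (@le_trans _ _ ((mixture mu t y)^-1%:E *
     ((r ^+ 2)%:E * \int[mu]_z (K (y, z))%:E))%E).
    by apply: lee_wpmul2l => //; rewrite lee_fin invr_ge0 ltW.
  rewrite muleA; apply: lee_wpmul2r => //.
  rewrite -EFinM lee_fin mulrC ler_wpM2l ?sqr_ge0// lef_pV2 ?posrE//.
  exact: mixture_ge.
rewrite ge0_integralZl//; last by rewrite lee_fin divr_ge0 ?sqr_ge0 ?ltW.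
rewrite (ge0_integral_swap (gauss t) mu mK K0).
under eq_integral do rewrite /K/= gaussian_cameron_martin_sqrB1//.
rewrite [X in (_ <= X%:E)%E](_ : _ = (r ^+ 2 / q) * (expR (r ^+ 2 / t) - 1)); last first.
  by field; rewrite !gt_eqF.
rewrite [leRHS]EFinM; apply: lee_wpmul2l.
  by rewrite lee_fin divr_ge0 ?sqr_ge0 ?ltW.
rewrite -[leRHS](@integral_prob_cst _ _ R mu).
apply: ae_ge0_le_integral => //.
- move=> z _; rewrite lee_fin subr_ge0 -[leLHS]expR0 ler_expR.
  by rewrite divr_ge0 ?dotvv_ge0 ?ltW.
- apply: measurable_fun_EFin; apply: measurable_funB => //.
  apply: measurableT_comp => //; apply: measurable_funM => //.
  exact: measurable_fun_dot.
- move=> z _; rewrite lee_fin subr_ge0 -[leLHS]expR0 ler_expR.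
  by rewrite divr_ge0 ?sqr_ge0 ?ltW.
apply: filterS mur => z zr _; rewrite lee_fin lerD2r ler_expR.
rewrite ler_wpM2r ?invr_ge0 ?(ltW t0)// -enorm_sqr.
by rewrite ler_sqr ?nnegrE ?enorm_ge0.
Qed.

End post_mean_norm.

(** * Combination of quadratic errors *)

Section minkowski_sqr.
Context (R : realType) (d : nat) dT (T : measurableType dT) (P : probability T R).

(** Young's inequality with the weights [b'/a'] and [a'/b'], for which the bound is exactly
    [(a' + b')^2]. The weights need positive numbers, hence the detour through [a + e/2] and
    [b + e/2]. *)
Lemma minkowski_sqr (u v : T -> 'rV[R]_d) (a b : R) :
  measurable_fun setT u -> measurable_fun setT v -> 0 <= a -> 0 <= b ->
  (\int[P]_x (enorm (u x) ^+ 2)%:E <= (a ^+ 2)%:E)%E ->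
  (\int[P]_x (enorm (v x) ^+ 2)%:E <= (b ^+ 2)%:E)%E ->
  (\int[P]_x (enorm (u x + v x) ^+ 2)%:E <= ((a + b) ^+ 2)%:E)%E.
Proof.
move=> mmu mmv a0 b0 ua vb.
have msq (w : T -> 'rV[R]_d) : measurable_fun setT w ->
    measurable_fun setT (fun x => (enorm (w x) ^+ 2)%:E).
  move=> mw; apply: measurable_fun_EFin; apply: measurable_funX.
  exact: measurable_fun_enorm.
have sq0 (x : R) : (0 <= (x ^+ 2)%:E)%E by rewrite lee_fin sqr_ge0.
have pos (a' b' : R) : 0 < a' -> 0 < b' -> a <= a' -> b <= b' ->
    (\int[P]_x (enorm (u x + v x) ^+ 2)%:E <= ((a' + b') ^+ 2)%:E)%E.
  move=> a'0 b'0 aa' bb'.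
  have l0 : 0 <= 1 + b' / a' by rewrite addr_ge0 ?divr_ge0 ?ltW.
  have l1 : 0 <= 1 + a' / b' by rewrite addr_ge0 ?divr_ge0 ?ltW.
  apply: (@le_trans _ _ (\int[P]_x ((1 + b' / a')%:E * (enorm (u x) ^+ 2)%:E +
      (1 + a' / b')%:E * (enorm (v x) ^+ 2)%:E))%E).
    apply: ge0_le_integral => //.
    - by apply: msq; exact: measurable_fun_rowvecD.
    - by apply: emeasurable_funD; apply: emeasurable_funM => //; exact: msq.
    move=> x _; rewrite -!EFinM -EFinD lee_fin.
    have [c c0 ->] : exists2 c, 0 < c & b' = c * a'.
      by exists (b' / a'); [rewrite divr_gt0|rewrite divfK// gt_eqF].
    have -> : a' / (c * a') = c^-1 by field; rewrite !gt_eqF.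
    rewrite mulfK ?gt_eqF//.
    rewrite !enorm_sqr dotDl !dotDr (dotC (v x) (u x)).
    have := dot_le (c *: u x) (v x); rewrite !(dotZl, dotZr) => H.
    have : c^-1 * (2 * (c * dot (u x) (v x))) <=
        c^-1 * (c * (c * dot (u x) (u x)) + dot (v x) (v x)).
      by rewrite ler_wpM2l ?invr_ge0 ?(ltW c0)//; lra.
    rewrite mulrCA mulKf ?gt_eqF// mulrDr mulKf ?gt_eqF//; lra.
  have mu1 : measurable_fun setT (fun x => (1 + b' / a')%:E * (enorm (u x) ^+ 2)%:E)%E.
    by apply: emeasurable_funM => //; exact: msq.
  have mv1 : measurable_fun setT (fun x => (1 + a' / b')%:E * (enorm (v x) ^+ 2)%:E)%E.
    by apply: emeasurable_funM => //; exact: msq.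
  rewrite ge0_integralD//; last 2 first.
  - by move=> x _; rewrite mule_ge0// lee_fin.
  - by move=> x _; rewrite mule_ge0// lee_fin.
  rewrite !ge0_integralZl//; try exact: msq.
  apply: (@le_trans _ _ ((1 + b' / a')%:E * (a' ^+ 2)%:E + (1 + a' / b')%:E * (b' ^+ 2)%:E)%E).
    apply: leeD; apply: lee_wpmul2l; rewrite ?lee_fin//.
    - by apply: le_trans ua _; rewrite lee_fin ler_sqr ?nnegrE// ltW.
    - by apply: le_trans vb _; rewrite lee_fin ler_sqr ?nnegrE// ltW.
  rewrite -!EFinM -EFinD lee_fin le_eqVlt; apply/orP; left; apply/eqP.
  by field; rewrite !gt_eqF.
move: pos; set I := (\int[P]_x _)%E => pos.
have I0 : (0 <= I)%E by exact: integral_ge0.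
have {}pos (e : R) : 0 < e -> (I <= ((a + b + e) ^+ 2)%:E)%E.
  move=> e0; have := pos (a + e / 2) (b + e / 2).
  rewrite (_ : a + e / 2 + (b + e / 2) = a + b + e); last by field.
  by apply; lra.
case: I I0 pos => [x x0 pos|_ /(_ 1 ltr01)|//]; last by rewrite leye_eq.
rewrite lee_fin -[x]sqr_sqrtr// ler_sqr ?nnegrE ?sqrtr_ge0 ?addr_ge0//.
apply/ler_addgt0Pr => e e0; have := pos e e0; rewrite lee_fin.
by rewrite -{1}[x]sqr_sqrtr// ler_sqr ?nnegrE ?sqrtr_ge0// !addr_ge0// ltW.
Qed.

End minkowski_sqr.

(** Minkowski in the plane: [(c A + q + c sqrt V, sqrt v)] is the sum of [(c A + q, 0)] and
    [(c sqrt V, sqrt v)]. *)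
Lemma sqrt_chain_le (R : realType) (A V q v c : R) : 0 <= A -> 0 <= V ->
  0 <= q -> 0 <= v -> 0 <= c ->
  Num.sqrt ((c * (A + Num.sqrt V) + q) ^+ 2 + v) <=
  c * A + q + Num.sqrt (c ^+ 2 * V + v).
Proof.
move=> A0 V0 q0 v0 c0; set s := Num.sqrt V; have s0 : 0 <= s by exact: sqrtr_ge0.
set w := Num.sqrt (c ^+ 2 * V + v); have w0 : 0 <= w by exact: sqrtr_ge0.
have cA0 : 0 <= c * A by exact: mulr_ge0.
have cs0 : 0 <= c * s by exact: mulr_ge0.
have V2 : s ^+ 2 = V by rewrite sqr_sqrtr.
have W2 : w ^+ 2 = c ^+ 2 * V + v.
  by rewrite sqr_sqrtr// addr_ge0// mulr_ge0// sqr_ge0.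
have sw : c * s <= w.
  by rewrite -(@ler_pXn2r _ 2)// ?nnegrE// exprMn V2 W2 lerDl.
rewrite -(@ler_pXn2r _ 2)// ?nnegrE ?sqrtr_ge0 ?addr_ge0//.
rewrite sqr_sqrtr ?addr_ge0 ?sqr_ge0//.
rewrite (_ : _ + v = (c * A + q) ^+ 2 + 2 * (c * A + q) * (c * s) +
  (c ^+ 2 * s ^+ 2 + v)); last by ring.
have X0 : 0 <= c * A + q by rewrite addr_ge0.
have := mulr_ge0 X0 (etrans (subr_ge0 _ _) sw).
rewrite V2 -W2; nra.
Qed.

(** * Contraction from a distant time down to [T] *)

Section initial_coupling.
Context (R : realType) (d : nat) (mu : probability 'rV[R]_d R) (r : R).
Hypothesis mur : {ae mu, forall z, enorm z <= r}.
Hypothesis mu0 : forall i, \int[mu]_z (z ord0 i) = 0.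
Hypothesis r0 : 0 < r.
Notation E := 'rV[R]_d.
Notation gauss := (@gauss R d).
Hypothesis gauss_conv : forall (s t : R) (G : E -> \bar R), 0 < s -> 0 < t ->
  measurable_fun setT G -> (forall x, 0 <= G x)%E ->
  (\int[gauss s]_v \int[gauss t]_w G (v + w)%R = \int[gauss (s + t)]_v G v)%E.
Implicit Types (t : R) (y z : E).

Definition msq (gamma : probability (E * E)%type R) : \bar R :=
  (\int[gamma]_p (enorm (p.1 - p.2) ^+ 2)%:E)%E.

Definition coupled_with_gaussian t (gamma : probability (E * E)%type R) : Prop :=
  (forall G, measurable_fun setT G -> (forall x, 0 <= G x)%E ->
    (\int[gamma]_p G p.1 = smoothed_law mu t G)%E) /\
  (forall G, measurable_fun setT G -> (forall x, 0 <= G x)%E ->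
    (\int[gamma]_p G p.2 = \int[gauss t]_x G x)%E).

(** Both components use the same Gaussian, so they differ by [X]. *)
Lemma trivial_gaussian_coupling t : 0 < t ->
  exists2 gamma, coupled_with_gaussian t gamma & (msq gamma <= (r ^+ 2)%:E)%E.
Proof.
move=> t0; pose phi (x : E * E) : E * E := (x.2 + x.1, x.2).
have mphi : measurable_fun setT phi.
  apply: measurable_fun_pair; last exact: measurable_snd.
  exact: measurable_fun_rowvecD.
have [|gamma gammaE] := @weighted_image_probability _ _ _ _ R
    (mu \x gauss t)%E phi (fun=> 1) mphi (measurable_cst _) (fun=> ler01).
  have mc1 : measurable_fun [set: E * E] (fun=> 1%E : \bar R).
    exact: measurable_cst.
  rewrite (ge0_integral_prod mu (gauss t) mc1 (fun=> lee01)).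
  under eq_integral do rewrite integral_gaussian_cst.
  exact: integral_prob_cst.
have {}gammaE G : measurable_fun setT G -> (forall x, 0 <= G x)%E ->
    (\int[gamma]_p G p = \int[mu]_z \int[gauss t]_v G (phi (z, v)))%E.
  move=> mG G0; rewrite gammaE//; under eq_integral do rewrite mule1.
  have mGp := measurableT_comp mG mphi.
  by rewrite (ge0_integral_prod mu (gauss t) mGp (fun=> G0 _)).
exists gamma; first split.
- move=> G mG G0; have mG1 := measurableT_comp mG (@measurable_fst _ _ E E).
  by rewrite (gammaE _ mG1 (fun=> G0 _)) smoothed_lawE.
- move=> G mG G0; have mG2 := measurableT_comp mG (@measurable_snd _ _ E E).
  by rewrite (gammaE _ mG2 (fun=> G0 _)) /= integral_prob_cst.
- have mD : measurable_fun setT (fun p : E * E => (enorm (p.1 - p.2) ^+ 2)%:E).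
    apply: measurable_fun_EFin; apply: measurable_funX.
    by apply: measurable_fun_enorm; exact: measurable_fun_rowvecB.
  have D0 (p : E * E) : (0 <= (enorm (p.1 - p.2) ^+ 2)%:E)%E.
    by rewrite lee_fin sqr_ge0.
  rewrite /msq (gammaE _ mD D0).
  rewrite (eq_integral (fun z : E => (enorm z ^+ 2)%:E)); last first.
    move=> z _; rewrite -[RHS](@integral_gaussian_cst R d t).
    by apply: eq_integral => v _; rewrite /= addrAC subrr add0r.
  rewrite -[leRHS](@integral_prob_cst _ _ R mu).
  apply: ae_ge0_le_integral => //.
  + by move=> z _; rewrite lee_fin sqr_ge0.
  + apply: measurable_fun_EFin; apply: measurable_funX.
    exact: measurable_fun_enorm.
  + by move=> z _; rewrite lee_fin sqr_ge0.
  + apply: filterS mur => z zr _; rewrite lee_fin ler_sqr ?nnegrE ?enorm_ge0//.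
    exact: ltW.
Qed.

(** With [x = r^2 / t <= 1/8], [(exp x - 1) / (1 - x/2) <= x / ((1 - x) (1 - x/2)) <= 81/64 x]. The
    constant [9/8] and the threshold [8 r^2] are tied together here. *)
Lemma post_mean_norm_le t : 8 * r ^+ 2 <= t ->
  (smoothed_law mu t (fun y => (enorm (post_mean mu t y) ^+ 2)%:E) <=
   ((9 / 8 * r ^+ 2 / Num.sqrt t) ^+ 2)%:E)%E.
Proof.
move=> rt; have r20 : 0 < r ^+ 2 by rewrite exprn_gt0.
have t0 : 0 < t by lra.
apply: le_trans (smoothed_post_mean_le mur mu0 _) _; first by lra.
rewrite lee_fin exprMn exprVn sqr_sqrtr ?(ltW t0)//.
pose x := r ^+ 2 / t.
have x0 : 0 < x by rewrite divr_gt0.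
have x8 : x <= 1 / 8 by rewrite ler_pdivrMr//; lra.
have -> : r ^+ 2 / (2 * t) = x / 2 by rewrite /x; field; rewrite gt_eqF.
rewrite -/x.
have ex : expR x - 1 <= x / (1 - x).
  rewrite lerBlDr; apply: le_trans (expR_le_inv1B _) _; first by lra.
  by rewrite le_eqVlt; apply/orP; left; apply/eqP; field; lra.
have -> : (9 / 8 * r ^+ 2) ^+ 2 / t = r ^+ 2 * (81 / 64 * x).
  by rewrite /x; field; rewrite gt_eqF.
rewrite -mulrA ler_wpM2l ?(ltW r20)// ler_pdivrMr; last by lra.
apply: (le_trans ex); rewrite ler_pdivrMr; last by lra.
have : 0 <= 81 / 64 * (1 - x / 2) * (1 - x) - 1 by nra.
by move=> /(mulr_ge0 (ltW x0)); lra.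
Qed.

(** The bridge with the posterior draw replaced by 0 is the exact backward step of a Gaussian:
    [F x = c x] with the same intensity. It carries [N(0, tI)] to [N(0, c t I)], has no mismatch of
    noises, and in the mean the difference becomes [c (p.1 - p.2) + (1 - c) m]. *)
Lemma gaussian_step t c (gamma : probability (E * E)%type R) (e q : R) :
  0 < t -> 0 < c -> c < 1 -> 0 <= e -> 0 <= q ->
  coupled_with_gaussian t gamma -> (msq gamma <= (e ^+ 2)%:E)%E ->
  (smoothed_law mu t (fun y => (enorm (post_mean mu t y) ^+ 2)%:E) <=
    (q ^+ 2)%:E)%E ->
  exists2 gamma', coupled_with_gaussian (c * t) gamma' &
    (msq gamma' <= ((c * e + (1 - c) * q) ^+ 2 +
      (1 - c) ^+ 2 * (d%:R * r ^+ 2))%:E)%E.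
Proof.
move=> t0 c0 c1 e0 q0 [g1 g2] ge mq.
have h0 : 0 < (1 - c) * t by rewrite mulr_gt0// subr_gt0.
have ht : (1 - c) * t < t by rewrite gtr_pMl// gtrBl.
have mF : measurable_fun setT (fun x : E => c *: x) by exact: measurable_fun_rowvecZ.
have [gamma' [g1' g2' g3']] := one_step mur gauss_conv
  (Num.sqrt ((1 - c) * t * (t - (1 - c) * t) / t)) h0 ht mF g1.
have tE : t - (1 - c) * t = c * t by ring.
have cE : (1 - c) * t / t = 1 - c by rewrite mulfK ?gt_eqF.
have cE2 : 1 - (1 - c) = c by ring.
exists gamma'; first split.
- by move=> G mG G0; rewrite g1'// tE.
- move=> G mG G0; rewrite g2'//.
  have mH : measurable_fun setT (fun x : E => \int[gauss 1]_g G (c *: x +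
      Num.sqrt ((1 - c) * t * (t - (1 - c) * t) / t) *: g)%R)%E.
    apply: (@measurable_ge0_integral_snd _ _ _ _ _ (gauss 1) (fun x : E * E =>
      G (c *: x.1 + Num.sqrt ((1 - c) * t * (t - (1 - c) * t) / t) *: x.2)%R)) => //.
    apply: (measurableT_comp mG); apply: measurable_fun_rowvecD.
      exact: measurable_fun_rowvecZ.
    exact: measurable_fun_rowvecZ.
  rewrite (g2 _ mH); last by move=> x; exact: integral_ge0.
  by have := gaussian_bridge gauss_conv h0 ht mG G0; rewrite cE cE2 tE.
- apply: le_trans g3' _; rewrite subrr expr0n mul0r addr0 cE EFinD leeD2r//.
  have mm : measurable_fun setT (fun p : E * E => post_mean mu t p.1).
    exact: (measurableT_comp (measurable_post_mean mur t0)).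
  have m1 : measurable_fun setT (fun p : E * E => c *: (p.1 - p.2)).
    by apply: measurable_fun_rowvecZ => //; exact: measurable_fun_rowvecB.
  have m2 : measurable_fun setT (fun p : E * E => (1 - c) *: post_mean mu t p.1).
    exact: measurable_fun_rowvecZ.
  have H (a : R) (w : E * E -> E) b : measurable_fun setT w ->
      (\int[gamma]_p (enorm (w p) ^+ 2)%:E <= (b ^+ 2)%:E)%E ->
      (\int[gamma]_p (enorm (a *: w p) ^+ 2)%:E <= ((a * b) ^+ 2)%:E)%E.
    move=> mw wb; under eq_integral do
      rewrite enormZ exprMn real_normK ?num_real// (EFinM (a ^+ 2)).
    rewrite exprMn (EFinM (a ^+ 2)) ge0_integralZl//.
    - by apply: lee_wpmul2l => //; rewrite lee_fin sqr_ge0.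
    - apply: measurable_fun_EFin; apply: measurable_funX.
      exact: measurable_fun_enorm.
    - by move=> p _; rewrite lee_fin sqr_ge0.
    - by rewrite lee_fin sqr_ge0.
  have gq : (\int[gamma]_p (enorm (post_mean mu t p.1) ^+ 2)%:E <= (q ^+ 2)%:E)%E.
    rewrite (g1 (fun y => (enorm (post_mean mu t y) ^+ 2)%:E))//.
      apply: measurable_fun_EFin; apply: measurable_funX.
      exact: (measurable_fun_enorm (measurable_post_mean mur t0)).
    by move=> y; rewrite lee_fin sqr_ge0.
  have mB : measurable_fun setT (fun p : E * E => p.1 - p.2).
    exact: measurable_fun_rowvecB.
  have ce0 : 0 <= c * e by rewrite mulr_ge0 ?(ltW c0).
  have cq0 : 0 <= (1 - c) * q by rewrite mulr_ge0 ?subr_ge0 ?(ltW c1).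
  have := minkowski_sqr m1 m2 ce0 cq0 (H c _ _ mB ge) (H (1 - c) _ _ mm gq).
  apply: le_trans; rewrite le_eqVlt; apply/orP; left; apply/eqP.
  apply: eq_integral => p _; congr (enorm _ ^+ 2)%:E.
  by apply/rowP => i; move: (post_mean _ _ _) => m; rewrite !mxE; ring.
Qed.

Lemma initial_coupling T : 8 * r ^+ 2 <= T ->
  exists2 gamma, coupled_with_gaussian T gamma &
    (msq gamma <= ((r ^+ 2 / Num.sqrt T) ^+ 2)%:E)%E.
Proof.
move=> rT; have r20 : 0 < r ^+ 2 by rewrite exprn_gt0.
have T0 : 0 < T by lra.
have sT0 : 0 < Num.sqrt T by rewrite sqrtr_gt0.
(* Small enough for the noise part [sqrt V] to be at most [r^2 / (8 sqrt T)]; [d.+1] covers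
   [d = 0]. *)
pose th := r ^+ 2 / (64 * d.+1%:R * T).
have d0 : 0 < d.+1%:R :> R by rewrite ltr0n.
have d1 : 1 <= d.+1%:R :> R by rewrite ler1n.
have th0 : 0 < th by rewrite divr_gt0// !mulr_gt0.
have th1 : th <= 1 / 512.
  rewrite ler_pdivrMr ?mulr_gt0//; nra.
pose c := 1 - th; have c0 : 0 < c by rewrite /c; lra.
have c1 : c < 1 by rewrite /c; lra.
pose u := Num.sqrt c; have u0 : 0 < u by rewrite sqrtr_gt0.
have u2 : u ^+ 2 = c by rewrite sqr_sqrtr ?ltW.
have u1 : u <= 1 by rewrite -sqrtr1 ler_sqrt ?ltr01// ltW.
have W0 : 0 <= d%:R * r ^+ 2 by rewrite mulr_ge0 ?(ltW r20).
(* A level that the noise recursion does not exceed: [c^2 V + (1 - c)^2 d r^2 <= V] for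
   [c = 1 - th]. *)
pose V := th * (d%:R * r ^+ 2).
have V0 : 0 <= V by rewrite mulr_ge0 ?(ltW th0).
(* The trivial coupling costs [r]; [K] contractions by [c] bring this down to an eighth of the
   target. *)
have [K cK] : exists K : nat, c ^+ K * r <= r ^+ 2 / (8 * Num.sqrt T).
  have r8 : 0 < r / (8 * Num.sqrt T) by rewrite divr_gt0// mulr_gt0.
  pose x := (r / (8 * Num.sqrt T))^-1 / th.
  have x0 : 0 <= x by rewrite divr_ge0 ?(ltW th0)// invr_ge0 ltW.
  exists (Num.bound x); rewrite expr2 -mulrA mulrC ler_wpM2l ?(ltW r0)//.
  have cx : c <= expR (- th) by rewrite /c expR_ge1Dx.
  apply: (@le_trans _ _ (expR (- th) ^+ Num.bound x)).
    by rewrite ler_pXn2r ?nnegrE ?expR_ge0 ?(ltW c0).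
  rewrite -expRM_natl mulrN expRN -[leRHS]invrK lef_pV2 ?posrE ?expR_gt0 ?invr_gt0//.
  apply: le_trans (expR_ge1Dx _); rewrite -[leLHS](divfK (lt0r_neq0 th0)) -/x.
  have := archi_boundP x0; move: (_%:R) => y xy.
  have : x * th <= y * th by rewrite ler_wpM2r ?ltW.
  lra.
(* Geometric times descending from [T / c^K] to [T]. Only [j <= K] is used, where the subtraction is
   not truncated. *)
pose tau j := T / c ^+ (K - j).
have ci k : c ^+ k <= 1 by rewrite exprn_ile1 ?(ltW c0) ?(ltW c1).
have tauT j : T <= tau j.
  by rewrite ler_pdivlMr ?exprn_gt0// ler_piMr ?(ltW T0).
have tau_gt0 j : 0 < tau j by apply: lt_le_trans (tauT j).
have B0 j : 0 <= 3 / 4 * r ^+ 2 / Num.sqrt (tau j).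
  by rewrite divr_ge0 ?sqrtr_ge0// mulr_ge0 ?(ltW r20).
have C0 j : 0 <= c ^+ j * r by rewrite mulr_ge0 ?exprn_ge0 ?(ltW c0) ?(ltW r0).
have H j : (j <= K)%N -> exists2 gamma, coupled_with_gaussian (tau j) gamma &
    (msq gamma <= ((c ^+ j * r + 3 / 4 * r ^+ 2 / Num.sqrt (tau j) +
       Num.sqrt V) ^+ 2)%:E)%E.
  elim: j => [_|j IH jK].
    have [gamma g1 g2] := trivial_gaussian_coupling (tau_gt0 0).
    exists gamma => //; apply: (le_trans g2); rewrite lee_fin ler_sqr ?nnegrE.
    - by rewrite expr0 mul1r -addrA lerDl addr_ge0 ?sqrtr_ge0.
    - exact: ltW.
    - by rewrite !addr_ge0 ?sqrtr_ge0.
  have [gamma g1 g2] := IH (ltnW jK).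
  set A := c ^+ j * r + 3 / 4 * r ^+ 2 / Num.sqrt (tau j) in g2.
  have A0 : 0 <= A by rewrite addr_ge0.
  have AV0 : 0 <= A + Num.sqrt V by rewrite addr_ge0// sqrtr_ge0.
  pose q := 9 / 8 * r ^+ 2 / Num.sqrt (tau j).
  have q0 : 0 <= q.
    by rewrite divr_ge0 ?sqrtr_ge0// mulr_ge0 ?(ltW r20)//; lra.
  have [|gamma' g1' g2'] := gaussian_step (tau_gt0 j) c0 c1 AV0 q0 g1 g2.
    by apply: post_mean_norm_le; exact: le_trans (tauT j).
  have tauS : c * tau j = tau j.+1.
    rewrite /tau subnS -{1}[(K - j)%N]prednK ?subn_gt0// exprS.
    by field; rewrite expf_neq0 ?gt_eqF.
  exists gamma'; first by rewrite -tauS.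
  apply: (le_trans g2'); rewrite lee_fin.
  have v0 : 0 <= (1 - c) ^+ 2 * (d%:R * r ^+ 2) by rewrite mulr_ge0 ?sqr_ge0.
  have q0' : 0 <= (1 - c) * q by rewrite mulr_ge0// subr_ge0 ltW.
  have chain := sqrt_chain_le A0 V0 q0' v0 (ltW c0).
  have sqrtS : Num.sqrt (tau j.+1) = u * Num.sqrt (tau j).
    by rewrite -tauS sqrtrM ?ltW.
  have Vle : Num.sqrt (c ^+ 2 * V + (1 - c) ^+ 2 * (d%:R * r ^+ 2)) <= Num.sqrt V.
    apply: ler_wsqrtr; have := mulr_ge0 V0 (mulr_ge0 (ltW th0) (ltW c0)).
    by rewrite /V /c; lra.
  have Ale : c * A + (1 - c) * q <= c ^+ j.+1 * r +
      3 / 4 * r ^+ 2 / Num.sqrt (tau j.+1).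
    have s0 : 0 < Num.sqrt (tau j) by rewrite sqrtr_gt0.
    pose p := r ^+ 2 / Num.sqrt (tau j).
    have p0 : 0 <= p by rewrite divr_ge0 ?(ltW r20) ?(ltW s0).
    have -> : 3 / 4 * r ^+ 2 / Num.sqrt (tau j.+1) = u^-1 * (3 / 4) * p.
      by rewrite sqrtS /p; field; rewrite !gt_eqF.
    rewrite /A /q exprS -!(mulrA _ (r ^+ 2)) -/p.
    (* Multiplied by [8 u / 3], this is [u^3 - 3 u + 2 >= 0], that is [(1 - u)^2 (u + 2) >= 0]. The
       double root at 1 reflects that [3/4] is the equilibrium level as [c] tends to 1. *)
    have key : u ^+ 2 * (3 / 4) + (1 - u ^+ 2) * (9 / 8) <= u^-1 * (3 / 4).
      rewrite ler_pdivlMl//.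
      have : 0 <= (1 - u) ^+ 2 * (u + 2).
        by rewrite mulr_ge0 ?sqr_ge0// addr_ge0 ?(ltW u0).
      lra.
    have := ler_wpM2r p0 key; rewrite u2 [c ^+ j.+1]exprS.
    move=> key'; rewrite [leLHS](_ : _ = c * c ^+ j * r +
      (c * (3 / 4) + (1 - c) * (9 / 8)) * p); last by ring.
    by rewrite lerD2l.
  rewrite -[leLHS]sqr_sqrtr; last by rewrite addr_ge0// sqr_ge0.
  rewrite ler_sqr ?nnegrE ?sqrtr_ge0//.
    by apply: (le_trans chain); rewrite lerD.
  by rewrite !addr_ge0 ?sqrtr_ge0.
have [gamma g1 g2] := H K (leqnn K).
have tauK : tau K = T by rewrite /tau subnn expr0 divr1.
have BK := B0 K; rewrite tauK in g1 g2 BK; exists gamma => //.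
apply: (le_trans g2); rewrite lee_fin ler_sqr ?nnegrE; last 2 first.
- by rewrite !addr_ge0 ?sqrtr_ge0.
- by rewrite divr_ge0 ?(ltW r20) ?(ltW sT0).
have thd : Num.sqrt V <= r ^+ 2 / (8 * Num.sqrt T).
  have R0 : 0 <= r ^+ 2 / (8 * Num.sqrt T).
    by rewrite divr_ge0 ?(ltW r20)// mulr_ge0 ?(ltW sT0).
  rewrite -[leRHS]ger0_norm// -sqrtr_sqr ler_wsqrtr// exprMn exprVn exprMn.
  rewrite [(8 * _) ^+ 2]exprMn sqr_sqrtr ?(ltW T0)// -expr2 /V /th.
  have -> : r ^+ 2 / (64 * d.+1%:R * T) * (d%:R * r ^+ 2) =
     (r ^+ 2) ^+ 2 / (8 ^+ 2 * T) * (d%:R / d.+1%:R).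
    by field; rewrite !gt_eqF// -natr1 in d0 *; rewrite ?gt_eqF.
  rewrite ler_piMr//.
    by rewrite divr_ge0 ?sqr_ge0// mulr_ge0 ?(ltW T0)// sqr_ge0.
  by rewrite ler_pdivrMr// mul1r ler_nat.
(* The three parts add up to the target, since [1/8 + 3/4 + 1/8 = 1]. *)
apply: (le_trans (lerD (lerD cK (lexx _)) thd)).
rewrite le_eqVlt; apply/orP; left; apply/eqP.
by field; rewrite gt_eqF.
Qed.

End initial_coupling.

(** * Laws of the forward process and of the sampler *)

Section independence.
Context d (Omega : measurableType d) (R : realType) (P : probability Omega R).

Lemma measurable_preimage d' (E : measurableType d') (Y : Omega -> E) A :
  measurable_fun setT Y -> measurable A -> measurable (Y @^-1` A).
Proof. by move=> mY mA; rewrite -[X in measurable X]setTI; exact: mY. Qed.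

Lemma has_law_ae_eq d' (E : measurableType d') (Y Y' : Omega -> E) nu :
  measurable_fun setT Y -> measurable_fun setT Y' ->
  {ae P, forall w, Y w = Y' w} -> has_law P Y nu -> has_law P Y' nu.
Proof.
move=> mY mY' YY' YE A mA; rewrite -YE//.
have := @ae_eq_integral _ _ _ P setT (EFin \o \1_(Y @^-1` A)) (EFin \o \1_(Y' @^-1` A)).
have m1 : measurable (Y @^-1` A) by exact: measurable_preimage.
have m2 : measurable (Y' @^-1` A) by exact: measurable_preimage.
rewrite !integral_indic// !setIT; apply => //.
- by apply/measurable_EFinP; exact: measurable_indic.
- by apply/measurable_EFinP; exact: measurable_indic.
- apply: filterS YY' => w YY' _; rewrite /= !indicE; congr ((nat_of_bool _)%:R)%:E.
  by apply/idP/idP; rewrite !inE /preimage/= YY'.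
Qed.

(** The restriction of [P] to [E], divided by [c], has an image that agrees with the product law on
    rectangles, hence everywhere; [c = 0] is settled by monotonicity. This extends independence from
    [E] to every function of the pair. *)
Lemma pair_law_scale d1 d2 (E1 : measurableType d1) (E2 : measurableType d2)
    (Y1 : Omega -> E1) (Y2 : Omega -> E2) (E : set Omega) (c : R) :
  measurable_fun setT Y1 -> measurable_fun setT Y2 -> measurable E ->
  (forall A B, measurable A -> measurable B ->
    P (Y1 @^-1` A `&` Y2 @^-1` B) = P (Y1 @^-1` A) * P (Y2 @^-1` B))%E ->
  (forall A B, measurable A -> measurable B ->
    P (Y1 @^-1` A `&` Y2 @^-1` B `&` E) =
    c%:E * (P (Y1 @^-1` A) * P (Y2 @^-1` B)))%E ->
  forall S, measurable S ->
    P ((fun w => (Y1 w, Y2 w)) @^-1` S `&` E) =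
    (c%:E * P ((fun w => (Y1 w, Y2 w)) @^-1` S))%E.
Proof.
move=> mY1 mY2 mE ind indE S mS.
have mp : measurable_fun setT (fun w => (Y1 w, Y2 w)).
  exact: measurable_fun_pair.
have PE : P E = c%:E.
  have := indE setT setT measurableT measurableT.
  by rewrite !preimage_setT !setTI !probability_setT !mule1.
have c0 : 0 <= c by rewrite -lee_fin -PE measure_ge0.
have [cz|cN0] := eqVneq c 0.
  rewrite cz mul0e; apply/eqP; rewrite eq_le measure_ge0 andbT.
  apply: (@le_trans _ _ (P E)); last by rewrite PE cz.
  apply: le_measure; rewrite ?inE//.
  by apply: measurableI => //; exact: measurable_preimage.
have cp : 0 < c by rewrite lt_neqAle eq_sym cN0.
pose X1 : {RV P >-> E1} := mfun_Sub (mem_set mY1).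
pose X2 : {RV P >-> E2} := mfun_Sub (mem_set mY2).
pose X12 : {mfun Omega >-> (E1 * E2)%type} := mfun_Sub (mem_set mp).
have ci0 : 0 <= c^-1 by rewrite invr_ge0.
have ME : (c^-1%:E * P (X12 @^-1` S `&` E) =
    (distribution P X1 \x distribution P X2)%E S)%E.
  apply/esym; apply: (@product_measure_unique _ _ _ _ _ (distribution P X1)
    (distribution P X2)
    (mscale (NngNum ci0) (pushforward (mrestr P mE) X12))) => // A B mA mB.
  transitivity (c^-1%:E * P (Y1 @^-1` A `&` Y2 @^-1` B `&` E))%E => //.
  by rewrite indE// muleA -EFinM mulVf// mul1e.
have XE : P ((fun w => (Y1 w, Y2 w)) @^-1` S) =
    (distribution P X1 \x distribution P X2)%E S.
  apply/esym.
  apply: (@product_measure_unique _ _ _ _ _ (distribution P X1)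
    (distribution P X2) (pushforward P X12) _ S mS); exact: ind.
by rewrite XE -ME muleA -EFinM divff// mul1e.
Qed.

End independence.

Section brownian_gaussian.
Context d (Omega : measurableType d) (R : realType) (P : probability Omega R).
Context (n : nat) (B : R -> {RV P >-> 'rV[R]_n}).
Hypothesis BM : standard_brownian_motion B.
Notation E := 'rV[R]_n.

Lemma measurable_increment s t : measurable_fun setT (fun w => B t w - B s w).
Proof. exact: measurable_fun_rowvecB. Qed.

Lemma has_law_increment s t : 0 <= s -> s < t ->
  has_law P (fun w => B t w - B s w) (gauss n (t - s)).
Proof. by case: BM => _ H _ _ s0 st A mA; rewrite gaussE H. Qed.

(** [B (s + t) - B 0] is the sum of two independent increments with laws [N(0, sI)] and [N(0, tI)].
    This discharges the hypothesis [gauss_conv] of the other sections. *)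
Lemma gauss_conv_brownian (s t : R) (G : E -> \bar R) : 0 < s -> 0 < t ->
  measurable_fun setT G -> (forall x, 0 <= G x)%E ->
  (\int[gauss n s]_v \int[gauss n t]_w G (v + w)%R =
   \int[gauss n (s + t)]_v G v)%E.
Proof.
move=> s0 t0 mG G0.
(* The times [0], [s], [s + t], then constant, because independence of increments is stated along
   infinite nondecreasing sequences. *)
pose tau (i : nat) : R := if i is j.+1 then (if j is 0%N then s else s + t) else 0.
have ndtau : nondecreasing_seq tau.
  apply/nondecreasing_seqP => -[|[|i]] //=; first exact: ltW.
  by rewrite lerDl ltW.
have l1 : has_law P (fun w => B s w - B 0 w) (gauss n s).
  by rewrite -[X in gauss n X]subr0; exact: has_law_increment.
have l2 : has_law P (fun w => B (s + t) w - B s w) (gauss n t).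
  rewrite [X in gauss n X](_ : t = s + t - s); last by ring.
  by apply: has_law_increment; rewrite ?ltrDl// ltW.
have l3 : has_law P (fun w => B (s + t) w - B 0 w) (gauss n (s + t)).
  by rewrite -[X in gauss n X]subr0; apply: has_law_increment; rewrite ?addr_gt0.
have ind A C : measurable A -> measurable C ->
    (P ((fun w => B s w - B 0 w)%R @^-1` A `&` (fun w => B (s + t) w - B s w)%R @^-1` C)
     = gauss n s A * gauss n t C)%E.
  move=> mA mC; rewrite -l1// -l2//.
  case: BM => _ _ /(_ tau (lexx _) ndtau) H _.
  have := H [:: 0%N; 1%N] (fun i => if i is 0%N then A else C) isT.
  rewrite big_cons big_seq1 => <-//; last by case.
  congr (P _); apply/seteqP; split => w /=.
    by move=> [wA wC] i /=; rewrite !inE => /orP[] /eqP ->.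
  by move=> H'; split; [apply: (H' 0%N)|apply: (H' 1%N)]; rewrite /= !inE.
have lp := has_law_pair (measurable_increment 0 s) (measurable_increment s (s + t)) ind.
have mGD : measurable_fun setT (fun x : E * E => G (x.1 + x.2)).
  by apply: (measurableT_comp mG); exact: measurable_fun_rowvecD.
rewrite -(ge0_integral_prod (gauss n s) (gauss n t) mGD (fun=> G0 _)).
rewrite (ge0_integral_has_law (measurable_fun_pair (measurable_increment 0 s)
  (measurable_increment s (s + t))) lp mGD (fun=> G0 _)).
rewrite (ge0_integral_has_law (measurable_increment 0 (s + t)) l3 mG G0).
by apply: eq_integral => w _; congr G; rewrite /= addrC subrKA.
Qed.

Lemma has_law_brownian t : 0 < t -> has_law P (B t) (gauss n t).
Proof.
move=> t0; have := has_law_increment (lexx 0) t0; rewrite subr0.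
apply: has_law_ae_eq => //; first exact: measurable_increment.
by case: BM => B0 _ _ _; apply: filterS B0 => w ->; rewrite subr0.
Qed.

Lemma smoothed_law_brownian (X : {RV P >-> E}) (mu : probability E R) t G :
  has_law P X mu -> independent_of_family P [set t : R | 0 <= t] X B ->
  0 < t -> measurable_fun setT G -> (forall x, 0 <= G x)%E ->
  (\int[P]_w G (X w + B t w)%R = smoothed_law mu t G)%E.
Proof.
move=> Xmu XB t0 mG G0.
have ind A C : measurable A -> measurable C ->
    (P (X @^-1` A `&` B t @^-1` C) = mu A * gauss n t C)%E.
  move=> mA mC; have := XB [:: t] A (fun=> C) isT.
  rewrite (_ : \bigcap_(i in _) _ = B t @^-1` C); last first.
    apply/seteqP; split => w /=; first by apply; rewrite /= inE.
    by move=> wC i /=; rewrite inE => /eqP ->.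
  move=> ->//; first by rewrite Xmu// (has_law_brownian t0).
  by move=> u /=; rewrite inE => /eqP ->; exact: ltW.
have mX : measurable_fun setT X by [].
have mB : measurable_fun setT (B t) by [].
have lp := has_law_pair mX mB ind.
have mGD : measurable_fun setT (fun x : E * E => G (x.2 + x.1)).
  by apply: (measurableT_comp mG); exact: measurable_fun_rowvecD.
rewrite smoothed_lawE//.
rewrite -(ge0_integral_prod mu (gauss n t) mGD (fun=> G0 _)).
rewrite (ge0_integral_has_law (measurable_fun_pair mX mB) lp mGD (fun=> G0 _)).
by apply: eq_integral => w _; rewrite addrC.
Qed.

End brownian_gaussian.

(** * Markov property of the sampler *)

Section sampler_law.
Context d (Omega : measurableType d) (R : realType) (Q : probability Omega R).
Context (n : nat) (s : R -> 'rV[R]_n -> 'rV[R]_n) (T h : R) (N : nat).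
Context (Xh Z : nat -> {RV Q >-> 'rV[R]_n}).
Hypothesis EM : euler_maruyama_sampler s T h N Xh Z.
Hypothesis ms : forall k, (k < N)%N -> measurable_fun setT (s (T - k%:R * h)).
Hypothesis h0 : 0 < h.
Notation E := 'rV[R]_n.

Definition euler_drift k (x : E) : E := x + h *: s (T - k%:R * h) x.

Lemma measurable_euler_drift k : (k < N)%N -> measurable_fun setT (euler_drift k).
Proof.
move=> kN; apply: measurable_fun_rowvecD => //.
by apply: measurable_fun_rowvecZ => //; exact: ms.
Qed.

Lemma sampler_stepE k w : (k < N)%N ->
  Xh k.+1 w = euler_drift k (Xh k w) + Z k.+1 w.
Proof. by case: EM => _ _ _ _ H kN; rewrite H. Qed.

Let mZ k : measurable_fun setT (Z k). Proof. by []. Qed.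
Let mX k : measurable_fun setT (Xh k). Proof. by []. Qed.

Lemma measurable_noise_event (l : seq nat) (C : nat -> set E) :
  (forall i, measurable (C i)) ->
  measurable (\bigcap_(i in [set` l]) (Z i @^-1` C i)).
Proof.
move=> mC; rewrite bigcap_seq; apply: bigsetI_measurable => i _.
exact: measurable_preimage.
Qed.

(** The induction has to carry all later noises at once: [Xh k.+1] is a function of [Xh k] and
    [Z k.+1], and must in turn be independent of the noises that remain. *)
Lemma sampler_independent k (l : seq nat) (A : set E) (C : nat -> set E) :
  (k <= N)%N -> uniq l -> (forall i, i \in l -> (k < i <= N)%N) ->
  measurable A -> (forall i, measurable (C i)) ->
  Q (Xh k @^-1` A `&` \bigcap_(i in [set` l]) (Z i @^-1` C i)) =
  (Q (Xh k @^-1` A) * \prod_(i <- l) Q (Z i @^-1` C i))%E.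
Proof.
elim: k l A C => [|k IH] l A C kN ul lk mA mC.
  by case: EM => _ _ mi ind _; rewrite ind ?mi// => i /= /lk.
have mE := measurable_noise_event l mC.
have kNW := ltnW kN.
have ind1 A' B' : measurable A' -> measurable B' ->
    (Q (Xh k @^-1` A' `&` Z k.+1 @^-1` B') = Q (Xh k @^-1` A') * Q (Z k.+1 @^-1` B'))%E.
  move=> mA' mB'; have := IH [:: k.+1] A' (fun=> B') kNW isT.
  rewrite big_seq1 => <-//; last by move=> i; rewrite inE => /eqP ->; rewrite ltnSn.
  congr (Q (_ `&` _)); apply/seteqP; split => w /=; last by apply; rewrite /= inE.
  by move=> wC i /=; rewrite inE => /eqP ->.
pose c := fine (\prod_(i <- l) Q (Z i @^-1` C i))%E.
have cE : (\prod_(i <- l) Q (Z i @^-1` C i) = c%:E)%E.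
  rewrite fineK//; elim: (l) => [|i l' IHl]; first by rewrite big_nil.
  by rewrite big_cons fin_numM//; exact: fin_num_measure (measurable_preimage _ (mC i)).
have ind2 A' B' : measurable A' -> measurable B' ->
    (Q (Xh k @^-1` A' `&` Z k.+1 @^-1` B' `&` \bigcap_(i in [set` l]) (Z i @^-1` C i))
     = c%:E * (Q (Xh k @^-1` A') * Q (Z k.+1 @^-1` B')))%E.
  move=> mA' mB'.
  have kl : k.+1 \notin l by apply/negP => /lk; rewrite ltnn.
  (* The event on [Z k.+1] joins those on the later noises, so that the induction hypothesis covers
     them together. *)
  pose C' i := if i == k.+1 then B' else C i.
  have := IH (k.+1 :: l) A' C' kNW.
  rewrite /= kl ul big_cons /C' eqxx => /(_ isT) H.
  rewrite muleC -cE -muleA.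
  have -> : (\prod_(i <- l) Q (Z i @^-1` C i) =
      \prod_(i <- l) Q (Z i @^-1` (if i == k.+1 then B' else C i)))%E.
    apply: eq_big_seq => i il; case: eqP => // ik; move: il.
    by rewrite ik (negbTE kl).
  rewrite -H//; last 2 first.
  - by move=> i; rewrite inE => /orP[/eqP ->|/lk /andP[ki ->]]; rewrite ?ltnSn// (ltnW ki).
  - by move=> i; case: ifP.
  congr (Q _); rewrite -setIA; congr (_ `&` _); apply/seteqP; split => w /=.
    move=> [wB wC] i /=; rewrite inE; case: eqP => [-> _//|_ /=]; exact: wC.
  move=> H'; split; first by have := H' k.+1; rewrite /= inE !eqxx; apply.
  move=> i /= il; have := H' i; rewrite /= inE il orbT => /(_ isT).
  by case: eqP => // ik; move: il; rewrite ik (negbTE kl).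
have mS : measurable ((fun x : E * E => euler_drift k x.1 + x.2) @^-1` A).
  apply: measurable_preimage => //; apply: measurable_fun_rowvecD => //.
  exact: (measurableT_comp (measurable_euler_drift kN)).
have XE : Xh k.+1 @^-1` A = (fun w => (Xh k w, Z k.+1 w)) @^-1`
    ((fun x : E * E => euler_drift k x.1 + x.2) @^-1` A).
  by apply/seteqP; split => w /=; rewrite sampler_stepE.
rewrite XE cE muleC.
exact: (pair_law_scale (mX k) (mZ k.+1) mE ind1 ind2).
Qed.

Lemma sampler_step_law k (G : E -> \bar R) : (k < N)%N ->
  measurable_fun setT G -> (forall x, 0 <= G x)%E ->
  (\int[Q]_w G (Xh k.+1 w) = \int[Q]_w \int[gauss n 1]_g
     G (euler_drift k (Xh k w) + Num.sqrt h *: g)%R)%E.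
Proof.
move=> kN mG G0.
have ind A B : measurable A -> measurable B ->
    (Q (Xh k @^-1` A `&` Z k.+1 @^-1` B) = distribution Q (Xh k) A * gauss n h B)%E.
  move=> mA mB; have := @sampler_independent k [:: k.+1] A (fun=> B) (ltnW kN) isT.
  rewrite big_seq1 (_ : \bigcap_(i in _) _ = Z k.+1 @^-1` B); last first.
    apply/seteqP; split => w /=; first by apply; rewrite /= inE.
    by move=> wC i /=; rewrite inE => /eqP ->.
  move=> ->//; last by move=> i; rewrite inE => /eqP ->; rewrite ltnSn.
  by case: EM => _ Zh _ _ _; rewrite gaussE -(Zh k.+1).
have lp := has_law_pair (mX k) (mZ k.+1) ind.
have mGD : measurable_fun setT (fun x : E * E => G (euler_drift k x.1 + x.2)).
  apply: (measurableT_comp mG); apply: measurable_fun_rowvecD => //.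
  exact: (measurableT_comp (measurable_euler_drift kN)).
transitivity (\int[Q]_w G (euler_drift k (Xh k w) + Z k.+1 w)%R)%E.
  by apply: eq_integral => w _; rewrite sampler_stepE.
have := ge0_integral_has_law (measurable_fun_pair (mX k) (mZ k.+1)) lp mGD (fun=> G0 _).
move=> /= <-; rewrite (ge0_integral_prod _ _ mGD (fun=> G0 _)).
have mH := measurable_ge0_integral_snd (gauss n h) mGD (fun=> G0 _).
rewrite ge0_integral_distribution//; last by move=> x; exact: integral_ge0.
apply: eq_integral => w _ /=.
have mGw : measurable_fun setT (fun v : E => G (euler_drift k (Xh k w) + v)).
  by apply: (measurableT_comp mG); exact: measurable_fun_rowvecD.
by rewrite -(ge0_integral_gaussian_scale h0 mGw (fun=> G0 _)).
Qed.

End sampler_law.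

(** * The density of the forward process and its score *)

Section uniqueness_of_continuous_densities.
Context (R : realType) (n : nat).
Notation E := 'rV[R]_n.
Notation leb := (lebesgue_rowvec R n).

(** The integral of a nonnegative function is a supremum over the simple functions below it, so it
    is monotone. This applies directly to densities given as continuous functions. *)
Lemma ge0_le_integral_nonmeasurable dT (T : measurableType dT)
    (m : {measure set T -> \bar R}) (D : set T) (f g : T -> \bar R) :
  (forall x, D x -> 0 <= f x)%E -> (forall x, D x -> f x <= g x)%E ->
  (\int[m]_(x in D) f x <= \int[m]_(x in D) g x)%E.
Proof.
move=> f0 fg.
have g0 x : D x -> (0 <= g x)%E by move=> Dx; exact: le_trans (f0 x Dx) (fg x Dx).
rewrite !ge0_integralE//; apply: le_ereal_sup => _ [h hf <-]; exists h => // x.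
apply: (le_trans (hf x)); rewrite /patch; case: ifPn => //.
by rewrite inE => /fg.
Qed.

(** If [p y < q y], a gap of [2 dl] separates the two functions on a small cube around [y], and the
    cube has positive volume. *)
Lemma continuous_le_of_integral_eq (p q : E -> R) : continuous p -> continuous q ->
  (forall x, 0 <= p x) -> (forall x, 0 <= q x) ->
  (forall A, measurable A ->
    \int[leb]_(x in A) (p x)%:E = \int[leb]_(x in A) (q x)%:E)%E ->
  forall y, q y <= p y.
Proof.
move=> cp cq p0 q0 pq y; rewrite leNgt; apply/negP => pqy.
pose m := (p y + q y) / 2; pose dl := (q y - p y) / 4.
have dl0 : 0 < dl by rewrite /dl divr_gt0// subr_gt0.
have /nbhs_ballP[e /= e0 He] : \forall x \near y,
    `|p y - p x| < dl /\ `|q y - q x| < dl.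
  near=> x; split; near: x.
    by move: (cp y) => /cvgrPdist_lt; apply.
  by move: (cq y) => /cvgrPdist_lt; apply.
(* A ball of the sup norm is a product of intervals, so [power_measure_box] gives its volume
   [(2 e)^n]. *)
pose I i : set (measurableTypeR R) := `]y ord0 i - e, y ord0 i + e[%classic.
pose A := [set v : E | forall i, I i (v ord0 i)].
have mA : measurable A.
  rewrite (_ : A = \bigcap_(i in [set: 'I_n])
      ((fun v : E => v ord0 i) @^-1` I i)); last first.
    by apply/seteqP; split => v /= H i => [_|]; exact: H.
  apply: fin_bigcap_measurable => // i _.
  by apply: measurable_preimage; [exact: measurable_rowvec_coord|exact: measurable_itv].
have AE x : A x -> `|p y - p x| < dl /\ `|q y - q x| < dl.
  move=> Ax; apply: He; split=> // i j; rewrite ord1.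
  have := Ax j; rewrite /I/= in_itv/= => H.
  by rewrite /ball/= distrC ltr_distl.
have lA : exists2 c : R, 0 < c & leb A = c%:E.
  exists (\prod_(i < n) (2 * e)).
    by apply: prodr_gt0 => i _; rewrite mulr_gt0.
  rewrite /lebesgue_rowvec (power_measure_box _ (A := I)); last first.
    by move=> i; exact: measurable_itv.
  rewrite -prodEFin; apply: eq_bigr => i _.
  have := lebesgue_measure_itv `]y ord0 i - e, y ord0 i + e[.
  rewrite /= lte_fin ifT; last by lra.
  by move=> H; apply: (etrans H); rewrite -EFinD; congr EFin; ring.
case: lA => c c0 lA.
have IC (a : R) : (\int[leb]_(x in A) a%:E = (a * c)%:E)%E.
  by rewrite EFinM -lA; exact: integral_cst.
have H1 : (\int[leb]_(x in A) (p x)%:E <= ((m - dl) * c)%:E)%E.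
  apply: (@le_trans _ _ (\int[leb]_(x in A) (m - dl)%:E)%E).
    apply: ge0_le_integral_nonmeasurable => x Ax; first by rewrite lee_fin.
    rewrite lee_fin; have [/ltr_normlP[H1 H2] _] := AE _ Ax.
    rewrite /m /dl in H1 H2 *; lra.
  by rewrite IC.
have H2 : (((m + dl) * c)%:E <= \int[leb]_(x in A) (q x)%:E)%E.
  apply: (@le_trans _ _ (\int[leb]_(x in A) (m + dl)%:E)%E).
    by rewrite IC.
  apply: ge0_le_integral_nonmeasurable => x Ax; rewrite lee_fin.
    by rewrite addr_ge0 ?(ltW dl0)// /m divr_ge0 ?addr_ge0.
  have [_ /ltr_normlP[H2 H3]] := AE _ Ax.
  rewrite /m /dl in H2 H3 *; lra.
have := le_trans H2 (le_trans _ H1); rewrite pq// lexx => /(_ isT).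
rewrite lee_fin ler_pM2r// => H; lra.
Unshelve. all: by end_near. Qed.

Lemma continuous_density_unique (p q : E -> R) : continuous p -> continuous q ->
  (forall x, 0 <= p x) -> (forall x, 0 <= q x) ->
  (forall A, measurable A ->
    \int[leb]_(x in A) (p x)%:E = \int[leb]_(x in A) (q x)%:E)%E ->
  p = q.
Proof.
move=> cp cq p0 q0 pq; apply/funext => y; apply/eqP; rewrite eq_le.
by rewrite !(continuous_le_of_integral_eq _ _ _ _ _ y)// => A mA; rewrite pq.
Qed.

End uniqueness_of_continuous_densities.

Lemma is_derive_quadratic (R : realType) (a b c : R) :
  is_derive (0 : R) (1 : R) (fun x => c + (a * x + b * (x * x))) a.
Proof.
have d1 := is_deriveZ a (@is_derive_id R R^o 0 1).
have d2 := is_deriveZ b (is_deriveM (@is_derive_id R R^o 0 1) (@is_derive_id R R^o 0 1)).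
have d3 := is_deriveD (is_derive_cst c (0 : R) 1) (is_deriveD d1 d2).
apply: (is_derive_eq d3).
by rewrite /= !scale0r addr0 scaler0 addr0 add0r [LHS]mulr1.
Qed.

(** * Explicit density and score of the forward process *)

Section smoothed_density.
Context (R : realType) (n : nat) (mu : probability 'rV[R]_n R) (r t : R).
Hypothesis mur : {ae mu, forall z, enorm z <= r}.
Hypothesis t0 : 0 < t.
Notation E := 'rV[R]_n.

Definition smoothed_density (y : E) : R :=
  mixture mu t y * (normal_peak (Num.sqrt t) ^+ n * expR (- (dot y y / (2 * t)))).

Lemma prod_normal_pdf (y : E) : \prod_i normal_pdf 0 (Num.sqrt t) (y ord0 i) =
  normal_peak (Num.sqrt t) ^+ n * expR (- (dot y y / (2 * t))).
Proof.
have st : Num.sqrt t != 0 by rewrite gt_eqF// sqrtr_gt0.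
under eq_bigr do rewrite normal_pdfE//.
rewrite big_split/= prodr_const card_ord; congr (_ * _).
rewrite /normal_fun -expR_sum; congr expR.
rewrite /dot mulr_suml -sumrN; apply: eq_bigr => i _.
by rewrite subr0 sqr_sqrtr ?(ltW t0)// -mulr_natl expr2 mulNr.
Qed.

Lemma continuous_dot (f g : E -> E) : continuous f -> continuous g ->
  continuous (fun x => dot (f x) (g x)).
Proof.
move=> cf cg; apply: continuous_big => //; first exact: add_continuous.
move=> i _ x.
have cc : continuous (fun v : E => v ord0 i) by exact: coord_continuous.
exact: (continuousM (continuous_comp (cf x) (cc _)) (continuous_comp (cg x) (cc _))).
Qed.

Lemma continuous_enorm : continuous (@enorm R n).
Proof.
have ci : continuous (fun v : E => v) by move=> v; exact: cvg_id.
rewrite (_ : @enorm R n = Num.sqrt \o (fun v => dot v v)); last first.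
  by apply/funext => v; rewrite /= -enorm_sqr sqrtr_sqr ger0_norm ?enorm_ge0.
by move=> x; apply: continuous_comp; [exact: continuous_dot|exact: sqrt_continuous].
Qed.

(** A Harnack inequality: by Cauchy-Schwarz the exponent changes by at most
    [enorm (y' - y) * r / t]. Used in both directions it squeezes [mixture] and yields its
    continuity. *)
Lemma mixture_shift_le (y y' : E) :
  mixture mu t y' <= expR (enorm (y' - y) * r / t) * mixture mu t y.
Proof.
have iM v := integrable_cameron_martin mu v t0.
rewrite /mixture -(RintegralZl _ measurableT (iM y)).
apply: ae_le_Rintegral; first exact: iM.
  exact: (integrableZl measurableT _ (iM y)).
apply: filterS mur => z zr.
rewrite /cameron_martin -expRD ler_expR -mulrDl ler_pM2r ?invr_gt0//.
have -> : dot y' z = dot (y' - y) z + dot y z by rewrite -dotDl subrK.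
rewrite -addrA lerD2r; apply: (le_trans (cauchy_schwarz _ _)).
by rewrite ler_wpM2l ?enorm_ge0.
Qed.

Lemma continuous_mixture : continuous (mixture mu t).
Proof.
move=> y.
have ci : continuous (fun v : E => v) by move=> v; exact: cvg_id.
have cv (a : R) : expR (a * (enorm (x - y) * r / t)) * mixture mu t y @[x --> y]
    --> mixture mu t y.
  pose f x := expR (a * (enorm (x - y) * r / t)) * mixture mu t y.
  have fy : f y = mixture mu t y.
    rewrite /f subrr /enorm big1 ?sqrtr0 ?mul0r ?mulr0 ?expR0 ?mul1r//.
    by move=> i _; rewrite mxE expr0n.
  rewrite -[X in _ --> X]fy.
  have cB : {for y, continuous (fun x : E => x - y)}.
    exact: (continuousB (ci y) (@cst_continuous _ _ y y)).
  have cE := continuous_comp cB (@continuous_enorm _).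
  have cR (c : R) : {for y, continuous (fun=> c : R)} by exact: cst_continuous.
  have c2 := continuousM (cR a) (continuousM (continuousM cE (cR r)) (cR t^-1)).
  exact: (continuousM (continuous_comp c2 (@continuous_expR _ _)) (cR _)).
apply: (squeeze_cvgr _ (cv (- 1)) (cv 1)).
near=> x; apply/andP; split.
  rewrite mulN1r expRN mulrC ler_pdivrMr ?expR_gt0// mulrC enormB.
  exact: mixture_shift_le.
by rewrite mul1r; exact: mixture_shift_le.
Unshelve. all: by end_near. Qed.

Lemma continuous_smoothed_density : continuous smoothed_density.
Proof.
move=> y.
have ci : continuous (fun v : E => v) by move=> v; exact: cvg_id.
have cR (c : R) : {for y, continuous (fun=> c : R)} by exact: cst_continuous.
have c1 := continuousN (continuousM (continuous_dot ci ci (x := y)) (cR (2 * t)^-1)).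
exact: (continuousM (@continuous_mixture y)
  (continuousM (cR _) (continuous_comp c1 (@continuous_expR _ _)))).
Qed.

Lemma smoothed_density_gt0 y : 0 < smoothed_density y.
Proof.
have st : Num.sqrt t != 0 by rewrite gt_eqF// sqrtr_gt0.
rewrite mulr_gt0 ?(mixture_gt0 mur)// mulr_gt0 ?expR_gt0//.
by rewrite exprn_gt0// normal_peak_gt0.
Qed.

Lemma smoothed_law_density G : measurable_fun setT G -> (forall x, 0 <= G x)%E ->
  (smoothed_law mu t G =
   \int[lebesgue_rowvec R n]_y (G y * (smoothed_density y)%:E))%E.
Proof.
move=> mG G0; have mM := measurable_mixture mu t0.
have M0 y : 0 <= mixture mu t y by exact: ltW (mixture_gt0 mur y t0).
rewrite /smoothed_law ge0_integral_gaussian_density//.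
- by apply: eq_integral => y _; rewrite prod_normal_pdf -muleA -EFinM.
- by apply: emeasurable_funM => //; exact: measurable_fun_EFin.
- by move=> y; rewrite mule_ge0// lee_fin.
Qed.

(** The densities of the theorem are specified by their continuity and the law alone; identifying
    them with a formula makes their score computable. *)
Lemma density_smoothed dO (Omega : measurableType dO) (P : probability Omega R)
    (Y : Omega -> E) (p : E -> R) :
  measurable_fun setT Y -> continuous_density P Y p ->
  (forall G, measurable_fun setT G -> (forall x, 0 <= G x)%E ->
    \int[P]_w G (Y w) = smoothed_law mu t G)%E ->
  p = smoothed_density.
Proof.
move=> mY [cp p0 Yp] Ymu.
apply: continuous_density_unique => //; first exact: continuous_smoothed_density.
  by move=> y; exact/ltW/smoothed_density_gt0.
move=> A mA; rewrite -Yp//.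
have mI : measurable_fun setT (fun x : E => (\1_A x : R)%:E).
  by apply: measurable_fun_EFin; exact: measurable_indic.
have I0 (x : E) : (0 <= (\1_A x : R)%:E)%E by rewrite lee_fin.
have := Ymu _ mI I0; rewrite smoothed_law_density//.
have mYA := measurable_preimage mY mA.
rewrite (_ : (\int[P]_w (\1_A (Y w))%:E = P (Y @^-1` A))%E); last first.
  by rewrite -[X in P X](setIT (Y @^-1` A)) -integral_indic.
move=> ->; rewrite [RHS]integral_mkcond; apply: eq_integral => y _.
rewrite indicE patchE; case: (y \in A); first by rewrite mul1e.
by rewrite mul0e.
Qed.

(** Differentiation under the integral sign. As [|a| <= e^a + e^-a], the derivative of the integrand
    at [x] is dominated by its values at [x + 1] and [x - 1], which [cameron_martin_le] bounds
    uniformly in [z]. *)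
Lemma is_derive_mixture (y : E) (i : 'I_n) :
  is_derive (0 : R) (1 : R) (fun h : R => mixture mu t (h *: delta_mx ord0 i + y))
    (post_mean mu t y ord0 i * mixture mu t y / t).
Proof.
have aux (x : R) : -1 < x -> x < 1 -> -2 < x + 1 < 2 /\ -2 < x - 1 < 2.
  by move=> x1 x2; split; apply/andP; split; lra.
set e : E := delta_mx ord0 i.
pose f (x : R) (z : E) := cameron_martin t (x *: e + y) z.
have dote (u : E) : dot e u = u ord0 i by rewrite dotC dot_delta.
have fE x z : f x z = expR (x * (z ord0 i / t) + (dot y z - dot z z / 2) / t).
  by rewrite /f /cameron_martin dotDl dotZl dote; congr expR; ring.
have df x z : is_derive x (1 : R) (f^~ z) (z ord0 i / t * f x z).
  pose l := (z ord0 i / t) \*: (id : R -> R) + cst ((dot y z - dot z z / 2) / t).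
  have fl x' : expR (l x') = f x' z.
    by rewrite fE /l !fctE /=; congr (expR (_ + _)); exact: mulrC.
  have -> : f^~ z = expR \o l by apply/funext => x'; rewrite -fl.
  have dl : is_derive x (1 : R) l (z ord0 i / t).
    by apply: is_derive_eq; rewrite addr0 /GRing.scale/= mulr1.
  by apply: (is_derive_eq (is_derive1_comp (is_derive_expR (l x)) dl)); rewrite fl mulrC.
have e1 : e ord0 i = 1 by rewrite mxE !eqxx.
(* The interval []-2, 2[] leaves room for the shifts by 1; the constant is
   [|x e + y|^2 <= 2 x^2 + 2 |y|^2]. *)
have f_le (x : R) z : -2 < x < 2 -> f x z <= expR ((8 + 2 * dot y y) / (2 * t)).
  move=> /andP[x1 x2]; apply: (le_trans (cameron_martin_le _ _ t0)).
  rewrite ler_expR ler_pM2r ?invr_gt0 ?mulr_gt0//.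
  have := dot_le (x *: e) y.
  rewrite dotZl dote dotZr dotZl dote e1 => H.
  rewrite !dotDl !dotDr !dotZl !dotZr (dotC y e) !dote e1; nra.
pose C : R := 2 * expR ((8 + 2 * dot y y) / (2 * t)).
have C0 : 0 <= C by rewrite mulr_ge0 ?expR_ge0.
have df_le (x : R) z : `]-1, 1[%classic x -> setT z -> `|partial1of2 f x z| <= C.
  rewrite /= in_itv/= => /andP[x1 x2] _.
  rewrite /partial1of2 derive1E (@derive_val _ _ _ _ _ _ _ (df x z)).
  set a := z ord0 i / t; rewrite normrM (gtr0_norm (cameron_martin_gt0 _ _ _)).
  have f0 : 0 < f x z := cameron_martin_gt0 _ _ _.
  have fD (b : R) : f (x + b) z = expR (b * a) * f x z.
    by rewrite !fE -expRD; congr expR; rewrite -/a; ring.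
  apply: (@le_trans _ _ (f (x + 1) z + f (x - 1) z)).
    rewrite !fD -mulrDl ler_pM2r// mul1r mulN1r.
    have := expR_ge1Dx a; have := expR_ge1Dx (- a).
    have := expR_gt0 a; have := expR_gt0 (- a).
    by rewrite ler_norml => *; apply/andP; split; lra.
  have [x3 x4] := aux x x1 x2.
  by rewrite /C mulr_natl mulr2n lerD// f_le.
have i0 : `]-1, 1[%classic (0 : R) by rewrite /= in_itv/= ltrN10 ltr01.
have intf (x : R) : `]-1, 1[%classic x -> mu.-integrable setT (EFin \o f x).
  by move=> _; exact: integrable_cameron_martin.
have derf (x : R) z : `]-1, 1[%classic x -> setT z -> derivable (f^~ z) x 1.
  by move=> _ _; apply: ex_derive; exact: df.
have intC : mu.-integrable setT (EFin \o (fun=> C)).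
  by apply: (@ae_bounded_integrable _ _ _ mu (fun=> C) C) => //; apply: aeW => z; rewrite ger0_norm.
have C0' (z : E) : 0 <= C by [].
have dM := @derivable_under_integral R _ E mu f setT measurableT 0 (-1) 1 i0 intf derf
  (fun=> C) C0' intC df_le.
have eM := @differentiation_under_integral R _ E mu f setT measurableT 0 (-1) 1 i0 intf derf
  (fun=> C) C0' intC df_le.
apply: DeriveDef; first exact: dM.
apply: (etrans (etrans (esym (derive1E _ _)) eM)).
rewrite (post_mean_mixture mur)//.
rewrite mulrC -(RintegralZl _ measurableT (integrable_coord_cameron_martin mur y i t0)).
apply: eq_Rintegral => z _.
rewrite /partial1of2 derive1E (@derive_val _ _ _ _ _ _ _ (df 0 z)).
by rewrite /f scale0r add0r mulrAC mulrC.
Qed.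

(** Tweedie's formula. Along [e_i] the log density is [ln mixture] plus a quadratic polynomial whose
    derivative at 0 is [- y_i / t]. *)
Lemma gradient_ln_smoothed_density (y : E) :
  gradient (fun x => ln (smoothed_density x)) y = t^-1 *: (post_mean mu t y - y).
Proof.
apply/rowP => i; rewrite [LHS]mxE.
have -> : (t^-1 *: (post_mean mu t y - y)) 0 i =
    t^-1 * (post_mean mu t y ord0 i - y ord0 i).
  by rewrite mxE [(_ - y) _ _]mxE [(- y) _ _]mxE.
set e : E := delta_mx ord0 i.
have dote (u : E) : dot e u = u ord0 i by rewrite dotC dot_delta.
pose K := normal_peak (Num.sqrt t) ^+ n.
have st : Num.sqrt t != 0 by rewrite gt_eqF// sqrtr_gt0.
have K0 : 0 < K by rewrite exprn_gt0// normal_peak_gt0.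
pose M h := mixture mu t (h *: e + y).
pose c := ln K - dot y y / (2 * t).
pose q x := c + (- (y ord0 i / t) * x + (- (2 * t)^-1) * (x * x)).
pose g : R -> R := (@ln R \o M) + q.
have e1 : e ord0 i = 1 by rewrite mxE !eqxx.
transitivity ('D_1 g 0).
  have gE x : ln (smoothed_density (x *: e + y)) = g x.
    rewrite /smoothed_density lnM ?posrE ?(mixture_gt0 mur) ?mulr_gt0 ?expR_gt0//.
    rewrite lnM ?posrE ?expR_gt0// expRK; congr (_ + _).
    rewrite !dotDl !dotDr !dotZl !dotZr (dotC y e) !dote e1.
    rewrite -/K /q /c.
    by field; exact: lt0r_neq0.
  rewrite /derive; set F1 := (fun h : R => _); set F2 := (fun h : R => _).
  suff -> : F1 = F2 by [].
  apply/funext => h; rewrite /F1 /F2 /=.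
  by rewrite -!gE scale0r add0r addr0 [h *: 1]/GRing.scale/= mulr1.
have M0 : 0 < M 0 by exact: (mixture_gt0 mur).
have dM := is_derive_mixture y i.
have dln := is_derive1_comp (is_derive1_ln M0) dM.
have dg := is_deriveD dln (is_derive_quadratic (- (y ord0 i / t)) (- (2 * t)^-1) c).
have mN0 := lt0r_neq0 (mixture_gt0 mur y t0).
apply: (etrans (@derive_val _ _ _ _ _ _ _ dg)).
rewrite /M scale0r add0r.
by field; rewrite mN0 lt0r_neq0.
Qed.

End smoothed_density.

(** * Propagation of the error *)

Section error_propagation_weights.
Context (R : realType) (rho eps h : R).
Hypotheses (rho0 : 0 < rho) (h0 : 0 < h) (heps : h <= eps).

(** The forward time at which the drift is evaluated when [j] sampler steps remain. *)
Definition time_left (j : nat) : R := eps + h * j%:R.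

Definition lipschitz_factor (t : R) : R := 1 + h * (rho / t ^+ 2 - 1 / t).

(* Bounds the product of the Lipschitz factors of the last j steps. *)
Definition propagation_weight (j : nat) : R :=
  expR (rho / eps - rho / time_left j) * ((eps + h) / (time_left j + h)).

Let eps0 : 0 < eps. Proof. exact: lt_le_trans heps. Qed.

Let eh0 : 0 < eps + h. Proof. exact: addr_gt0. Qed.

Lemma time_left_ge j : eps <= time_left j.
Proof. by rewrite lerDl mulr_ge0 ?(ltW h0). Qed.

Lemma time_left_gt0 j : 0 < time_left j.
Proof. exact: lt_le_trans (time_left_ge j). Qed.

Lemma time_leftS j : time_left j.+1 = time_left j + h.
Proof. by rewrite /time_left -natr1 mulrDr mulr1 addrA. Qed.

Lemma propagation_weight0 : propagation_weight 0 = 1.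
Proof.
rewrite /propagation_weight /time_left mulr0 addr0 subrr expR0 mul1r divff//.
by rewrite gt_eqF// addr_gt0.
Qed.

Lemma propagation_weight_ge0 j : 0 <= propagation_weight j.
Proof.
have th0 : 0 < time_left j + h by rewrite addr_gt0// time_left_gt0.
exact: mulr_ge0 (expR_ge0 _) (divr_ge0 (ltW eh0) (ltW th0)).
Qed.

Lemma lipschitz_factor_ge0 t : eps <= t -> 0 <= lipschitz_factor t.
Proof.
move=> et; have t0 : 0 < t by exact: lt_le_trans et.
have : 0 <= h * (rho / t ^+ 2).
  by rewrite mulr_ge0 ?(ltW h0)// divr_ge0 ?(ltW rho0) ?sqr_ge0.
have : h / t <= 1 by rewrite ler_pdivrMr// mul1r; exact: le_trans et.
by rewrite /lipschitz_factor mulrBr mul1r; lra.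
Qed.

(** The left side is at most [(1 + a/2)^2], the difference being [(a/2 - b)^2]. *)
Lemma expR_ge_quadratic (a b : R) : 0 <= a -> 0 <= b ->
  (1 + a - b) * (1 + b) <= expR a.
Proof.
move=> a0 b0; have e1 := expR_ge1Dx (a / 2).
have -> : expR a = expR (a / 2) ^+ 2 by rewrite -expRM_natl; congr expR; field.
have : (1 + a / 2) ^+ 2 <= expR (a / 2) ^+ 2.
  by rewrite ler_sqr ?nnegrE ?expR_ge0//; lra.
apply: le_trans; have := sqr_ge0 (a / 2 - b); lra.
Qed.

(** The contracting part of the factor is at most [t / (t + h)], which telescopes, and so does the
    exponent through [h rho / t^2 <= rho / (t - h) - rho / t]. *)
Lemma propagation_weightS j :
  propagation_weight j * lipschitz_factor (time_left j.+1) <= propagation_weight j.+1.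
Proof.
set t' := time_left j; have t'0 : 0 < t' := time_left_gt0 j.
rewrite /propagation_weight -/t' time_leftS -/t'; set t := t' + h.
have t0 : 0 < t by exact: addr_gt0.
have th0 : 0 < t + h by exact: addr_gt0.
have Lle : lipschitz_factor t <= expR (h * rho / t ^+ 2) * (t / (t + h)).
  have -> : t / (t + h) = (1 + h / t)^-1.
    by field; rewrite !gt_eqF// ?addr_gt0 ?divr_gt0.
  rewrite ler_pdivlMr ?addr_gt0 ?divr_gt0//.
  have := @expR_ge_quadratic (h * rho / t ^+ 2) (h / t).
  rewrite /lipschitz_factor => H; apply: (le_trans _ (H _ _)).
  - by rewrite le_eqVlt; apply/orP; left; apply/eqP; ring.
  - by rewrite divr_ge0 ?sqr_ge0 ?mulr_ge0 ?(ltW h0) ?(ltW rho0).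
  - by rewrite divr_ge0 ?(ltW h0) ?(ltW t0).
have w0 : 0 <= expR (rho / eps - rho / t') * ((eps + h) / t).
  by rewrite mulr_ge0 ?expR_ge0// divr_ge0 ?(ltW t0) ?(ltW eh0).
apply: (le_trans (ler_wpM2l w0 Lle)).
have -> : expR (rho / eps - rho / t') * ((eps + h) / t) *
    (expR (h * rho / t ^+ 2) * (t / (t + h))) =
    expR (rho / eps - rho / t' + h * rho / t ^+ 2) * ((eps + h) / (t + h)).
  by rewrite [in RHS]expRD; move: (expR _) (expR _) => a b; field; rewrite !gt_eqF.
rewrite ler_pM2r ?divr_gt0// ler_expR -addrA lerD2l.
have -> : - (rho / t') + h * rho / t ^+ 2 = - (rho / t) - rho * h ^+ 2 / (t' * t ^+ 2).
  by rewrite {1}/t /t; field; rewrite !gt_eqF.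
rewrite gerDl oppr_le0.
exact: divr_ge0 (mulr_ge0 (ltW rho0) (sqr_ge0 _)) (mulr_ge0 (ltW t'0) (sqr_ge0 _)).
Qed.

(** Keeps the decay in time, from which the factors [1 / T] and [1 / (eps + h k)] of the final bound
    arise; [eps + h <= 2 eps] gives the 2. *)
Lemma propagation_weight_le j :
  propagation_weight j <= expR (rho / eps) * (2 * eps / time_left j.+1).
Proof.
rewrite /propagation_weight -time_leftS; have tj := time_left_gt0 j.+1.
apply: ler_pM.
- exact: expR_ge0.
- exact: divr_ge0 (ltW eh0) (ltW tj).
- by rewrite ler_expR gerBl divr_ge0 ?(ltW rho0) ?(ltW (time_left_gt0 j)).
- by rewrite ler_pM2r ?invr_gt0// mulr_natl mulr2n lerD2l.
Qed.

(** The version for the noise part, where [sum_inv_sqr_time_left_le] supplies the decay. *)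
Lemma propagation_weight_le_expR j : propagation_weight j <= expR (rho / eps).
Proof.
rewrite /propagation_weight -time_leftS; have tj := time_left_gt0 j.+1.
rewrite -[leRHS]mulr1; apply: ler_pM.
- exact: expR_ge0.
- exact: divr_ge0 (ltW eh0) (ltW tj).
- by rewrite ler_expR gerBl divr_ge0 ?(ltW rho0) ?(ltW (time_left_gt0 j)).
- by rewrite ler_pdivrMr// mul1r time_leftS lerD2r time_left_ge.
Qed.

(** Telescoping of [h / (t + h)^2 <= 1 / t - 1 / (t + h)]. *)
Lemma sum_inv_sqr_time_left_le n :
  \sum_(0 <= j < n) h / time_left j.+1 ^+ 2 <= 1 / eps - 1 / time_left n.
Proof.
elim: n => [|n IH]; first by rewrite big_geq// /time_left mulr0 addr0 subrr.
rewrite big_nat_recr//=; apply: (le_trans (lerD IH (lexx _))).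
rewrite time_leftS; have tn := time_left_gt0 n; set t := time_left n in tn *.
have th : 0 < t + h by exact: addr_gt0.
rewrite -addrA lerD2l.
have -> : - (1 / t) + h / (t + h) ^+ 2 = - (1 / (t + h)) - h ^+ 2 / (t * (t + h) ^+ 2).
  by field; rewrite !gt_eqF.
rewrite gerDl oppr_le0.
exact: divr_ge0 (sqr_ge0 _) (mulr_ge0 (ltW tn) (sqr_ge0 _)).
Qed.

End error_propagation_weights.

(** * Error recursion along the sampler *)

Section sampler_error.
Context (R : realType) (n : nat) (mu : probability 'rV[R]_n R) (r : R).
Hypothesis mur : {ae mu, forall z, enorm z <= r}.
Hypothesis r0 : 0 < r.
Notation E := 'rV[R]_n.
Notation gauss := (@gauss R n).
Hypothesis gauss_conv : forall (s t : R) (G : E -> \bar R), 0 < s -> 0 < t ->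
  measurable_fun setT G -> (forall x, 0 <= G x)%E ->
  (\int[gauss s]_v \int[gauss t]_w G (v + w)%R = \int[gauss (s + t)]_v G v)%E.

(** The mean part of the step is the difference of the Euler map at [p.1] and [p.2], controlled by
    [L], plus [h] times the score defect at [p.1]. The defect is thus taken along the exact process,
    under the law where [q] bounds it. *)
Lemma sampler_step_coupling (gamma : probability (E * E)%type R)
    (s : E -> E) (t h L e q : R) :
  0 < h -> h < t -> h <= r ^+ 2 -> 0 <= L -> 0 <= e -> 0 <= q ->
  measurable_fun setT s ->
  elipschitz L (fun x => x + h *: s x) ->
  (forall G, measurable_fun setT G -> (forall x, 0 <= G x)%E ->
    \int[gamma]_p G p.1 = smoothed_law mu t G)%E ->
  (msq gamma <= (e ^+ 2)%:E)%E ->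
  (smoothed_law mu t (fun y =>
    (enorm (t^-1 *: (post_mean mu t y - y) - s y) ^+ 2)%:E) <= (q ^+ 2)%:E)%E ->
  exists gamma' : probability (E * E)%type R,
  [/\ forall G, measurable_fun setT G -> (forall x, 0 <= G x)%E ->
        (\int[gamma']_p G p.1 = smoothed_law mu (t - h) G)%E,
      forall G, measurable_fun setT G -> (forall x, 0 <= G x)%E ->
        (\int[gamma']_p G p.2 =
         \int[gamma]_p \int[gauss 1]_g G (p.2 + h *: s p.2 + Num.sqrt h *: g)%R)%E &
      (msq gamma' <= ((L * e + h * q) ^+ 2 + 2 * n%:R * (h / t) ^+ 2 * r ^+ 2)%:E)%E].
Proof.
move=> h0 ht hr L0 e0 q0 ms sL g1 ge gq.
have t0 : 0 < t by exact: lt_trans ht.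
have mF : measurable_fun setT (fun x : E => x + h *: s x).
  by apply: measurable_fun_rowvecD => //; exact: measurable_fun_rowvecZ.
have [gamma' [g1' g2' g3']] := one_step mur gauss_conv (Num.sqrt h) h0 ht mF g1.
exists gamma'; split => //; apply: (le_trans g3').
have mpm := measurable_post_mean mur t0.
pose u (p : E * E) : E := (p.1 + h *: s p.1) - (p.2 + h *: s p.2).
pose D (y : E) : E := t^-1 *: (post_mean mu t y - y) - s y.
have mD : measurable_fun setT D.
  apply: measurable_fun_rowvecB => //; apply: measurable_fun_rowvecZ => //.
  exact: measurable_fun_rowvecB.
have mu1 : measurable_fun setT u.
  by apply: measurable_fun_rowvecB; [exact: (measurableT_comp mF measurable_fst)|
    exact: (measurableT_comp mF measurable_snd)].
have mhD : measurable_fun setT (fun p : E * E => h *: D p.1).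
  by apply: measurable_fun_rowvecZ => //; exact: (measurableT_comp mD measurable_fst).
have mB : measurable_fun setT (fun p : E * E => p.1 - p.2).
  exact: measurable_fun_rowvecB.
have m2 (w : E * E -> E) : measurable_fun setT w ->
    measurable_fun setT (fun p => (enorm (w p) ^+ 2)%:E).
  by move=> mw; apply: measurable_fun_EFin; apply: measurable_funX; exact: measurable_fun_enorm.
have Q0 (x : R) : (0 <= (x ^+ 2)%:E)%E by rewrite lee_fin sqr_ge0.
have u_le : (\int[gamma]_p (enorm (u p) ^+ 2)%:E <= ((L * e) ^+ 2)%:E)%E.
  rewrite exprMn (EFinM (L ^+ 2)).
  apply: (@le_trans _ _ (\int[gamma]_p ((L ^+ 2)%:E * (enorm (p.1 - p.2) ^+ 2)%:E))%E).
    apply: ge0_le_integral_nonmeasurable => p _; first exact: Q0.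
    rewrite -EFinM lee_fin -exprMn ler_sqr ?nnegrE ?mulr_ge0 ?enorm_ge0//.
    exact: sL.
  rewrite (ge0_integralZl _ measurableT (m2 _ mB) (fun p _ => Q0 _) (Q0 _)).
  by apply: lee_wpmul2l.
have D_le : (\int[gamma]_p (enorm (h *: D p.1) ^+ 2)%:E <= ((h * q) ^+ 2)%:E)%E.
  have mDE : measurable_fun setT (fun y => (enorm (D y) ^+ 2)%:E).
    by apply: measurable_fun_EFin; apply: measurable_funX; exact: measurable_fun_enorm.
  have mDE1 := measurableT_comp mDE (@measurable_fst _ _ E E).
  under eq_integral do rewrite enormZ exprMn real_normK ?num_real// (EFinM (h ^+ 2)).
  rewrite exprMn (EFinM (h ^+ 2)).
  rewrite (ge0_integralZl _ measurableT mDE1 (fun p _ => Q0 _) (Q0 _)).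
  by apply: lee_wpmul2l => //; rewrite (g1 _ mDE (fun y => Q0 _)).
have Le0 : 0 <= L * e by exact: mulr_ge0.
have hq0 : 0 <= h * q by rewrite mulr_ge0 ?(ltW h0).
have M := minkowski_sqr mu1 mhD Le0 hq0 u_le D_le.
rewrite [leRHS]EFinD; apply: leeD.
  apply: le_trans M; rewrite le_eqVlt; apply/orP; left; apply/eqP.
  apply: eq_integral => p _; congr (enorm _ ^+ 2)%:E.
  rewrite /u /D; move: (post_mean mu t p.1) (s p.1) (s p.2) => m s1 s2.
  by apply/rowP => i; rewrite !mxE; field; rewrite gt_eqF.
rewrite lee_fin; set x := h / t.
have x0 : 0 < x by rewrite divr_gt0.
have x1 : x < 1 by rewrite ltr_pdivrMr// mul1r.
have -> : h * (t - h) / t = h * (1 - x) by rewrite /x; field; rewrite gt_eqF.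
rewrite sqrtrM ?(ltW h0)//.
(* For the intensities, [1 - sqrt (1 - x) <= x], and [h <= r^2] turns [h x^2] into [r^2 x^2];
   together with the equal posterior term this makes the factor 2. *)
have s1 : 1 - x <= Num.sqrt (1 - x).
  have x2 : 0 <= 1 - x by lra.
  rewrite -[leLHS](ger0_norm x2) -sqrtr_sqr ler_wsqrtr// expr2; nra.
have s2 : Num.sqrt (1 - x) <= 1.
  by rewrite -[leRHS]sqrtr1 ler_wsqrtr// gerBl ltW.
have -> : (Num.sqrt h * Num.sqrt (1 - x) - Num.sqrt h) ^+ 2 =
    h * (1 - Num.sqrt (1 - x)) ^+ 2.
  by rewrite -[in RHS](sqr_sqrtr (ltW h0)); ring.
have H1 : (1 - Num.sqrt (1 - x)) ^+ 2 <= x ^+ 2 by rewrite ler_sqr ?nnegrE; lra.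
have H2 : h * (1 - Num.sqrt (1 - x)) ^+ 2 <= r ^+ 2 * x ^+ 2.
  by apply: ler_pM => //; [exact: ltW|exact: sqr_ge0].
have n0 : 0 <= n%:R :> R by [].
have := ler_wpM2r n0 H2; lra.
Qed.

Context dO (Omega : measurableType dO) (Q : probability Omega R).
Context (s : R -> E -> E) (T eps h : R) (N : nat).
Context (Xh Z : nat -> {RV Q >-> E}).
Hypothesis EM : euler_maruyama_sampler s T h N Xh Z.
Hypotheses (h0 : 0 < h) (heps : h <= eps) (epsr : eps <= r ^+ 2).
Hypothesis TE : T = time_left eps h N.
Hypothesis ms : forall t, 0 < t -> measurable_fun setT (s t).
Hypothesis sL : forall t, eps <= t ->
  elipschitz (lipschitz_factor (r ^+ 2) h t) (fun x => x + h *: s t x).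
Context (q : nat -> R).
Hypothesis q0 : forall j, 0 <= q j.
Hypothesis sq : forall j, (0 < j <= N)%N -> let t := time_left eps h j in
  (smoothed_law mu t (fun y =>
    (enorm (t^-1 *: (post_mean mu t y - y) - s t y) ^+ 2)%:E) <= (q j ^+ 2)%:E)%E.
Context (gamma0 : probability (E * E)%type R) (e0 : R).
Hypothesis gamma0E : coupled_with_gaussian mu T gamma0.
Hypotheses (e00 : 0 <= e0) (gamma0_le : (msq gamma0 <= (e0 ^+ 2)%:E)%E).

Let w := propagation_weight (r ^+ 2) eps h.
Let v j := 2 * n%:R * (h / time_left eps h j) ^+ 2 * r ^+ 2.

(** Both bounds are multiplied by the weight of the remaining steps. As [w i * L <= w i.+1], a step
    only adds its own term, and [w 0 = 1] gives back [A] and [V] at the end. [A] holds the initial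
    and score errors, [V] the noise. *)
Lemma sampler_error_recursion k : (k <= N)%N ->
  exists gamma : probability (E * E)%type R, exists A V : R,
  [/\ 0 <= A, 0 <= V,
      (forall G, measurable_fun setT G -> (forall x, 0 <= G x)%E ->
        \int[gamma]_p G p.1 = smoothed_law mu (time_left eps h (N - k)) G)%E,
      (forall G, measurable_fun setT G -> (forall x, 0 <= G x)%E ->
        \int[gamma]_p G p.2 = \int[Q]_x G (Xh k x))%E &
      [/\ (msq gamma <= ((A + Num.sqrt V) ^+ 2)%:E)%E,
        w (N - k) * A <= w N * e0 + \sum_(N - k <= i < N) w i * (h * q i.+1) &
        w (N - k) ^+ 2 * V <= \sum_(N - k <= i < N) w i ^+ 2 * v i.+1]].
Proof.
have rho0 : 0 < r ^+ 2 by rewrite exprn_gt0.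
have eps0 : 0 < eps by exact: lt_le_trans heps.
have v0 j : 0 <= v j.
  exact: mulr_ge0 (mulr_ge0 (mulr_ge0 (ler0n _ 2) (ler0n _ n)) (sqr_ge0 _)) (sqr_ge0 _).
elim: k => [_|k IH kN].
  exists gamma0, e0, 0; rewrite subn0 -TE; case: gamma0E => g1 g2; split => //.
  - move=> G mG G0; rewrite g2//.
    have mX : measurable_fun setT (Xh 0%N) by [].
    apply: ge0_integral_has_law => // A mA; rewrite gaussE.
    by case: EM => X0 _ _ _ _; exact: X0.
  - by rewrite sqrtr0 addr0 !big_geq// addr0 mulr0; split.
have [gamma [A [V [A0 V0 g1 g2 [g3 g4 g5]]]]] := IH (ltnW kN).
set i := (N - k.+1)%N; have jE : (N - k)%N = i.+1 by rewrite /i subnSK.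
have iN : (i < N)%N by rewrite /i ltn_subrL (leq_trans _ kN).
rewrite jE in g1 g4 g5; set t := time_left eps h i.+1 in g1.
have tE : T - k%:R * h = t.
  rewrite TE /t -jE /time_left natrB ?(ltnW kN)//; ring.
have et : eps <= t by exact: time_left_ge.
have t0 : 0 < t by exact: lt_le_trans et.
have tS : t - h = time_left eps h i by rewrite /t time_leftS addrK.
have ht : h < t by rewrite -subr_gt0 tS; exact: time_left_gt0.
pose L := lipschitz_factor (r ^+ 2) h t.
have L0 : 0 <= L by exact: (lipschitz_factor_ge0 rho0 h0 heps).
have AV0 : 0 <= A + Num.sqrt V by rewrite addr_ge0 ?sqrtr_ge0.
have sqi : (0 < i.+1 <= N)%N by [].
have [gamma' [g1' g2' g3']] := sampler_step_coupling h0 ht (le_trans heps epsr) L0 AV0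
  (q0 i.+1) (ms t0) (sL et) g1 g3 (sq sqi).
have w0 j : 0 <= w j by exact: propagation_weight_ge0.
have wS : w i * L <= w i.+1 by exact: propagation_weightS.
have hq : 0 <= h * q i.+1 by rewrite mulr_ge0 ?(ltW h0).
exists gamma', (L * A + h * q i.+1), (L ^+ 2 * V + v i.+1); split.
- by rewrite addr_ge0// mulr_ge0.
- by rewrite addr_ge0// mulr_ge0// sqr_ge0.
- by move=> G mG G0; rewrite g1'// tS.
- move=> G mG G0; rewrite g2'//.
  have mk j : (j < N)%N -> measurable_fun setT (s (T - j%:R * h)).
    move=> jN; apply: ms; rewrite TE /time_left.
    rewrite -addrA addr_gt0// mulrC -mulrBl mulr_gt0// subr_gt0 ltr_nat//.
  rewrite (sampler_step_law EM mk h0 kN mG G0).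
  have mH : measurable_fun setT (fun x : E => \int[gauss 1]_g
      G (x + h *: s t x + Num.sqrt h *: g)%R)%E.
    apply: (@measurable_ge0_integral_snd _ _ _ _ _ (gauss 1) (fun x : E * E =>
      G (x.1 + h *: s t x.1 + Num.sqrt h *: x.2)%R)) => //.
    have mst := measurableT_comp (ms t0) (@measurable_fst _ _ E E).
    apply: (measurableT_comp mG); apply: measurable_fun_rowvecD.
      by apply: measurable_fun_rowvecD => //; exact: measurable_fun_rowvecZ.
    exact: measurable_fun_rowvecZ.
  rewrite (g2 _ mH); last by move=> x; exact: integral_ge0.
  by apply: eq_integral => x _; rewrite /euler_drift tE.
split.
- apply: (le_trans g3'); rewrite lee_fin -/(v i.+1).
  have C := sqrt_chain_le A0 V0 hq (v0 i.+1) L0.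
  rewrite -[leLHS]sqr_sqrtr; last by rewrite addr_ge0 ?sqr_ge0.
  by rewrite ler_sqr ?nnegrE// (le_trans (sqrtr_ge0 _) C).
- rewrite big_ltn// mulrDr [leRHS]addrCA [leLHS]addrC lerD2l mulrA.
  by apply: (le_trans _ g4); exact: ler_wpM2r.
- rewrite big_ltn// mulrDr [leLHS]addrC lerD2l mulrA -exprMn.
  apply: (le_trans _ g5); apply: ler_wpM2r => //.
  by rewrite ler_sqr ?nnegrE// mulr_ge0.
Qed.

Lemma sampler_error : exists gamma : probability (E * E)%type R,
  [/\ (forall G, measurable_fun setT G -> (forall x, 0 <= G x)%E ->
        \int[gamma]_p G p.1 = smoothed_law mu eps G)%E,
      (forall G, measurable_fun setT G -> (forall x, 0 <= G x)%E ->
        \int[gamma]_p G p.2 = \int[Q]_x G (Xh N x))%E &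
      (msq gamma <= ((2 * eps / T * expR (r ^+ 2 / eps) * e0 +
        Num.sqrt (2 * n%:R) * (r ^+ 2 / eps) * expR (r ^+ 2 / eps) * Num.sqrt h +
        2 * eps * expR (r ^+ 2 / eps) * h *
          \sum_(1 <= j < N.+1) q j / time_left eps h j) ^+ 2)%:E)%E].
Proof.
have rho0 : 0 < r ^+ 2 by rewrite exprn_gt0.
have eps0 : 0 < eps by exact: lt_le_trans heps.
have [gamma [A [V [A0 V0 g1 g2 [g3 g4 g5]]]]] := sampler_error_recursion (leqnn N).
exists gamma; rewrite subnn in g1 g4 g5; split => //.
  by move=> G mG G0; rewrite g1// /time_left mulr0 addr0.
have T0 : 0 < T by rewrite TE; exact: time_left_gt0.
have S0 : 0 <= \sum_(1 <= j < N.+1) q j / time_left eps h j.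
  by apply: sumr_ge0 => j _; rewrite divr_ge0// (ltW (time_left_gt0 h0 heps j)).
set Ex := expR (r ^+ 2 / eps) in g4 g5 *; have Ex0 : 0 <= Ex by exact: expR_ge0.
have w1 : w 0%N = 1 by exact: propagation_weight0.
rewrite w1 ?expr1n mul1r in g4; rewrite w1 expr1n mul1r in g5.
have A_le : A <= 2 * eps / T * Ex * e0 +
    2 * eps * Ex * h * \sum_(1 <= j < N.+1) q j / time_left eps h j.
  apply: (le_trans g4); apply: lerD.
    apply: ler_wpM2r => //; rewrite mulrC.
    apply: (le_trans (propagation_weight_le rho0 h0 heps N)).
    (* The weight has [T + h] in its denominator, weakened to [T]. *)
    rewrite ler_wpM2l// TE time_leftS.
    have tN := time_left_gt0 h0 heps N.
    by rewrite ler_pM2l ?mulr_gt0// lef_pV2 ?posrE ?lerDl ?(ltW h0)// addr_gt0.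
  rewrite mulr_sumr big_add1/= !big_mkord; apply: ler_sum => j _.
  have := ler_wpM2r (mulr_ge0 (ltW h0) (q0 j.+1)) (propagation_weight_le rho0 h0 heps j).
  by move/le_trans; apply; rewrite -/Ex le_eqVlt; apply/orP; left; apply/eqP; ring.
have V_le : V <= (Num.sqrt (2 * n%:R) * (r ^+ 2 / eps) * Ex * Num.sqrt h) ^+ 2.
  have c0 : 0 <= 2 * n%:R * (r ^+ 2 * h) * Ex ^+ 2.
    apply: mulr_ge0 (sqr_ge0 _); apply: mulr_ge0 (mulr_ge0 (ltW rho0) (ltW h0)).
    exact: mulr_ge0 (ler0n _ 2) (ler0n _ n).
  apply: (@le_trans _ _ (2 * n%:R * (r ^+ 2 * h) * Ex ^+ 2 *
      \sum_(0 <= j < N) h / time_left eps h j.+1 ^+ 2)).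
    apply: (le_trans g5); rewrite mulr_sumr !big_mkord; apply: ler_sum => j _.
    have wE : w j ^+ 2 <= Ex ^+ 2.
      rewrite ler_sqr ?nnegrE ?propagation_weight_ge0//.
      exact: propagation_weight_le_expR.
    have vj0 : 0 <= v j.+1.
      exact: mulr_ge0 (mulr_ge0 (mulr_ge0 (ler0n _ 2) (ler0n _ n)) (sqr_ge0 _)) (sqr_ge0 _).
    apply: (le_trans (ler_wpM2r vj0 wE)).
    rewrite /v expr_div_n le_eqVlt; apply/orP; left; apply/eqP.
    have := lt0r_neq0 (time_left_gt0 h0 heps j.+1) => tN0.
    by field.
  apply: (le_trans (ler_wpM2l c0 (sum_inv_sqr_time_left_le h0 heps N))).
  apply: (@le_trans _ _ (2 * n%:R * (r ^+ 2 * h) * Ex ^+ 2 * (1 / eps))).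
    by rewrite ler_wpM2l// gerBl divr_ge0// (ltW (time_left_gt0 h0 heps N)).
  have -> : (Num.sqrt (2 * n%:R) * (r ^+ 2 / eps) * Ex * Num.sqrt h) ^+ 2 =
      2 * n%:R * (r ^+ 2 * h) * Ex ^+ 2 * (1 / eps) * (r ^+ 2 / eps).
    rewrite !exprMn !sqr_sqrtr ?mulr_ge0 ?(ltW h0)//.
    by field; rewrite gt_eqF.
  have c1 : 0 <= 2 * n%:R * (r ^+ 2 * h) * Ex ^+ 2 * (1 / eps).
    exact: mulr_ge0 c0 (divr_ge0 ler01 (ltW eps0)).
  (* The square of the stated bound has one more factor [r^2 / eps], which is at least 1 since
     [eps <= r^2]. *)
  by rewrite ler_peMr// ler_pdivlMr// mul1r.
set b := Num.sqrt (2 * n%:R) * _ * _ * _ in V_le *.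
have b0 : 0 <= b.
  have re0 : 0 <= r ^+ 2 / eps by exact: divr_ge0 (ltW rho0) (ltW eps0).
  exact: mulr_ge0 (mulr_ge0 (mulr_ge0 (sqrtr_ge0 _) re0) Ex0) (sqrtr_ge0 _).
have sV : Num.sqrt V <= b by rewrite -(ger0_norm b0) -sqrtr_sqr ler_wsqrtr.
have AV0 : 0 <= A + Num.sqrt V by rewrite addr_ge0 ?sqrtr_ge0.
apply: (le_trans g3); rewrite lee_fin lerXn2r ?nnegrE//; last lra.
by apply: (le_trans AV0); lra.
Qed.

End sampler_error.

(** * Conclusion *)

Section laws.
Context dO (Omega : measurableType dO) (R : realType) (P : probability Omega R).

Lemma has_law_of_integral dE (E : measurableType dE) (Y : Omega -> E)
    (nu : {measure set E -> \bar R}) : measurable_fun setT Y ->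
  (forall G, measurable_fun setT G -> (forall x, 0 <= G x)%E ->
    \int[P]_w G (Y w) = \int[nu]_x G x)%E ->
  has_law P Y nu.
Proof.
move=> mY PY A mA.
have mI : measurable_fun setT (fun x : E => (\1_A x : R)%:E).
  by apply: measurable_fun_EFin; exact: measurable_indic.
have I0 (x : E) : (0 <= (\1_A x : R)%:E)%E by rewrite lee_fin.
have InuA : (\int[nu]_x (\1_A x)%:E = nu A)%E by rewrite integral_indic// setIT.
rewrite -InuA -(PY _ mI I0).
have mYA := measurable_preimage mY mA.
by rewrite -[X in P X](setIT (Y @^-1` A)) -integral_indic.
Qed.

Lemma integral_has_law dE (E : measurableType dE) (Y : Omega -> E)
    (nu : {measure set E -> \bar R}) (f : E -> \bar R) :
  measurable_fun setT Y -> has_law P Y nu -> measurable_fun setT f ->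
  (\int[nu]_x f x = \int[P]_w f (Y w))%E.
Proof.
move=> mY PY mf; rewrite [LHS]integralE [RHS]integralE; congr (_ - _)%E.
  rewrite (ge0_integral_has_law (f := f^\+%E) mY PY)//; last exact: measurable_funepos.
  by apply: eq_integral => w _; rewrite !funeposE.
rewrite (ge0_integral_has_law (f := f^\-%E) mY PY)//; last exact: measurable_funeneg.
by apply: eq_integral => w _; rewrite !funenegE.
Qed.

Lemma ae_has_law dE (E : measurableType dE) (Y : Omega -> E)
    (nu : {measure set E -> \bar R}) (A : set E) :
  measurable_fun setT Y -> has_law P Y nu -> measurable A ->
  {ae P, forall w, A (Y w)} -> {ae nu, forall x, A x}.
Proof.
move=> mY PY mA [B [mB PB0 AB]]; exists (~` A); split => //.
  exact: measurableC.
rewrite -PY; last exact: measurableC.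
apply/eqP; rewrite eq_le measure_ge0 andbT -PB0.
by apply: le_measure; rewrite ?inE//; apply: measurable_preimage => //; exact: measurableC.
Qed.

Lemma L2norm_le n (Y : Omega -> 'rV[R]_n) (b : R) : 0 <= b ->
  (\int[P]_w (enorm (Y w) ^+ 2)%:E <= (b ^+ 2)%:E)%E -> (L2norm P Y <= b%:E)%E.
Proof.
move=> b0 Yb; rewrite /L2norm unlock.
rewrite (eq_integral (fun w => (enorm (Y w) ^+ 2)%:E)); last first.
  by move=> w _ /=; rewrite powR_mulrn// real_normK ?num_real.
have -> : b = (b ^+ 2) `^ 2^-1 by rewrite powR12_sqrt ?sqr_ge0// sqrtr_sqr ger0_norm.
rewrite -poweR_EFin; apply: gt0_ler_poweR => //; rewrite in_itv/= leey andbT.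
  by apply: integral_ge0 => w _; rewrite lee_fin sqr_ge0.
by rewrite lee_fin sqr_ge0.
Qed.

Lemma integral_sqr_L2norm n (Y : Omega -> 'rV[R]_n) : L2norm P Y \is a fin_num ->
  (\int[P]_w (enorm (Y w) ^+ 2)%:E = (fine (L2norm P Y) ^+ 2)%:E)%E.
Proof.
move=> fY; have N0 : 0 <= fine (L2norm P Y) by rewrite fine_ge0// Lnorm_ge0.
have n2 : (2 : R) != 0 by [].
have := poweR_Lnorm P (EFin \o @enorm R n \o Y) n2.
rewrite -/(L2norm P Y) -(fineK fY) poweR_EFin powR_mulrn// => ->.
by apply: eq_integral => w _ /=; rewrite powR_mulrn// real_normK ?num_real.
Qed.

End laws.

Section denoising_coupling.
Context (R : realType) (n : nat) (mu : probability 'rV[R]_n R) (r eps : R).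
Hypothesis mur : {ae mu, forall z, enorm z <= r}.
Hypothesis eps0 : 0 < eps.
Notation E := 'rV[R]_n.

Lemma gaussian_sqr_le : (\int[gauss n eps]_v (enorm v ^+ 2)%:E <= (n%:R * eps)%:E)%E.
Proof.
have mn : measurable_fun setT (fun v : E => (enorm v ^+ 2)%:E).
  by apply: measurable_fun_EFin; apply: measurable_funX; exact: measurable_fun_enorm.
have n0 (v : E) : (0 <= (enorm v ^+ 2)%:E)%E by rewrite lee_fin sqr_ge0.
rewrite -(ge0_integral_gaussian_scale eps0 mn n0).
have := gaussian1_shift_sqr (0 : E) (Num.sqrt eps).
rewrite /enorm [X in Num.sqrt X ^+ 2]big1; last by move=> i _; rewrite mxE expr0n.
rewrite -!/(enorm _) sqrtr0 expr0n add0r sqr_sqrtr ?(ltW eps0)// mulrC.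
by under eq_integral do rewrite add0r.
Qed.

(** A posterior draw given [p.1] has law exactly [mu], and by Bayes' formula its difference with
    [p.1] is [N(0, eps I)], of [L2] norm at most [sqrt (n eps)]. The triangle inequality through
    [p.1] concludes. *)
Lemma denoising_coupling (gamma : probability (E * E)%type R)
    (nu : probability E R) (b : R) : 0 <= b ->
  (forall G, measurable_fun setT G -> (forall x, 0 <= G x)%E ->
    \int[gamma]_p G p.1 = smoothed_law mu eps G)%E ->
  (forall G, measurable_fun setT G -> (forall x, 0 <= G x)%E ->
    \int[gamma]_p G p.2 = \int[nu]_x G x)%E ->
  (msq gamma <= (b ^+ 2)%:E)%E ->
  (W2 mu nu <= (Num.sqrt (n%:R * eps) + b)%:E)%E.
Proof.
move=> b0 g1 g2 g3.
have [Gamma GammaE] := posterior_coupling mur gamma eps0.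
have M0 y : 0 < mixture mu eps y := mixture_gt0 mur y eps0.
have Mi0 y : (0 <= (mixture mu eps y)^-1%:E)%E by rewrite lee_fin invr_ge0 ltW.
have C0 (y z : E) : (0 <= (cameron_martin eps y z)%:E)%E.
  by rewrite lee_fin ltW// cameron_martin_gt0.
have mC y : measurable_fun setT (fun z : E => (cameron_martin eps y z)%:E).
  by apply: measurable_fun_EFin; exact: measurable_cameron_martinr.
have GammaP G : measurable_fun setT G -> (forall x, 0 <= G x)%E ->
    (\int[Gamma]_x G x.1 = \int[gamma]_p G p)%E.
  move=> mG G0; have mG1 := measurableT_comp mG (@measurable_fst _ _ (E * E)%type E).
  rewrite (GammaE _ mG1 (fun=> G0 _)); apply: eq_integral => p _ /=.
  rewrite (ge0_integralZl _ measurableT (mC p.1) (fun z _ => C0 _ z) (G0 p)).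
  by rewrite -mixtureE// muleCA -EFinM mulVf ?mule1// gt_eqF.
have GammaZ G : measurable_fun setT G -> (forall x, 0 <= G x)%E ->
    (\int[Gamma]_x G (x.1.1, x.2) = \int[mu]_z \int[gauss n eps]_v G ((v + z)%R, z))%E.
  move=> mG G0.
  have mG1 : measurable_fun setT (fun x : E * E * E => G (x.1.1, x.2)).
    apply: (measurableT_comp mG); apply: measurable_fun_pair => //.
    exact: (measurableT_comp measurable_fst measurable_fst).
  rewrite (GammaE _ mG1 (fun=> G0 _)) /=.
  pose H y := ((mixture mu eps y)^-1%:E *
    \int[mu]_z (G (y, z) * (cameron_martin eps y z)%:E))%E.
  have mGC : measurable_fun setT (fun x : E * E => G x * (cameron_martin eps x.1 x.2)%:E)%E.
    apply: emeasurable_funM => //; apply: measurable_fun_EFin.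
    exact: measurable_cameron_martin.
  have GC0 (x : E * E) : (0 <= G x * (cameron_martin eps x.1 x.2)%:E)%E by rewrite mule_ge0.
  have mH : measurable_fun setT H.
    apply: emeasurable_funM.
      by apply: measurable_fun_EFin; exact: (measurable_mixtureV mur).
    exact: (measurable_ge0_integral_snd mu mGC GC0).
  have H0 y : (0 <= H y)%E.
    by rewrite mule_ge0//; apply: integral_ge0 => z _; exact: (GC0 (y, z)).
  rewrite (g1 _ mH H0) /smoothed_law -smoothed_law_kernel//.
  apply: eq_integral => y _; rewrite /H muleC muleA -EFinM divff ?mul1e//.
  by rewrite gt_eqF.
(* Forgets [p.1] and keeps the posterior draw with the sampler output. *)
pose phi (x : E * E * E) : E * E := (x.2, x.1.2).
have mphi : measurable_fun setT phi.
  apply: measurable_fun_pair => //.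
  exact: (measurableT_comp measurable_snd measurable_fst).
have [|gamma' gamma'E] := @weighted_image_probability _ _ _ _ R Gamma phi (fun=> 1) mphi
    (measurable_cst _) (fun=> ler01).
  exact: integral_prob_cst.
have {}gamma'E G : measurable_fun setT G -> (forall x, 0 <= G x)%E ->
    (\int[gamma']_p G p = \int[Gamma]_x G (x.2, x.1.2))%E.
  by move=> mG G0; rewrite gamma'E//; apply: eq_integral => x _; rewrite mule1.
have cpl : coupling mu nu gamma'.
  split; apply: has_law_of_integral => // G mG G0.
    have mG1 := measurableT_comp mG (@measurable_fst _ _ E E).
    have mG2 := measurableT_comp mG (@measurable_snd _ _ E E).
    rewrite (gamma'E _ mG1 (fun=> G0 _)) /= (GammaZ _ mG2 (fun=> G0 _)).
    by apply: eq_integral => z _ /=; rewrite integral_gaussian_cst.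
  have mG2 := measurableT_comp mG (@measurable_snd _ _ E E).
  by rewrite (gamma'E _ mG2 (fun=> G0 _)) (GammaP _ mG2 (fun=> G0 _)) g2.
have sb0 : 0 <= Num.sqrt (n%:R * eps) + b by rewrite addr_ge0 ?sqrtr_ge0.
apply: (@le_trans _ _ (L2norm gamma' (fun z => z.1 - z.2))).
  by apply: ereal_inf_lbound; exists gamma'.
apply: L2norm_le => //.
have msqr (w : E * E -> E) : measurable_fun setT w ->
    measurable_fun setT (fun p => (enorm (w p) ^+ 2)%:E).
  by move=> mw; apply: measurable_fun_EFin; apply: measurable_funX; exact: measurable_fun_enorm.
have Q0 (x : R) : (0 <= (x ^+ 2)%:E)%E by rewrite lee_fin sqr_ge0.
have mB : measurable_fun setT (fun p : E * E => p.1 - p.2) by exact: measurable_fun_rowvecB.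
have mB' : measurable_fun setT (fun p : E * E => p.2 - p.1) by exact: measurable_fun_rowvecB.
rewrite (gamma'E _ (msqr _ mB) (fun=> Q0 _)) /=.
have m11 : measurable_fun setT (fun x : E * E * E => x.1.1).
  exact: (measurableT_comp measurable_fst measurable_fst).
have m12 : measurable_fun setT (fun x : E * E * E => x.1.2).
  exact: (measurableT_comp measurable_snd measurable_fst).
have mu1 : measurable_fun setT (fun x : E * E * E => x.2 - x.1.1).
  exact: measurable_fun_rowvecB.
have mu2 : measurable_fun setT (fun x : E * E * E => x.1.1 - x.1.2).
  exact: measurable_fun_rowvecB.
have u1 : (\int[Gamma]_x (enorm (x.2 - x.1.1) ^+ 2)%:E <=
    (Num.sqrt (n%:R * eps) ^+ 2)%:E)%E.
  rewrite (GammaZ _ (msqr _ mB') (fun=> Q0 _)) sqr_sqrtr ?mulr_ge0 ?(ltW eps0)//=.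
  apply: le_trans gaussian_sqr_le.
  rewrite -[leRHS](@integral_prob_cst _ _ R mu) le_eqVlt; apply/orP; left; apply/eqP.
  apply: eq_integral => z _; apply: eq_integral => v _.
  by rewrite opprD addrCA subrr addr0 enormN.
have u2 : (\int[Gamma]_x (enorm (x.1.1 - x.1.2) ^+ 2)%:E <= (b ^+ 2)%:E)%E.
  by rewrite (GammaP _ (msqr _ mB) (fun=> Q0 _)).
have := minkowski_sqr mu1 mu2 (sqrtr_ge0 _) b0 u1 u2.
apply: le_trans; rewrite le_eqVlt; apply/orP; left; apply/eqP.
by apply: eq_integral => x _; rewrite addrA subrK.
Qed.

End denoising_coupling.

Section score.
Context dO (Omega : measurableType dO) (R : realType) (P : probability Omega R).
Context (n : nat) (mu : probability 'rV[R]_n R) (r : R).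
Hypothesis mur : {ae mu, forall z, enorm z <= r}.
Notation E := 'rV[R]_n.

(** Puts the score error in the form that the recursion uses, through the explicit density and
    Tweedie's formula. *)
Lemma score_defect_le (X : {RV P >-> E}) (B : R -> {RV P >-> E}) (t : R)
    (p : E -> R) (s : E -> E) : 0 < t ->
  has_law P X mu -> standard_brownian_motion B ->
  independent_of_family P [set t : R | 0 <= t] X B ->
  continuous_density P (fun w => X w + B t w) p ->
  measurable_fun setT s ->
  let e := score_error P (fun w => X w + B t w) p s in
  e \is a fin_num ->
  (smoothed_law mu t (fun y =>
    (enorm (t^-1 *: (post_mean mu t y - y) - s y) ^+ 2)%:E) <= (fine e ^+ 2)%:E)%E.
Proof.
move=> t0 Xmu BM XB cp ms e fe.
have mY : measurable_fun setT (fun w => X w + B t w) by exact: measurable_fun_rowvecD.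
have pE := density_smoothed mur t0 mY cp
  (fun G mG G0 => smoothed_law_brownian BM Xmu XB t0 mG G0).
have mG : measurable_fun setT (fun y : E =>
    (enorm (t^-1 *: (post_mean mu t y - y) - s y) ^+ 2)%:E).
  apply: measurable_fun_EFin; apply: measurable_funX; apply: measurable_fun_enorm.
  apply: measurable_fun_rowvecB => //; apply: measurable_fun_rowvecZ => //.
  by apply: measurable_fun_rowvecB => //; exact: (measurable_post_mean mur).
have G0 (y : E) : (0 <= (enorm (t^-1 *: (post_mean mu t y - y) - s y) ^+ 2)%:E)%E.
  by rewrite lee_fin sqr_ge0.
rewrite -(smoothed_law_brownian BM Xmu XB t0 mG G0) -integral_sqr_L2norm//.
rewrite le_eqVlt; apply/orP; left; apply/eqP; apply: eq_integral => w _.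
by rewrite pE (gradient_ln_smoothed_density mur t0).
Qed.

End score.

Theorem proposition12 (R : realType) (d : nat) (mu : probability 'rV[R]_d R) :
  exists T0 : R,
  forall (dO : measure_display) (Omega : measurableType dO)
    (P : probability Omega R) (X : {RV P >-> 'rV[R]_d}) (r : R),
  has_law P X mu ->
  0 < r ->
  {ae P, forall w, enorm (X w) <= r} ->
  (forall i : 'I_d, 'E_P[fun w => X w ord0 i] = 0)%E ->
  forall (B : R -> {RV P >-> 'rV[R]_d}) (p : R -> 'rV[R]_d -> R),
  standard_brownian_motion B ->
  independent_of_family P [set t : R | 0 <= t] X B ->
  (forall t : R, 0 < t -> continuous_density P (fun w => X w + B t w) (p t)) ->
  forall (T eps : R) (N : nat) (s : R -> 'rV[R]_d -> 'rV[R]_d),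
  let h := (T - eps) / N%:R in
  T0 <= T -> 0 < eps -> (1 <= N)%N -> eps < T -> h <= eps -> eps <= r ^+ 2 ->
  score_lipschitz_assumption r eps s ->
  forall (dO' : measure_display) (Omega' : measurableType dO')
    (Q : probability Omega' R) (Xh Z : nat -> {RV Q >-> 'rV[R]_d}),
  euler_maruyama_sampler s T h N Xh Z ->
  let eps_score t := score_error P (fun w => X w + B t w) (p t) (s t) in
  (W2 (distribution P X) (distribution Q (Xh N)) <=
    (Num.sqrt (d%:R * eps)
     + 2 * eps / T `^ (3 / 2) * expR (r ^+ 2 / eps) * r ^+ 2
     + Num.sqrt (2 * d%:R) * (r ^+ 2 / eps) * expR (r ^+ 2 / eps)
       * Num.sqrt h)%:E
    + (2 * eps * expR (r ^+ 2 / eps) * h)%:E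
      * \sum_(1 <= k < N.+1)
          (eps_score (eps + h * k%:R)%R * ((eps + h * k%:R)^-1)%R%:E))%E.
Proof.
have [[r1 [r10 mur1]]|no_radius] :=
    pselect (exists r1 : R, 0 < r1 /\ {ae mu, forall z, enorm z <= r1}); last first.
  (* When no ball carries [mu], the almost sure bound on [X] is contradictory, so any [T0]
     serves. *)
  exists 0 => dO Omega P X r Xmu r0 Xr; exfalso; apply: no_radius; exists r; split => //.
  have mA : measurable [set z : 'rV[R]_d | enorm z <= r].
    rewrite -[X in measurable X]setTI; apply: measurable_fun_le => //.
    exact: measurable_fun_enorm.
  exact: (ae_has_law (A := [set z | enorm z <= r]) _ Xmu mA Xr).
exists (8 * r1 ^+ 2) => dO Omega P X r Xmu r0 Xr X0 B p BM XB cp.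
move=> T eps N s h TT eps0 N0 epsT heps epsr [sL1 sL2].
move=> dO' Omega' Q Xh Z EM; lazy zeta.
pose eps_score t := score_error P (fun w => X w + B t w) (p t) (s t).
set S := (X in (_ + _ * X)%E).
have SE : S = (\sum_(1 <= k < N.+1) eps_score (time_left eps h k) *
    ((time_left eps h k)^-1)%:E)%E by [].
have mX : measurable_fun setT X by [].
have mur : {ae mu, forall z, enorm z <= r}.
  have mA : measurable [set z : 'rV[R]_d | enorm z <= r].
    rewrite -[X in measurable X]setTI; apply: measurable_fun_le => //.
    exact: measurable_fun_enorm.
  exact: (ae_has_law (A := [set z | enorm z <= r]) _ Xmu mA Xr).
have mu0 i : \int[mu]_z (z ord0 i) = 0.
  have := X0 i; rewrite unlock.
  have mi : measurable_fun setT (fun z : 'rV[R]_d => (z ord0 i)%:E).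
    by apply: measurable_fun_EFin; exact: measurable_rowvec_coord.
  by rewrite -(integral_has_law mX Xmu mi) /Rintegral => ->.
have NR : 0 < N%:R :> R by rewrite ltr0n.
have h0 : 0 < h by rewrite divr_gt0// subr_gt0.
have TE : T = time_left eps h N by rewrite /time_left /h; field; rewrite gt_eqF.
have T0 : 0 < T by exact: lt_trans epsT.
have gc := gauss_conv_brownian BM.
have rho0 : 0 < r ^+ 2 by rewrite exprn_gt0.
(* [T] is compared with [r1] while the claim is stated with [r]. The minimum is an admissible radius
   with [8 r'^2 <= T], and its initial error is at most the one stated with [r]. *)
pose r' := Num.min r r1.
have r'0 : 0 < r' by rewrite lt_min r0.
have mur' : {ae mu, forall z, enorm z <= r'}.
  by apply: filterS2 mur mur1 => z zr zr1; rewrite le_min zr.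
have r'r : r' ^+ 2 <= r ^+ 2 by rewrite ler_sqr ?nnegrE ?(ltW r0) ?(ltW r'0)// ge_min lexx.
have r'T : 8 * r' ^+ 2 <= T.
  apply: le_trans TT; rewrite ler_pM2l// ler_sqr ?nnegrE ?(ltW r10) ?(ltW r'0)//.
  by rewrite ge_min lexx orbT.
have [gamma0 gamma0E gamma0_le] := initial_coupling mur' mu0 r'0 gc r'T.
have sT0 : 0 < Num.sqrt T by rewrite sqrtr_gt0.
have e00 : 0 <= r ^+ 2 / Num.sqrt T by rewrite divr_ge0 ?(ltW rho0) ?(ltW sT0).
have gamma0_le' : (msq gamma0 <= ((r ^+ 2 / Num.sqrt T) ^+ 2)%:E)%E.
  apply: (le_trans gamma0_le); rewrite lee_fin ler_sqr ?nnegrE//.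
    by rewrite ler_pM2r ?invr_gt0.
  by rewrite divr_ge0 ?sqr_ge0 ?(ltW sT0).
have ms t : 0 < t -> measurable_fun setT (s t).
  by move=> t0; exact: (elipschitz_measurable (sL1 t t0)).
have sL t : eps <= t ->
    elipschitz (lipschitz_factor (r ^+ 2) h t) (fun x => x + h *: s t x).
  by move=> et; exact: sL2.
have es0 t : (0 <= eps_score t)%E by exact: Lnorm_ge0.
have tl0 j : 0 < time_left eps h j by exact: time_left_gt0.
have Ex0 : 0 < expR (r ^+ 2 / eps) by exact: expR_gt0.
(* If some score error is infinite, so is the right side, its coefficients being positive; otherwise
   the errors are real numbers. *)
have [fin|inf] := pselect (forall j, (0 < j <= N)%N ->
    eps_score (time_left eps h j) \is a fin_num); last first.
  have -> : S = +oo%E.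
    rewrite SE; apply/esum_eqyP.
      move=> j _; rewrite gt_eqF// (lt_le_trans (ltNyr 0))// mule_ge0//.
      by rewrite lee_fin invr_ge0 ltW// (tl0 j).
    have /existsNP[j /not_implyP[jN /negP nfin]] := inf.
    exists j; split => //; first by rewrite mem_index_iota ltnS.
    have : eps_score (time_left eps h j) = +oo%E.
      by apply/eqP; move: nfin; rewrite ge0_fin_numE// -leNgt leye_eq.
    by move=> ->; rewrite gt0_mulye// lte_fin invr_gt0 (tl0 j).
  have c0 : (0 < (2 * eps * expR (r ^+ 2 / eps) * h)%:E)%E.
    by rewrite lte_fin; exact: mulr_gt0 (mulr_gt0 (mulr_gt0 (ltr0Sn _ 1) eps0) Ex0) h0.
  by rewrite gt0_muley// addey// leey.
pose q j := if (0 < j <= N)%N then fine (eps_score (time_left eps h j)) else 0.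
have q0 j : 0 <= q j by rewrite /q; case: ifP => // _; rewrite fine_ge0.
have sq j : (0 < j <= N)%N -> let t := time_left eps h j in
    (smoothed_law mu t (fun y =>
      (enorm (t^-1 *: (post_mean mu t y - y) - s t y) ^+ 2)%:E) <= (q j ^+ 2)%:E)%E.
  move=> jN; lazy zeta; rewrite /q jN.
  exact: (score_defect_le mur (tl0 j) Xmu BM XB (cp _ (tl0 j)) (ms _ (tl0 j)) (fin j jN)).
have [gamma [g1 g2 g3]] := sampler_error mur r0 gc EM h0 heps epsr TE ms sL q0 sq
  gamma0E e00 gamma0_le'.
have Sq : S = (\sum_(1 <= j < N.+1) q j / time_left eps h j)%:E.
  rewrite SE -sumEFin; apply: eq_big_nat => j; rewrite ltnS => jN.
  by rewrite EFinM /q jN fineK// fin.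
pose b := 2 * eps / T * expR (r ^+ 2 / eps) * (r ^+ 2 / Num.sqrt T) +
  Num.sqrt (2 * d%:R) * (r ^+ 2 / eps) * expR (r ^+ 2 / eps) * Num.sqrt h +
  2 * eps * expR (r ^+ 2 / eps) * h * \sum_(1 <= j < N.+1) q j / time_left eps h j.
have b0 : 0 <= b.
  have S0 : 0 <= \sum_(1 <= j < N.+1) q j / time_left eps h j.
    by apply: sumr_ge0 => j _; rewrite divr_ge0// (ltW (tl0 j)).
  have re0 : 0 <= r ^+ 2 / eps by rewrite divr_ge0 ?(ltW rho0) ?(ltW eps0).
  have eT0 : 0 <= 2 * eps / T by rewrite divr_ge0 ?mulr_ge0 ?(ltW eps0) ?(ltW T0).
  have e20 : 0 <= 2 * eps by rewrite mulr_ge0 ?(ltW eps0).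
  apply: addr_ge0; first apply: addr_ge0.
  - exact: mulr_ge0 (mulr_ge0 eT0 (ltW Ex0)) e00.
  - exact: mulr_ge0 (mulr_ge0 (mulr_ge0 (sqrtr_ge0 _) re0) (ltW Ex0)) (sqrtr_ge0 _).
  - exact: mulr_ge0 (mulr_ge0 (mulr_ge0 e20 (ltW Ex0)) (ltW h0)) S0.
have W := denoising_coupling mur eps0 (nu := distribution Q (Xh N)) b0 g1.
(* [mu] and the law of [X] are equated on measurable sets, which is all that [coupling] tests. *)
have distribution_mu : W2 (distribution P X) (distribution Q (Xh N)) =
    W2 mu (distribution Q (Xh N)).
  rewrite /W2; congr (ereal_inf (image _ _)); apply/seteqP.
  split => gamma' [c1 c2]; split => // A mA; rewrite c1//.
    exact: Xmu.
  by rewrite -(Xmu A mA).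
rewrite distribution_mu Sq -EFinM -EFinD.
apply: (le_trans (W _ g3)).
  move=> G mG G0; rewrite g2//.
  rewrite ge0_integral_distribution//.
rewrite lee_fin le_eqVlt; apply/orP; left; apply/eqP.
(* The power [3/2] is the weight [2 eps / T] times the initial error [r^2 / sqrt T]. *)
have -> : T `^ (3 / 2) = T * Num.sqrt T.
  have -> : 3 / 2 = 1 + 2^-1 :> R by field.
  by rewrite powRD ?powRr1 ?powR12_sqrt ?(ltW T0)// (gt_eqF T0) implybT.
by rewrite /b; field; rewrite !gt_eqF.
Qed.
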